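(* Let $G=\mathbb{T}\times\mathbb{R}^n\times V\times H$ be a unimodular translation complete subgroup of $G_{aWH}$, with $V\subsetneq\widehat{\mathbb{R}^n}$. Then the quasi-regular representation $\pi|_G$ on $L^2(\mathbb{R}^n)$ does not contain a discrete series subrepresentation.
   Context: The dual group $\widehat{\mathbb{R}^n}$ is identified with $\mathbb{R}^n$ (column vectors) by associating to $\xi$ the character $x\mapsto e^{2\pi i\langle x,\xi\rangle}$. The affine Weyl-Heisenberg group is $G_{aWH}=\mathbb{T}\times\mathbb{R}^n\times\widehat{\mathbb{R}^n}\times\mathrm{GL}(n,\mathbb{R})$ with the product topology and group law $(z_1,x_1,\xi_1,h_1)(z_2,x_2,\xi_2,h_2)=(z_1z_2e^{2\pi i\langle\xi_1,h_1x_2\rangle},\,x_1+h_1x_2,\,\xi_1+h_1^{-T}\xi_2,\,h_1h_2)$, where $h^{-T}=(h^{-1})^T$. Its quasi-regular representation on $L^2(\mathbb{R}^n)$ is $\pi(z,x,\xi,h)=zT_xM_\xi D_h$, where $T_xf(y)=f(y-x)$, $M_\xi f(y)=e^{2\pi i\langle y,\xi\rangle}f(y)$, $D_hf(y)=|\det h|^{-1/2}f(h^{-1}y)$. A translation complete subgroup is a subgroup $G=\mathbb{T}\times\mathbb{R}^n\times V\times H$, where $V\subset\widehat{\mathbb{R}^n}$ is a linear subspace, $H$ is a closed subgroup of $\mathrm{GL}(n,\mathbb{R})$, and $h^TV\subset V$ for all $h\in H$; $L^2(G)$ is taken with respect to Haar measure. For a closed $\pi(G)$-invariant subspace $\mathcal{H}\subset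 L^2(\mathbb{R}^n)$, a vector $\psi\in\mathcal{H}$ is admissible for $\mathcal{H}$ if $V_\psi:\mathcal{H}\to L^2(G)$, $V_\psi f(\mathbf{x})=\langle f,\pi(\mathbf{x})\psi\rangle$, is a nonzero scalar multiple of an isometry. A discrete series subrepresentation is the restriction of $\pi|_G$ to a nonzero closed invariant subspace $\mathcal{H}$ on which it is irreducible and for which an admissible vector exists. *)

(* Defs.v *)
From HB Require Import structures.
From mathcomp Require Import all_boot all_order all_algebra.
From mathcomp Require Import all_classical all_reals all_analysis.
From mathcomp Require Import complex.
Set Implicit Arguments.
Unset Strict Implicit.
Unset Printing Implicit Defensive.
Import Order.TTheory GRing.Theory Num.Theory.
Import numFieldNormedType.Exports.
Local Open Scope classical_set_scope.
Local Open Scope ring_scope.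
Local Open Scope complex_scope.

HB.instance Definition _ (R : rcfType) := PointedTopological.copy R[i] R[i]^o.

(* Matrices and complex numbers get the sigma-algebra generated by their       *)
(* real coordinates.  Since R is second countable, it is the Borel             *)
(* sigma-algebra of their topology, and likewise for the library's product     *)
(* sigma-algebra on finite products of such spaces.                            *)
Definition mx_display : measure_display -> measure_display.
Proof. exact. Qed.

Section matrix_measurable.
Context d (T : measurableType d) (m n : nat).

Definition mx_cylinder : set (set 'M[T]_(m, n)) :=
  [set B | exists (i : 'I_m) (j : 'I_n) (A : set T),
    measurable A /\ B = [set M : 'M[T]_(m, n) | A (M i j)]].

HB.instance Definition _ := @isMeasurable.Build (mx_display d) 'M[T]_(m, n)
  <<s mx_cylinder >> (@sigma_algebra0 _ _ _) (@sigma_algebraC _ _)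
  (@sigma_algebra_bigcup _ _ _).

Lemma measurable_mx_coord i j :
  measurable_fun [set: 'M[T]_(m, n)] (fun M => M i j).
Proof.
move=> _ A mA; rewrite setTI; apply: sub_sigma_algebra.
by exists i, j, A.
Qed.

Lemma measurable_fun_mxP d' (U : measurableType d') (f : U -> 'M[T]_(m, n)) :
  (forall i j, measurable_fun setT (fun u => f u i j)) ->
  measurable_fun setT f.
Proof.
move=> mf; apply: (@measurability _ _ _ _ _ _ mx_cylinder) => //.
by move=> _ [_ [i [j [A [mA ->]]]] <-]; exact: mf.
Qed.

End matrix_measurable.

Section complex_measurable.
Context (R : realType).

Definition complex_pair (z : R[i]) : R * R := (complex.Re z, complex.Im z).

Let complex_measurable : set (set R[i]) :=
  preimage_set_system setT complex_pair measurable.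

Let sigma_algebra_complex : sigma_algebra setT complex_measurable.
Proof. exact/sigma_algebra_preimage/sigma_algebra_measurable. Qed.

Let complex_measurable0 : complex_measurable set0.
Proof. by case: sigma_algebra_complex. Qed.

Let complex_measurableC A : complex_measurable A -> complex_measurable (~` A).
Proof. by case: sigma_algebra_complex => _ h _ /h; rewrite setTD. Qed.

Let complex_measurable_bigcup (F : (set R[i])^nat) :
  (forall i, complex_measurable (F i)) -> complex_measurable (\bigcup_i F i).
Proof. by case: sigma_algebra_complex => _ _; exact. Qed.

HB.instance Definition _ :=
  @isMeasurable.Build default_measure_display R[i] complex_measurable
    complex_measurable0 complex_measurableC complex_measurable_bigcup.

End complex_measurable.

Section lebesgue_measure_cV.
Context (R : realType).

Definition cV_cons n (p : R * 'cV[R]_n) : 'cV[R]_n.+1 := col_mx p.1%:M p.2.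

Lemma cV_cons0 n (p : R * 'cV[R]_n) : cV_cons p ord0 ord0 = p.1.
Proof.
have -> : cV_cons p ord0 ord0 = col_mx p.1%:M p.2 (lshift n ord0) ord0.
  by congr (col_mx _ _ _ _); exact/val_inj.
by rewrite col_mxEu mxE mulr1n.
Qed.

Lemma cV_consS n (p : R * 'cV[R]_n) i : cV_cons p (lift ord0 i) ord0 = p.2 i ord0.
Proof.
have -> : cV_cons p (lift ord0 i) ord0 = col_mx p.1%:M p.2 (rshift 1 i) ord0.
  by congr (col_mx _ _ _ _); exact/val_inj.
by rewrite col_mxEd.
Qed.

Lemma measurable_cV_cons n : measurable_fun setT (@cV_cons n).
Proof.
apply: measurable_fun_mxP => i j; rewrite ord1.
have [k ->|->] := unliftP ord0 i.
  rewrite (_ : (fun _ => _) = (fun M : 'cV[R]_n => M k ord0) \o snd).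
    by apply: measurableT_comp => //; exact: measurable_mx_coord.
  by apply/funext => p; rewrite /= -cV_consS.
rewrite (_ : (fun _ => _) = fst) //.
by apply/funext => p; rewrite /= -[RHS]cV_cons0.
Qed.

Section cons_measure.
Context n (m : {sigma_finite_measure set 'cV[R]_n -> \bar R}).

Definition cons_measure : set 'cV[R]_n.+1 -> \bar R :=
  pushforward (lebesgue_measure \x m)%E (@cV_cons n).

Let pre_cV_cons (A : set 'cV[R]_n.+1) :
  measurable A -> measurable (@cV_cons n @^-1` A).
Proof.
by move=> mA; rewrite -[X in measurable X]setTI; exact: measurable_cV_cons.
Qed.

Let cons_measure0 : cons_measure set0 = 0%E.
Proof. by rewrite /cons_measure /pushforward preimage_set0 measure0. Qed.

Let cons_measure_ge0 A : (0 <= cons_measure A)%E.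
Proof. by rewrite /cons_measure /pushforward measure_ge0. Qed.

Let cons_measure_sigma_additive : semi_sigma_additive cons_measure.
Proof.
move=> F mF tF mUF; rewrite /cons_measure /pushforward preimage_bigcup.
apply: measure_semi_sigma_additive.
- by move=> k; exact: pre_cV_cons.
- apply/trivIsetP => /= i j _ _ ij; rewrite -preimage_setI.
  by move/trivIsetP : tF => /(_ _ _ _ _ ij) -> //; rewrite preimage_set0.
- by rewrite -preimage_bigcup; exact: pre_cV_cons.
Qed.

HB.instance Definition _ := isMeasure.Build _ _ _ cons_measure
  cons_measure0 cons_measure_ge0 cons_measure_sigma_additive.

Let uncons (v : 'cV[R]_n.+1) : R * 'cV[R]_n :=
  (v ord0 ord0, \col_i v (lift ord0 i) ord0).

Let cV_consK : cancel (@cV_cons n) uncons.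
Proof.
move=> [x v]; rewrite /uncons cV_cons0; congr pair.
by apply/colP => i; rewrite mxE cV_consS.
Qed.

Let measurable_uncons : measurable_fun setT uncons.
Proof.
apply: measurable_fun_pair; first exact: measurable_mx_coord.
apply: measurable_fun_mxP => i j.
rewrite (_ : (fun _ => _) = fun v : 'cV[R]_n.+1 => v (lift ord0 i) ord0).
  exact: measurable_mx_coord.
by apply/funext => v; rewrite mxE.
Qed.

Let cons_measure_sigma_finite : sigma_finite setT cons_measure.
Proof.
have /sigma_finiteP[F [TF ndF Foo]] := sigma_finiteT (@lebesgue_measure R).
have /sigma_finiteP[G [TG ndG Goo]] := sigma_finiteT m.
exists (fun k => uncons @^-1` (F k `*` G k)).
  apply/esym; rewrite -subTset => v _.
  have : setT (uncons v).1 by []. rewrite TF => -[k _ Fk].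
  have : setT (uncons v).2 by []. rewrite TG => -[l _ Gl].
  exists (maxn k l) => //; split.
  - by move: Fk; exact/subsetPset/ndF/leq_maxl.
  - by move: Gl; exact/subsetPset/ndG/leq_maxr.
move=> k; have [mFk Fkoo] := Foo k; have [mGk Gkoo] := Goo k; split.
  rewrite -[X in measurable X]setTI; apply: measurable_uncons => //.
  exact: measurableX.
rewrite /cons_measure /pushforward (_ : _ @^-1` _ = F k `*` G k); last first.
  by apply/seteqP; split=> p; rewrite /preimage /mkset cV_consK.
by rewrite product_measure1E // lte_mul_pinfty // ge0_fin_numE.
Qed.

HB.instance Definition _ := Measure_isSigmaFinite.Build _ _ _ cons_measure
  cons_measure_sigma_finite.

End cons_measure.

Fixpoint lebesgue_cV n : {sigma_finite_measure set 'cV[R]_n -> \bar R} :=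
  if n is n'.+1 then cons_measure (lebesgue_cV n') else dirac (0 : 'cV[R]_0).

Lemma lebesgue_cV_box n (A : 'I_n -> set R) : (forall i, measurable (A i)) ->
  lebesgue_cV n [set v | forall i, A i (v i ord0)] =
  (\prod_(i < n) lebesgue_measure (A i))%E.
Proof.
elim: n A => [|n IHn] A mA /=.
  by rewrite big_ord0 diracE mem_set // => -[].
have mB : measurable [set v : 'cV[R]_n | forall i, A (lift ord0 i) (v i ord0)].
  rewrite [X in measurable X](_ : _ = \bigcap_(i in [set: 'I_n])
      [set v : 'cV[R]_n | A (lift ord0 i) (v i ord0)]).
    apply: fin_bigcap_measurable => // i _.
    rewrite -[X in measurable X]setTI.
    exact: (measurable_mx_coord _ _ measurableT (mA (lift ord0 i))).
  by apply/seteqP; split=> v h i; [move=> _; exact: h|exact: (h i I)].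
rewrite big_ord_recl -IHn // -product_measure1E //; last exact: (mA ord0).
rewrite /cons_measure /pushforward.
rewrite (_ : _ @^-1` _ = A ord0 `*`
    [set v : 'cV[R]_n | forall i, A (lift ord0 i) (v i ord0)]) //.
apply/seteqP; split=> [[x v] /= h|[x v] /= [Ax Av] i].
  split; first by have := h ord0; rewrite cV_cons0.
  by move=> i; have := h (lift ord0 i); rewrite cV_consS.
by have [k ->|->] := unliftP ord0 i; rewrite ?cV_cons0 ?cV_consS.
Qed.

End lebesgue_measure_cV.


Section square_integrable.
Context d (T : measurableType d) (R : realType).
Variable mu : {measure set T -> \bar R}.
Implicit Types (f g : T -> R[i]) (S : set (T -> R[i])).

Definition cintegral f : R[i] :=
  Rintegral mu setT (fun x => complex.Re (f x)) +i*
  Rintegral mu setT (fun x => complex.Im (f x)).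

Definition inner f g : R[i] := cintegral (fun x => f x * (g x)^*).

Definition L2norm f : \bar R := Lnorm mu 2%:E (fun x => (complex.Re `|f x|)%:E).

(* L^2(mu) is handled through representatives: functions that agree almost    *)
(* everywhere are at L2norm-distance 0.  A closed subspace in the sense below  *)
(* is therefore saturated under almost everywhere equality.                    *)
Definition L2 : set (T -> R[i]) :=
  [set f | measurable_fun setT f /\ (L2norm f < +oo)%E].

Record closed_subspace S : Prop := ClosedSubspace {
  closed_subspace_L2 : S `<=` L2;
  closed_subspace0 : S (fun=> 0);
  closed_subspaceD : forall f g, S f -> S g -> S (f \+ g);
  closed_subspaceZ : forall (a : R[i]) f, S f -> S (fun x => a * f x);
  closed_subspace_closed : forall f, L2 f ->
    (forall e : R, 0 < e -> exists2 g, S g & (L2norm (f \- g)%R < e%:E)%E) -> S f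
}.

Definition is_zero_subspace S : Prop := forall f, S f -> L2norm f = 0%E.

End square_integrable.

Definition isometry_on d d' (T : measurableType d) (T' : measurableType d')
    (R : realType) (mu : {measure set T -> \bar R})
    (nu : {measure set T' -> \bar R}) (S : set (T -> R[i]))
    (W : (T -> R[i]) -> (T' -> R[i])) : Prop :=
  (forall f, S f -> L2 nu (W f)) /\
  (forall f g, S f -> S g -> L2norm nu (W f \- W g) = L2norm mu (f \- g)).

(* The affine Weyl-Heisenberg group is the subset aWH_group of the ambient     *)
(* space C x R^n x R^n x M_n(R); its subgroups are likewise subsets of it.     *)
Definition aWH (R : realType) (n : nat) : Type :=
  (R[i] * 'cV[R]_n * 'cV[R]_n * 'M[R]_n)%type.

HB.instance Definition _ (R : realType) (n : nat) :=
  Topological.copy (aWH R n) (R[i] * 'cV[R]_n * 'cV[R]_n * 'M[R]_n)%type.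
HB.instance Definition _ (R : realType) (n : nat) :=
  Measurable.copy (aWH R n) (R[i] * 'cV[R]_n * 'cV[R]_n * 'M[R]_n)%type.

Section affine_Weyl_Heisenberg.
Context (R : realType) (n : nat).
Implicit Types (x y xi : 'cV[R]_n) (h : 'M[R]_n) (f : 'cV[R]_n -> R[i]).
Implicit Types (V : {vspace 'cV[R]_n}) (H : set 'M[R]_n).
Implicit Types (G : set (aWH R n)) (mu : {measure set (aWH R n) -> \bar R}).

Definition dotcV x y : R := \sum_(i < n) x i ord0 * y i ord0.

(* exp (2 pi i t) *)
Definition expi (t : R) : R[i] := cos (2 * pi * t) +i* sin (2 * pi * t).

Definition aWH_group : set (aWH R n) :=
  [set g | let: (z, x, xi, h) := g in `|z| = 1 /\ h \in unitmx].

Definition aWH_mul (g1 g2 : aWH R n) : aWH R n :=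
  let: (z1, x1, xi1, h1) := g1 in
  let: (z2, x2, xi2, h2) := g2 in
  (z1 * z2 * expi (dotcV xi1 (h1 *m x2)), x1 + h1 *m x2,
   xi1 + (invmx h1)^T *m xi2, h1 *m h2).

Definition translation x f : 'cV[R]_n -> R[i] := fun y => f (y - x).

Definition modulation xi f : 'cV[R]_n -> R[i] :=
  fun y => expi (dotcV y xi) * f y.

Definition dilation h f : 'cV[R]_n -> R[i] :=
  fun y => (Num.sqrt `|\det h|)^-1%:C * f (invmx h *m y).

Definition quasi_regular (g : aWH R n) f : 'cV[R]_n -> R[i] :=
  let: (z, x, xi, h) := g in
  fun y => z * translation x (modulation xi (dilation h f)) y.

Record closed_GL_subgroup H : Prop := ClosedGLSubgroup {
  GL_subgroup_unit : forall h, H h -> h \in unitmx;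
  GL_subgroup1 : H 1%:M;
  GL_subgroupM : forall h k, H h -> H k -> H (h *m k);
  GL_subgroupV : forall h, H h -> H (invmx h);
  GL_subgroup_closed : closure H `&` [set h | h \in unitmx] `<=` H
}.

Definition translation_complete V H : Prop :=
  closed_GL_subgroup H /\ forall h v, H h -> v \in V -> h^T *m v \in V.

Definition tc_group V H : set (aWH R n) :=
  [set g | let: (z, x, xi, h) := g in [/\ aWH_group g, xi \in V & H h]].

(* A Haar measure on G is represented by a Borel measure of the ambient space  *)
(* that is concentrated on G.  Regularity is automatic for Borel measures that *)
(* are finite on compact sets, since G is locally compact and second           *)
(* countable.                                                                  *)
Record left_Haar G mu : Prop := LeftHaar {
  Haar_carrier : mu (~` G) = 0%E;
  Haar_neq0 : mu G <> 0%E;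
  Haar_compact : forall K, compact K -> K `<=` G -> (mu K < +oo)%E;
  Haar_left_invariant : forall g A, G g -> measurable A -> A `<=` G ->
    mu (aWH_mul g @` A) = mu A
}.

Definition right_invariant G mu : Prop :=
  forall g A, G g -> measurable A -> A `<=` G ->
    mu ((fun a => aWH_mul a g) @` A) = mu A.

Definition unimodular G : Prop := forall mu, left_Haar G mu -> right_invariant G mu.

Definition invariant G (S : set ('cV[R]_n -> R[i])) : Prop :=
  forall g f, G g -> S f -> S (quasi_regular g f).

Definition irreducible_on G (S : set ('cV[R]_n -> R[i])) : Prop :=
  ~ is_zero_subspace (lebesgue_cV R n) S /\
  forall K, closed_subspace (lebesgue_cV R n) K -> invariant G K -> K `<=` S ->
    is_zero_subspace (lebesgue_cV R n) K \/ K = S.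

(* Extended by 0 outside G, in accordance with mu (~` G) = 0. *)
Definition voice_transform G (psi f : 'cV[R]_n -> R[i]) : aWH R n -> R[i] :=
  fun g => if g \in G then inner (lebesgue_cV R n) f (quasi_regular g psi) else 0.

Definition admissible G mu (S : set ('cV[R]_n -> R[i]))
    (psi : 'cV[R]_n -> R[i]) : Prop :=
  S psi /\ exists (c : R[i]) (W : ('cV[R]_n -> R[i]) -> (aWH R n -> R[i])),
    [/\ c != 0, isometry_on (lebesgue_cV R n) mu S W &
        forall f, S f -> voice_transform G psi f = (fun g => c * W f g)].

Definition discrete_series G mu (S : set ('cV[R]_n -> R[i])) : Prop :=
  [/\ closed_subspace (lebesgue_cV R n) S, invariant G S, irreducible_on G S &
      exists psi, admissible G mu S psi].

End affine_Weyl_Heisenberg.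

(* Main.v *)
Require Import Defs.
From HB Require Import structures.
From mathcomp Require Import all_boot all_order all_algebra all_fingroup.
From mathcomp Require Import all_classical all_reals all_analysis.
From mathcomp Require Import measurable_realfun complex.
From mathcomp Require Import ring lra.
Set Implicit Arguments.
Unset Strict Implicit.
Unset Printing Implicit Defensive.
Import Order.TTheory GRing.Theory Num.Theory.
Import numFieldNormedType.Exports.
Local Open Scope classical_set_scope.
Local Open Scope ring_scope.

(* Idea: let D_a be the unitary dilation by a > 0, i.e. the operator of the       *)
(* scalar matrix a.  It normalizes the group: conjugation by a scales R^n by      *)
(* 1/a and V by a and fixes T and H, hence multiplies Haar measure by             *)
(* a^(n - dim V).  Suppose that pi is irreducible on S, with admissible vector    *)
(* psi.  If P is the orthogonal projection on S, then B = P D_a and B* =          *)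
(* P D_(1/a) intertwine pi on S with its conjugate, so that by Schur's lemma      *)
(* |B f|^2 = |B* f|^2 = s |f|^2 on S.  Computing the L^2 norms of the voice       *)
(* transforms of B psi and B* psi, which correspond to each other under           *)
(* inversion and conjugation, gives s a^(n - dim V) = s by unimodularity.  Some   *)
(* a <> 1 has s > 0, because otherwise the vectors D_a psi would form an          *)
(* uncountable orthogonal family in a separable space.                            *)
(*   Since the group contains T, its closed invariant real subspaces are          *)
(* complex, so real inner products suffice throughout.                            *)

(** * Real pre-Hilbert spaces and Schur's lemma *)

(** In more detail, let c be the factor of the admissible vector, k = dim V, g^a = D_a^-1 g D_a
    ([aWH_conj]) and B_a = P D_a ([cdil a]), with adjoint B_(1/a) on S. Since S is invariant and g
    D_a = D_a g^a, B_a pi(g^a) = pi(g) B_a on S ([cdil_comm]). Hence B_a B_(1/a) and B_(1/a) B_a are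
    self-adjoint contractions that commute with pi, so they are scalars by [schur].
    [dilation_correlation] gives some a > 0, a <> 1, for which B_a is nonzero, and then both scalars
    equal one s > 0 ([cdil_norm]).

    On G, |V_psi(B_(1/a) psi)(g^a)| = |V_psi(B_a psi)(g^-1)| ([voice_dilation]). Integrate the
    squares: the left side gives a^(n-k) |c|^2 s |psi|^2 by [Haar_conj], the right side |c|^2 s
    |psi|^2 by [Haar_inv]. So a^(n-k) = 1, which is impossible since k < n. Both facts about Haar
    measure rest on [biinvariant_prod], which needs invariance on both sides; the factor a^(n-k) is
    read off from coordinate boxes ([Haar_box_scale]).

    Vectors are functions rather than classes of functions, so inner products are only semidefinite,
    and two vectors are regarded as equal when [ip x = ip y]. *)

Record semi_inner (R : realType) (E : lmodType R) (ip : E -> E -> R) : Prop :=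
  SemiInner {
    semi_innerC : forall x y, ip x y = ip y x;
    semi_innerDl : forall x y z, ip (x + y) z = ip x z + ip y z;
    semi_innerZl : forall a x z, ip (a *: x) z = a * ip x z;
    semi_inner_ge0 : forall x, 0 <= ip x x }.

Section semi_inner_product.
Context (R : realType) (E : lmodType R) (ip : E -> E -> R).
Context (ipP : semi_inner ip).

Definition inorm x := Num.sqrt (ip x x).

Let ipC := semi_innerC ipP.
Let ipDl := semi_innerDl ipP.
Let ipZl := semi_innerZl ipP.
Let ip_ge0 := semi_inner_ge0 ipP.

Lemma semi_innerDr x y z : ip x (y + z) = ip x y + ip x z.
Proof. by rewrite ipC ipDl !(ipC _ x). Qed.

Lemma semi_innerZr a x y : ip x (a *: y) = a * ip x y.
Proof. by rewrite ipC ipZl ipC. Qed.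

Lemma semi_innerNl x y : ip (- x) y = - ip x y.
Proof. by rewrite -scaleN1r ipZl mulN1r. Qed.

Lemma semi_innerNr x y : ip x (- y) = - ip x y.
Proof. by rewrite ipC semi_innerNl ipC. Qed.

Definition semi_innerE :=
  (ipDl, semi_innerDr, semi_innerNl, semi_innerNr, ipZl, semi_innerZr).

Lemma inorm_ge0 x : 0 <= inorm x. Proof. exact: sqrtr_ge0. Qed.

Lemma sqr_inorm x : inorm x ^+ 2 = ip x x.
Proof. by rewrite sqr_sqrtr. Qed.

Lemma inormZ a x : inorm (a *: x) = `|a| * inorm x.
Proof.
by rewrite /inorm !semi_innerE mulrA -expr2 sqrtrM ?sqr_ge0// sqrtr_sqr.
Qed.

Lemma inormN x : inorm (- x) = inorm x.
Proof. by rewrite /inorm !semi_innerE opprK. Qed.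

Lemma inorm0 : inorm 0 = 0.
Proof. by rewrite -(scale0r (0 : E)) inormZ normr0 mul0r. Qed.

Lemma inormBC x y : inorm (x - y) = inorm (y - x).
Proof. by rewrite -inormN opprB. Qed.

Lemma cauchy_schwarz x y : `|ip x y| <= inorm x * inorm y.
Proof.
have quad (t : R) : 0 <= ip x x + t * (2 * ip x y) + t ^+ 2 * ip y y.
  have := ip_ge0 (x + t *: y); rewrite !semi_innerE (ipC y x); lra.
rewrite -ler_sqr ?nnegrE ?mulr_ge0 ?inorm_ge0// exprMn !sqr_inorm real_normK ?num_real//.
(* If <y, y> = 0, the quadratic is affine in t, so nonnegativity forces <x, y> = 0: the chosen t
   would give the value -1. *)
have [y0|y0] := eqVneq (ip y y) 0.
  have [xy0|xy0] := eqVneq (ip x y) 0; first by rewrite xy0 expr0n mulr_ge0.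
  have := quad (- (ip x x + 1) / (2 * ip x y)).
  rewrite y0 mulr0 addr0 -mulrA mulVf ?mulf_neq0 ?pnatr_eq0//.
  lra.
have y0' : 0 < ip y y by rewrite lt_neqAle eq_sym y0 ip_ge0.
(* The minimizer of the quadratic. *)
have := quad (- ip x y / ip y y).
rewrite (_ : _ + _ = (ip x x * ip y y - ip x y ^+ 2) / ip y y); last by field.
by rewrite pmulr_lge0 ?invr_gt0// subr_ge0.
Qed.

Lemma inormD x y : inorm (x + y) <= inorm x + inorm y.
Proof.
rewrite -ler_sqr ?nnegrE ?addr_ge0 ?inorm_ge0// sqr_inorm !semi_innerE (ipC y x).
have := le_trans (ler_norm _) (cauchy_schwarz x y).
have := sqr_inorm x; have := sqr_inorm y; lra.
Qed.

Lemma inormB_trans z x y : inorm (x - y) <= inorm (x - z) + inorm (z - y).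
Proof. by rewrite (_ : x - y = (x - z) + (z - y)) ?inormD// addrA subrK. Qed.

(* Vectors at distance 0 are identified through the functional they induce. *)
Lemma ip_eqP x y : ip x = ip y <-> inorm (x - y) = 0.
Proof.
split=> [xy|xy0].
  by rewrite /inorm ipDl semi_innerNl xy subrr sqrtr0.
apply/funext => z; apply/eqP; rewrite -subr_eq0 -semi_innerNl -ipDl.
by rewrite -normr_le0 (le_trans (cauchy_schwarz _ _))// xy0 mul0r.
Qed.

Lemma ip_eq_inorm x y : ip x = ip y -> inorm x = inorm y.
Proof. by move=> xy; rewrite /inorm xy ipC xy. Qed.

Lemma ip_eqD x x' y y' : ip x = ip x' -> ip y = ip y' -> ip (x + y) = ip (x' + y').
Proof. by move=> xx yy; apply/funext => z; rewrite !ipDl xx yy. Qed.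

Lemma ip_eqZ a x x' : ip x = ip x' -> ip (a *: x) = ip (a *: x').
Proof. by move=> xx; apply/funext => z; rewrite !ipZl xx. Qed.

Lemma ip_eqN x x' : ip x = ip x' -> ip (- x) = ip (- x').
Proof. by rewrite -(scaleN1r x) -(scaleN1r x'); exact: ip_eqZ. Qed.

Lemma ip_eqB x x' y y' : ip x = ip x' -> ip y = ip y' -> ip (x - y) = ip (x' - y').
Proof. by move=> xx yy; apply: ip_eqD => //; exact: ip_eqN. Qed.

Lemma ip_eq_small x y : (forall e, 0 < e -> inorm (x - y) < e) -> ip x = ip y.
Proof.
move=> small; apply/ip_eqP/eqP; rewrite eq_le inorm_ge0 andbT.
by apply/ler_addgt0Pr => e e0; rewrite add0r ltW// small.
Qed.

Definition icvg (u : nat -> E) l :=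
  forall e, 0 < e -> exists N, forall k, (N <= k)%N -> inorm (u k - l) < e.

Definition icauchy (u : nat -> E) :=
  forall e, 0 < e -> exists N, forall k m, (N <= k)%N -> (N <= m)%N ->
    inorm (u k - u m) < e.

Definition icomplete := forall u, icauchy u -> exists l, icvg u l.

Lemma icvg_bound u l c : icvg u l -> (forall k, inorm (u k) <= c) -> inorm l <= c.
Proof.
move=> ul uc; apply/ler_addgt0Pr => e e0; have [N /(_ N (leqnn _)) ulN] := ul _ e0.
rewrite -[l](subrK (u N)) addrC (le_trans (inormD _ _))//.
by rewrite lerD// inormBC ltW.
Qed.

Lemma icvgD u v l m : icvg u l -> icvg v m -> icvg (fun k => u k + v k) (l + m).
Proof.
move=> ul vm e e0; have e20 : 0 < e / 2 by rewrite divr_gt0.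
have [N uN] := ul _ e20; have [M vM] := vm _ e20.
exists (maxn N M) => k; rewrite geq_max => /andP[Nk Mk].
rewrite opprD addrACA (le_lt_trans (inormD _ _))// [e]splitr.
by rewrite ltrD// ?uN ?vM.
Qed.

Lemma icvgZ a u l : icvg u l -> icvg (fun k => a *: u k) (a *: l).
Proof.
move=> ul e e0; have a0 : 0 < `|a| + 1 by rewrite ltr_pwDr.
have [N uN] := ul _ (divr_gt0 e0 a0); exists N => k Nk.
rewrite -scalerBr inormZ (le_lt_trans (y := (`|a| + 1) * inorm (u k - l)))//.
  by rewrite ler_wpM2r ?inorm_ge0// lerDl.
by rewrite mulrC -ltr_pdivlMr// uN.
Qed.

Lemma icvg_eq u v l m :
  icvg u l -> icvg v m -> (forall k, ip (u k) = ip (v k)) -> ip l = ip m.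
Proof.
move=> ul vm uv; apply: ip_eq_small => e e0.
have e20 : 0 < e / 2 by rewrite divr_gt0.
have [N uN] := ul _ e20; have [M vM] := vm _ e20.
have := uN (maxn N M) (leq_maxl _ _); have := vM (maxn N M) (leq_maxr _ _).
set k := maxn N M => vk uk.
rewrite (le_lt_trans (inormB_trans (u k) _ _))// [e]splitr ltrD//.
  by rewrite inormBC.
by rewrite (@ip_eq_inorm _ (v k - m))//; exact: ip_eqB.
Qed.

Record csubspace (S : set E) : Prop := CSubspace {
  csubspace0 : S 0;
  csubspaceD : forall x y, S x -> S y -> S (x + y);
  csubspaceZ : forall a x, S x -> S (a *: x);
  csubspace_closed : forall x, (forall e, 0 < e -> exists2 y, S y & inorm (x - y) < e) ->
    S x }.

Section csubspace_theory.
Context (S : set E) (cS : csubspace S).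

Lemma csubspaceN x : S x -> S (- x).
Proof. by rewrite -scaleN1r; exact: csubspaceZ. Qed.

Lemma csubspaceB x y : S x -> S y -> S (x - y).
Proof. by move=> Sx Sy; apply: csubspaceD => //; exact: csubspaceN. Qed.

Lemma csubspace_icvg u l : (forall k, S (u k)) -> icvg u l -> S l.
Proof.
move=> Su ul; apply: (csubspace_closed cS) => e /ul[N /(_ N (leqnn _)) uN].
by exists (u N) => //; rewrite inormBC.
Qed.

Lemma ip_eq_in x y : S x -> S y -> (forall z, S z -> ip x z = ip y z) -> ip x = ip y.
Proof.
move=> Sx Sy xy; apply/ip_eqP; rewrite /inorm ipDl semi_innerNl xy ?subrr ?sqrtr0//.
exact: csubspaceB.
Qed.

End csubspace_theory.

(** A sequence in S that minimizes the distance to x is Cauchy by the parallelogram law, because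
    midpoints stay in S. Its limit p attains the distance, and minimality along the lines p + t s
    gives orthogonality. *)
Lemma projection_exists (S : set E) : icomplete -> csubspace S ->
  forall x, exists2 p, S p & forall s, S s -> ip (x - p) s = 0.
Proof.
move=> Ecomp cS x.
pose D := [set inorm (x - s) ^+ 2 | s in S]; pose d := inf D.
have D0 : D !=set0 by exists (inorm (x - 0) ^+ 2), 0 => //; exact: csubspace0.
have lbD : has_lbound D by exists 0 => _ [s _ <-]; exact: sqr_ge0.
have dle s : S s -> d <= inorm (x - s) ^+ 2.
  by move=> Ss; apply: ge_inf => //; exists s.
have ex k : exists s, S s /\ inorm (x - s) ^+ 2 < d + k.+1%:R^-1.
  have [||_ [s Ss <-] sd] := @inf_adherent _ D (k.+1%:R^-1); first by rewrite invr_gt0.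
    by split.
  by exists s.
have [u uP] := choice ex.
have near k m : inorm (u k - u m) ^+ 2 <= 2 * (k.+1%:R^-1 + m.+1%:R^-1).
  have [[Sk uk] [Sm um]] := (uP k, uP m).
  have := dle (2^-1 *: (u k + u m)) (csubspaceZ cS _ (csubspaceD cS Sk Sm)).
  move: uk um; rewrite !sqr_inorm !semi_innerE (ipC (u k) x) (ipC (u m) x) (ipC (u m) (u k)).
  clearbody d; move: (k.+1%:R^-1) (m.+1%:R^-1) => a b; lra.
have [p up] : exists p, icvg u p.
  apply: Ecomp => e e0; have e40 : 0 < e ^+ 2 / 4 by rewrite divr_gt0// exprn_gt0.
  have [N NP] := ltr_add_invr e40; exists N => k m Nk Nm.
  rewrite -ltr_sqr ?nnegrE ?inorm_ge0 1?ltW// (le_lt_trans (near _ _))//.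
  have invS j : (N <= j)%N -> j.+1%:R^-1 <= N.+1%:R^-1 :> R.
    by move=> Nj; rewrite lef_pV2 ?posrE// ler_nat.
  move: NP (invS _ Nk) (invS _ Nm); rewrite add0r.
  move: (k.+1%:R^-1) (m.+1%:R^-1) (N.+1%:R^-1) => a b c; lra.
have Sp : S p by apply: (csubspace_icvg cS) up => k; have [] := uP k.
exists p => // s Ss.
(* For large k, u k is within e/2 of p and within sqrt d + e/2 of x. *)
have pd : inorm (x - p) ^+ 2 <= d.
  rewrite -[leRHS]sqr_sqrtr; last first.
    by apply: lb_le_inf => // _ [? _ <-]; exact: sqr_ge0.
  rewrite ler_sqr ?nnegrE ?inorm_ge0 ?sqrtr_ge0//.
  apply/ler_addgt0Pr => e e0; have e20 : 0 < e / 2 by rewrite divr_gt0.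
  have [N uN] := up _ e20.
  have [M MP] := @ltr_add_invr R 0 ((e / 2) ^+ 2) (exprn_gt0 _ e20).
  have kP := uN (maxn N M) (leq_maxl _ _); set k := maxn N M in kP.
  have [_ uk] := uP k.
  rewrite (le_trans (inormB_trans (u k) _ _))// [e]splitr addrA lerD// 1?ltW//.
  have d0 : 0 <= d by apply: lb_le_inf => // _ [? _ <-]; exact: sqr_ge0.
  have := sqrtr_ge0 d; have sd := sqr_sqrtr d0 => sd0.
  rewrite -ltr_sqr ?nnegrE ?inorm_ge0 ?addr_ge0// 1?ltW// (lt_le_trans uk)//.
  have : k.+1%:R^-1 <= M.+1%:R^-1 :> R by rewrite lef_pV2 ?posrE// ler_nat ltnS leq_maxr.
  have : 0 <= Num.sqrt d * (e / 2) by rewrite mulr_ge0// ltW.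
  move: MP sd; rewrite add0r; clearbody d.
  move: (k.+1%:R^-1) (M.+1%:R^-1) (Num.sqrt d) => a b c; nra.
have q t : 0 <= t ^+ 2 * ip s s - 2 * t * ip (x - p) s.
  have := dle (p + t *: s) (csubspaceD cS Sp (csubspaceZ cS _ Ss)).
  move/(le_trans pd); rewrite !sqr_inorm opprD addrA -scaleNr.
  rewrite !(ipDl (x - p)) !(semi_innerDr _ (x - p)) !ipZl !semi_innerZr (ipC s (x - p)).
  lra.
have [s0|s0] := eqVneq (ip s s) 0.
  move: (q 1) (q (-1)); rewrite s0; lra.
(* At the minimizer the nonnegative quadratic equals - <x - p, s>^2 / <s, s>. *)
have := q (ip (x - p) s / ip s s).
rewrite (_ : _ - _ = - (ip (x - p) s ^+ 2 / ip s s)); last by field.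
rewrite oppr_ge0 pmulr_lle0 ?invr_gt0 ?lt_neqAle 1?eq_sym ?s0 ?ip_ge0//.
by rewrite le_eqVlt ltNge sqr_ge0 orbF sqrf_eq0 => /eqP.
Qed.

Section operators.
Context (S : set E) (cS : csubspace S).
Implicit Types (W X Y A : E -> E) (f g : E) (c : R).

(** Linearity holds only up to [ip]: projections and limits choose representatives, so the two sides
    may differ by a vector of norm 0. *)
Record bounded_op W c : Prop := BoundedOp {
  bounded_op_in : forall f, S f -> S (W f);
  bounded_opD : forall f g, S f -> S g -> ip (W (f + g)) = ip (W f + W g);
  bounded_opZ : forall a f, S f -> ip (W (a *: f)) = ip (a *: W f);
  bounded_op_le : forall f, S f -> inorm (W f) <= c * inorm f }.

Definition op_comm W X := forall f, S f -> ip (W (X f)) = ip (X (W f)).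

Section bounded_op_theory.
Context W c (bW : bounded_op W c).

Lemma bounded_opN f : S f -> ip (W (- f)) = ip (- W f).
Proof. by move=> Sf; rewrite -(scaleN1r f) -(scaleN1r (W f)) (bounded_opZ bW). Qed.

Lemma bounded_opB f g : S f -> S g -> ip (W (f - g)) = ip (W f - W g).
Proof.
move=> Sf Sg; rewrite (bounded_opD bW)//; last exact: csubspaceN.
by apply: ip_eqD => //; exact: bounded_opN.
Qed.

Lemma bounded_op_leB f g : S f -> S g -> inorm (W f - W g) <= c * inorm (f - g).
Proof.
move=> Sf Sg; rewrite -(ip_eq_inorm (bounded_opB Sf Sg)).
by apply: (bounded_op_le bW); exact: csubspaceB.
Qed.

Lemma bounded_op_eq f g : S f -> S g -> ip f = ip g -> ip (W f) = ip (W g).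
Proof.
move=> Sf Sg /ip_eqP fg; apply/ip_eqP/eqP; rewrite eq_le inorm_ge0 andbT.
by rewrite (le_trans (bounded_op_leB Sf Sg))// fg mulr0.
Qed.

Lemma bounded_op_icvg u l :
  (forall k, S (u k)) -> S l -> icvg u l -> icvg (fun k => W (u k)) (W l).
Proof.
move=> Su Sl ul e e0; have c0 : 0 < `|c| + 1 by rewrite ltr_pwDr.
have [N uN] := ul _ (divr_gt0 e0 c0); exists N => k Nk.
rewrite (le_lt_trans (bounded_op_leB _ _))//.
rewrite (le_lt_trans (y := (`|c| + 1) * inorm (u k - l)))//.
  by rewrite ler_wpM2r ?inorm_ge0// (le_trans (ler_norm _))// lerDl.
by rewrite mulrC -ltr_pdivlMr// uN.
Qed.

End bounded_op_theory.

Lemma bounded_op_comp W X c d : 0 <= c -> bounded_op W c -> bounded_op X d ->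
  bounded_op (W \o X) (c * d).
Proof.
move=> c0 bW bX; split=> [f Sf|f g Sf Sg|a f Sf|f Sf] /=.
- by apply: (bounded_op_in bW); exact: (bounded_op_in bX).
- have [SXf SXg] : S (X f) /\ S (X g) by split; exact: (bounded_op_in bX).
  rewrite -(bounded_opD bW)//; apply: (bounded_op_eq bW); last exact: (bounded_opD bX).
  + by apply: (bounded_op_in bX); exact: csubspaceD.
  + exact: csubspaceD.
- have Sa : S (a *: f) by exact: csubspaceZ.
  rewrite -(bounded_opZ bW); last exact: (bounded_op_in bX).
  apply: (bounded_op_eq bW); last exact: (bounded_opZ bX).
  + exact: (bounded_op_in bX).
  + by apply: (csubspaceZ cS); exact: (bounded_op_in bX).
- rewrite (le_trans (bounded_op_le bW _)) -?mulrA ?ler_wpM2l//.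
    exact: (bounded_op_in bX).
  exact: (bounded_op_le bX).
Qed.

Lemma bounded_op_lin W X c d a b : bounded_op W c -> bounded_op X d ->
  bounded_op (fun f => a *: W f + b *: X f) (`|a| * c + `|b| * d).
Proof.
move=> bW bX; split=> [f Sf|f g Sf Sg|t f Sf|f Sf] /=.
- apply: (csubspaceD cS); apply: (csubspaceZ cS).
    exact: (bounded_op_in bW).
  exact: (bounded_op_in bX).
- rewrite addrACA -!scalerDr; apply: ip_eqD; apply: ip_eqZ.
    exact: (bounded_opD bW).
  exact: (bounded_opD bX).
- rewrite scalerDr !scalerA ![t * _]mulrC -!scalerA; apply: ip_eqD; apply: ip_eqZ.
    exact: (bounded_opZ bW).
  exact: (bounded_opZ bX).
- rewrite (le_trans (inormD _ _))// mulrDl !inormZ -!mulrA.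
  rewrite lerD// ler_wpM2l//.
    exact: (bounded_op_le bW).
  exact: (bounded_op_le bX).
Qed.

Lemma bounded_op_id : bounded_op id 1.
Proof. by split => // f Sf; rewrite mul1r. Qed.

Lemma bounded_opW W c d : c <= d -> bounded_op W c -> bounded_op W d.
Proof.
move=> cd [WS WD WZ Wle]; split=> // f Sf.
by rewrite (le_trans (Wle _ Sf))// ler_wpM2r// inorm_ge0.
Qed.

Lemma bounded_op_ext W X c : bounded_op W c -> (forall f, W f = X f) -> bounded_op X c.
Proof. by move=> bW /funext <-. Qed.

Section square_root.
Context X (bX : bounded_op X 1).

(* Visser's iteration Y_(k+1) = (X + Y_k^2) / 2, which converges to               *)
(* Y = 1 - sqrt (1 - X).                                                          *)
Fixpoint sqrt_iter k : E -> E :=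
  if k is k'.+1 then fun f => 2^-1 *: X f + 2^-1 *: sqrt_iter k' (sqrt_iter k' f)
  else fun=> 0.

(** The same iteration for the scalar X = 1. It increases, stays below 1, and dominates both the
    norms of the operator iterates and the norms of their increments. *)
Fixpoint sqrt_bound k : R := if k is k'.+1 then (1 + sqrt_bound k' ^+ 2) / 2 else 0.

Lemma sqrt_bound01 k : 0 <= sqrt_bound k <= 1.
Proof.
elim: k => [|k /andP[k0 k1]] /=; first by rewrite lexx ler01.
by rewrite divr_ge0 ?addr_ge0 ?sqr_ge0//=; nra.
Qed.

Lemma sqrt_boundS k : sqrt_bound k <= sqrt_bound k.+1.
Proof. by have /andP[] := sqrt_bound01 k => /=; nra. Qed.

Lemma sqrt_bound_mono : {homo sqrt_bound : k m / (k <= m)%N >-> k <= m}.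
Proof. by apply: homo_leq => [//|x y z|]; [exact: le_trans|exact: sqrt_boundS]. Qed.

Lemma sqrt_iter_bounded k : bounded_op (sqrt_iter k) (sqrt_bound k).
Proof.
elim: k => [|k IHk] /=.
  split=> *; rewrite ?mul0r ?inorm0 ?addr0 ?scaler0//; exact: csubspace0.
have k0 : 0 <= sqrt_bound k by have /andP[] := sqrt_bound01 k.
have := bounded_op_lin 2^-1 2^-1 bX (bounded_op_comp k0 IHk IHk).
by apply: bounded_opW; rewrite ger0_norm ?invr_ge0//; lra.
Qed.

Lemma sqrt_iter_in k f : S f -> S (sqrt_iter k f).
Proof. exact: (bounded_op_in (sqrt_iter_bounded k)). Qed.

(** The induction uses Y'^2 - Y^2 = (Y' - Y) Y' + Y (Y' - Y) for consecutive iterates Y, Y'; the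
    scalar bounds satisfy the same identity. *)
Lemma sqrt_iterS_le k f : S f -> inorm (sqrt_iter k.+1 f - sqrt_iter k f) <=
  (sqrt_bound k.+1 - sqrt_bound k) * inorm f.
Proof.
elim: k f => [|k IHk] f Sf.
  rewrite /= !scaler0 addr0 subr0 expr0n addr0 subr0 inormZ ger0_norm ?invr_ge0//.
  by rewrite mul1r ler_wpM2l ?invr_ge0// -[leRHS]mul1r (bounded_op_le bX).
(* [y] is an opaque name that keeps simplification from unfolding the bound. *)
set Y := sqrt_iter k.+1; have [y yE] : exists y, y = sqrt_bound k.+1 by exists (sqrt_bound k.+1).
rewrite -yE in IHk *.
have -> : sqrt_iter k.+2 f - Y f = 2^-1 *: (Y (Y f) - sqrt_iter k (Y f)) +
    2^-1 *: (sqrt_iter k (Y f) - sqrt_iter k (sqrt_iter k f)).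
  by rewrite -scalerDr addrA subrK /= opprD addrACA subrr add0r scalerBr.
have -> : sqrt_bound k.+2 - y = 2^-1 * ((y - sqrt_bound k) * y) +
    2^-1 * (sqrt_bound k * (y - sqrt_bound k)).
  by rewrite (_ : sqrt_bound k.+2 = (1 + sqrt_bound k.+1 ^+ 2) / 2)// yE /=; field.
have SY : S (Y f) by exact: sqrt_iter_in.
have Sk : S (sqrt_iter k f) by exact: sqrt_iter_in.
rewrite (le_trans (inormD _ _))// mulrDl !inormZ ger0_norm ?invr_ge0// -!mulrA lerD//.
  rewrite ler_wpM2l ?invr_ge0// (le_trans (IHk _ SY))//.
  rewrite yE ler_wpM2l ?subr_ge0 ?sqrt_boundS//.
  exact: (bounded_op_le (sqrt_iter_bounded k.+1)).
rewrite ler_wpM2l ?invr_ge0//.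
rewrite (le_trans (bounded_op_leB (sqrt_iter_bounded k) _ _))// ler_wpM2l ?IHk//.
by have /andP[] := sqrt_bound01 k.
Qed.

Lemma sqrt_iter_le k j f : S f -> inorm (sqrt_iter (k + j) f - sqrt_iter k f) <=
  (sqrt_bound (k + j) - sqrt_bound k) * inorm f.
Proof.
move=> Sf; elim: j => [|j IHj]; first by rewrite addn0 !subrr inorm0 mul0r.
rewrite (le_trans (inormB_trans (sqrt_iter (k + j) f) _ _))//.
rewrite (_ : _ * _ = (sqrt_bound (k + j.+1) - sqrt_bound (k + j)) * inorm f +
  (sqrt_bound (k + j) - sqrt_bound k) * inorm f); last by ring.
by rewrite lerD// addnS sqrt_iterS_le.
Qed.

Context (Ecomp : icomplete).

(** The iterates are Cauchy because their increments are dominated by those of a convergent real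
    sequence. Putting [S f] inside the existential lets choice yield a total map on E. *)
Lemma sqrt_lim_exists f : exists l, S f -> S l /\ icvg (sqrt_iter ^~ f) l.
Proof.
have [Sf|] := pselect (S f); last by exists 0.
suff [l fl] : exists l, icvg (sqrt_iter ^~ f) l.
  exists l => _; split=> //; apply: (csubspace_icvg cS) fl => k; exact: sqrt_iter_in.
apply: Ecomp => e e0; have f0 : 0 < inorm f + 1 by rewrite ltr_wpDl ?inorm_ge0.
have : cvgn sqrt_bound.
  apply: nondecreasing_is_cvgn; first exact: sqrt_bound_mono.
  by exists 1 => _ [k _ <-]; have /andP[] := sqrt_bound01 k.
(* Two bounds lie within e/4 / (|f| + 1) of their limit, so they differ by at most e/2 / (|f| + 1);
   the summand 1 keeps the divisor positive. *)
move/cvg_ex => [b /cvgrPdist_lt /(_ _ (divr_gt0 (divr_gt0 e0 (ltr0n R 4)) f0))][N _ /= Nb].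
exists N.
have near k : (N <= k)%N -> inorm (sqrt_iter k f - sqrt_iter N f) < e / 2.
  move=> Nk; have := sqrt_iter_le N (k - N) Sf; rewrite subnKC// => /le_lt_trans; apply.
  have := Nb _ Nk; have := Nb _ (leqnn N).
  rewrite !ltr_norml => /andP[a1 a2] /andP[a3 a4].
  rewrite (le_lt_trans (y := (sqrt_bound k - sqrt_bound N) * (inorm f + 1)))//.
    by rewrite ler_wpM2l ?lerDl// subr_ge0 sqrt_bound_mono.
  rewrite -ltr_pdivlMr// (_ : e / 2 / _ = 2 * (e / 4 / (inorm f + 1))); last first.
    by field; rewrite gt_eqF.
  lra.
move=> k m Nk Nm; rewrite (le_lt_trans (inormB_trans (sqrt_iter N f) _ _))//.
by rewrite [e]splitr ltrD ?near// inormBC near.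
Qed.

Definition sqrt_lim f := projT1 (cid (sqrt_lim_exists f)).

Lemma sqrt_lim_in f : S f -> S (sqrt_lim f).
Proof. by move=> /(projT2 (cid (sqrt_lim_exists f)))[]. Qed.

Lemma sqrt_lim_cvg f : S f -> icvg (sqrt_iter ^~ f) (sqrt_lim f).
Proof. by move=> /(projT2 (cid (sqrt_lim_exists f)))[]. Qed.

Lemma sqrt_iter_le1 k f : S f -> inorm (sqrt_iter k f) <= inorm f.
Proof.
move=> Sf; rewrite (le_trans (bounded_op_le (sqrt_iter_bounded k) Sf))//.
by rewrite ler_piMl ?inorm_ge0//; have /andP[] := sqrt_bound01 k.
Qed.

Lemma sqrt_lim_bounded : bounded_op sqrt_lim 1.
Proof.
split=> [f Sf|f g Sf Sg|a f Sf|f Sf]; first exact: sqrt_lim_in.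
- apply: (icvg_eq (sqrt_lim_cvg (csubspaceD cS Sf Sg))
    (icvgD (sqrt_lim_cvg Sf) (sqrt_lim_cvg Sg))) => k.
  exact: (bounded_opD (sqrt_iter_bounded k)).
- apply: (icvg_eq (sqrt_lim_cvg (csubspaceZ cS a Sf)) (icvgZ a (sqrt_lim_cvg Sf))) => k.
  exact: (bounded_opZ (sqrt_iter_bounded k)).
- by rewrite mul1r; apply: (icvg_bound (sqrt_lim_cvg Sf)) => k; exact: sqrt_iter_le1.
Qed.

(** The recursion passes to the limit; equivalently (1 - Y)^2 = 1 - X. *)
Lemma sqrt_limE f : S f ->
  ip (2 *: sqrt_lim f) = ip (X f + sqrt_lim (sqrt_lim f)).
Proof.
move=> Sf; set Y := sqrt_lim; have SY : S (Y f) by exact: sqrt_lim_in.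
(* Both the operator and its argument vary with k; this is harmless because all the iterates are
   contractions. *)
have YY : icvg (fun k => sqrt_iter k (sqrt_iter k f)) (Y (Y f)).
  move=> e e0; have e20 : 0 < e / 2 by rewrite divr_gt0.
  have [N fN] := sqrt_lim_cvg Sf e20; have [M gM] := sqrt_lim_cvg SY e20.
  exists (maxn N M) => k; rewrite geq_max => /andP[Nk Mk].
  rewrite (le_lt_trans (inormB_trans (sqrt_iter k (Y f)) _ _))// [e]splitr ltrD ?gM//.
  rewrite (le_lt_trans (bounded_op_leB (sqrt_iter_bounded k) _ _))//; first exact: sqrt_iter_in.
  rewrite (le_lt_trans _ (fN _ Nk))// ler_piMl ?inorm_ge0//.
  by have /andP[] := sqrt_bound01 k.
have XX : icvg (fun=> X f) (X f).
  by move=> e e0; exists 0%N => k _; rewrite subrr inorm0.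
have shift : icvg (fun k => sqrt_iter k.+1 f) (Y f).
  move=> e e0; have [N fN] := sqrt_lim_cvg Sf e0; exists N => k Nk.
  by apply: fN; exact: leqW.
apply: (icvg_eq (icvgZ 2 shift) (icvgD XX YY)) => k /=.
by rewrite -scalerDr scalerA divff ?pnatr_eq0// scale1r.
Qed.

(** Each iterate is a polynomial in X, so W commutes with it, and commutation survives the limit. *)
Lemma sqrt_lim_comm W c : bounded_op W c -> op_comm W X -> op_comm W sqrt_lim.
Proof.
move=> bW WX f Sf.
have SW g : S g -> S (W g) by exact: (bounded_op_in bW).
have SX g : S g -> S (X g) by exact: (bounded_op_in bX).
have comm k g : S g -> ip (W (sqrt_iter k g)) = ip (sqrt_iter k (W g)).
  elim: k g => [|k IHk] g Sg /=.
    rewrite -{1}(scale0r (0 : E)) (bounded_opZ bW) ?scale0r//; exact: csubspace0.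
  have Sk : S (sqrt_iter k (sqrt_iter k g)) by do 2!apply: sqrt_iter_in.
  rewrite (bounded_opD bW); try by apply: (csubspaceZ cS); [exact: SX|].
  - apply: ip_eqD.
      by rewrite (bounded_opZ bW); [apply: ip_eqZ; exact: WX|exact: SX].
    rewrite (bounded_opZ bW)//; apply: ip_eqZ.
    rewrite IHk; last exact: sqrt_iter_in.
    apply: (bounded_op_eq (sqrt_iter_bounded k)); last exact: IHk.
      by apply: SW; exact: sqrt_iter_in.
    by apply: sqrt_iter_in; exact: SW.
  - by apply: (csubspaceZ cS); exact: SX.
  - exact: (csubspaceZ cS).
apply: (icvg_eq (bounded_op_icvg bW _ _ (sqrt_lim_cvg Sf)) (sqrt_lim_cvg (SW _ Sf))).
- by move=> k; exact: sqrt_iter_in.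
- exact: sqrt_lim_in.
- by move=> k; exact: comm.
Qed.

End square_root.

Section schur.
Context (Ecomp : icomplete) (I : Type) (U : I -> E -> E).
Context (bU : forall i, bounded_op (U i) 1).
Context (irr : forall K, csubspace K -> K `<=` S -> (forall i x, K x -> K (U i x)) ->
  (forall x, K x -> inorm x = 0) \/ S `<=` K).

(** The bound 1 makes 1 - A^2 a contraction, as the square root iteration requires. *)
Record intertwiner A : Prop := Intertwiner {
  intertwiner_bounded : bounded_op A 1;
  intertwiner_sym : forall f g, S f -> S g -> ip (A f) g = ip f (A g);
  intertwiner_comm : forall i, op_comm (U i) A }.

(** Irreducibility is applied to two subspaces of this kind: where A = |A|, and where A = s. *)
Lemma equalizer_csubspace A Z c d : bounded_op A c -> bounded_op Z d ->
  csubspace [set f | S f /\ ip (A f) = ip (Z f)].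
Proof.
move=> bA bZ; split=> [|f g [Sf fP] [Sg gP]|a f [Sf fP]|f fP].
- split; first exact: csubspace0.
  rewrite -(scale0r (0 : E)) (bounded_opZ bA) ?(bounded_opZ bZ) ?scale0r//;
    exact: csubspace0.
- split; first exact: csubspaceD.
  by rewrite (bounded_opD bA)// (bounded_opD bZ)//; exact: ip_eqD.
- split; first exact: csubspaceZ.
  by rewrite (bounded_opZ bA)// (bounded_opZ bZ)//; exact: ip_eqZ.
- have Sf : S f by apply: (csubspace_closed cS) => e /fP[g [Sg _] fg]; exists g.
  split=> //; apply: ip_eq_small => e e0.
  have cd0 : 0 < `|c| + `|d| + 1 by rewrite ltr_wpDl// addr_ge0.
  have [g [Sg gP] fg] := fP _ (divr_gt0 e0 cd0).
  rewrite (le_lt_trans (inormB_trans (A g) _ _))//.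
  rewrite (le_lt_trans (y := (`|c| + `|d| + 1) * inorm (f - g)))//; last first.
    by rewrite mulrC -ltr_pdivlMr.
  have -> : inorm (A g - Z f) = inorm (Z g - Z f).
    by apply: ip_eq_inorm; exact: ip_eqB.
  have := bounded_op_leB bA Sf Sg; have := bounded_op_leB bZ Sg Sf.
  rewrite (inormBC g f); have := inorm_ge0 (f - g).
  have := ler_norm c; have := ler_norm d; nra.
Qed.

(* Let |A| be the positive square root of A^2, so |A| = 1 - Y for X = 1 - A^2.    *)
(* By irreducibility the invariant subspace where A = |A|, which contains the     *)
(* range of A + |A|, is zero or everything, whence A = -|A| or A = |A|.           *)
Lemma schur_semidefinite A : intertwiner A ->
  (forall f, S f -> 0 <= ip (A f) f) \/ (forall f, S f -> ip (A f) f <= 0).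
Proof.
move=> [bA symA commA].
have SA f : S f -> S (A f) by exact: (bounded_op_in bA).
have bAA := bounded_op_comp ler01 bA bA; rewrite mul1r in bAA.
have AAge0 f : S f -> ip (A (A f)) f = inorm (A f) ^+ 2.
  by move=> Sf; rewrite (symA _ _ (SA _ Sf) Sf) sqr_inorm.
pose X f := f - A (A f).
have bX : bounded_op X 1.
  have [XS XD XZ _] := bounded_op_ext (X := X)
    (bounded_op_lin 1 (-1) bounded_op_id bAA) (fun f => congr2 +%R (scale1r _) (scaleN1r _)).
  split=> // f Sf; rewrite mul1r -ler_sqr ?nnegrE ?inorm_ge0//.
  rewrite [inorm (X f) ^+ 2]sqr_inorm !semi_innerE (ipC f) AAge0// -!sqr_inorm.
  have AAf : inorm (A (A f)) <= inorm (A f).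
    by rewrite -[leRHS]mul1r; apply: (bounded_op_le bA); exact: SA.
  have := inorm_ge0 (A (A f)); nra.
have SX f : S f -> S (X f) by exact: (bounded_op_in bX).
set Y := sqrt_lim bX Ecomp; have bY : bounded_op Y 1 by exact: sqrt_lim_bounded.
have SY f : S f -> S (Y f) by exact: (bounded_op_in bY).
pose Z f := f - Y f.
have bZ := bounded_op_ext (X := Z)
  (bounded_op_lin 1 (-1) bounded_op_id bY) (fun f => congr2 +%R (scale1r _) (scaleN1r _)).
have SZ f : S f -> S (Z f) by exact: (bounded_op_in bZ).
have comm_YX W c : bounded_op W c -> op_comm W A -> op_comm W Y.
  move=> bW WA; apply: (sqrt_lim_comm _ _ bW) => f Sf.
  have SAA : S (A (A f)) by exact/SA/SA.
  rewrite (bounded_opB bW)//; apply: ip_eqB => //.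
  rewrite (WA _ (SA _ Sf)); apply: (bounded_op_eq bA); last exact: WA.
    by apply: (bounded_op_in bW); exact: SA.
  by apply: SA; exact: (bounded_op_in bW).
have comm_Z W c : bounded_op W c -> op_comm W A -> op_comm W Z.
  move=> bW WA f Sf; rewrite (bounded_opB bW Sf (SY _ Sf)); apply: ip_eqB => //.
  exact: (comm_YX _ _ bW).
(* Z plays the role of |A|: Z^2 = 1 - (2 Y - Y^2) = 1 - X = A^2. *)
have ZZ f : S f -> ip (Z (Z f)) = ip (A (A f)).
  move=> Sf; rewrite {1}/Z (_ : _ - Y (Z f) = f - (Y f + Y (Z f))); last first.
    by rewrite /Z opprD addrA.
  rewrite -[in RHS](subKr f (A (A f))); apply: ip_eqB => //.
  have <- : ip (2 *: Y f - Y (Y f)) = ip (X f).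
    transitivity (ip (X f + Y (Y f) - Y (Y f))); last by rewrite addrK.
    by apply: ip_eqB => //; exact: sqrt_limE.
  rewrite scaler_nat mulr2n -addrA; apply: ip_eqD => //.
  by rewrite (bounded_opB bY Sf (SY _ Sf)).
have Zge0 f : S f -> 0 <= ip (Z f) f.
  move=> Sf; rewrite ipDl semi_innerNl subr_ge0.
  rewrite (le_trans (ler_norm _))// (le_trans (cauchy_schwarz _ _))//.
  rewrite -sqr_inorm expr2 ler_wpM2r ?inorm_ge0//.
  by have := bounded_op_le bY Sf; rewrite mul1r.
have KP := equalizer_csubspace bA bZ.
case: (irr KP) => [f []//|i f [Sf fP]|K0|SK].
- have SU g : S g -> S (U i g) by exact: (bounded_op_in (bU i)).
  split; first exact: SU.
  rewrite -commA// -(comm_Z _ _ (bU i))//; apply: (bounded_op_eq (bU i)) => //.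
    exact: SA.
  exact: SZ.
(* A (A + Z) = Z^2 + Z A = Z (A + Z), so A f + Z f lies in the null subspace, and A = -Z. *)
- right=> f Sf.
  have SAZ : S (A f + Z f) by apply: (csubspaceD cS); [exact: SA|exact: SZ].
  have : [set f | S f /\ ip (A f) = ip (Z f)] (A f + Z f).
    split => //.
    have [SAf SZf] := (SA _ Sf, SZ _ Sf).
    rewrite (bounded_opD bA)// (bounded_opD bZ)// addrC.
    apply: ip_eqD; last by rewrite ZZ.
    exact: (comm_Z _ _ bA).
  move/K0; rewrite -[X in _ + X]opprK => /ip_eqP ->.
  by rewrite semi_innerNl oppr_le0 Zge0.
- by left=> f /[dup] /SK[_ ->]; exact: Zge0.
Qed.

(* [schur_semidefinite] applies to A - s for s = <A f0, f0> / |f0|^2; a           *)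
(* semidefinite B with <B f0, f0> = 0 annihilates f0, so the kernel of A - s is   *)
(* nonzero.                                                                       *)
Lemma schur A : intertwiner A -> exists s, forall f, S f -> ip (A f) = ip (s *: f).
Proof.
move=> iA; have [bA symA commA] := iA.
have [S0|/existsNP[f0 /not_implyP[Sf0 /eqP f00]]] :=
    pselect (forall f, S f -> inorm f = 0).
  exists 0 => f Sf; apply/ip_eqP; apply: S0; apply: (csubspaceB cS).
    exact: (bounded_op_in bA).
  exact: (csubspaceZ cS).
have f0_gt0 : 0 < ip f0 f0.
  by rewrite -sqr_inorm exprn_gt0// lt_neqAle eq_sym f00 inorm_ge0.
pose s := ip (A f0) f0 / ip f0 f0.
have s1 : `|s| <= 1.
  rewrite normrM normfV [X in _ / X]gtr0_norm// ler_pdivrMr// mul1r.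
  rewrite (le_trans (cauchy_schwarz _ _))// -sqr_inorm expr2 ler_wpM2r ?inorm_ge0//.
  by have := bounded_op_le bA Sf0; rewrite mul1r.
(* The factor 1/2 makes B a contraction, since A - s has norm at most 2. *)
pose B f := 2^-1 *: A f + (- (2^-1 * s)) *: f.
have bB : bounded_op B 1.
  apply: bounded_opW (bounded_op_lin 2^-1 (- (2^-1 * s)) bA bounded_op_id).
  rewrite normrN normrM ger0_norm ?invr_ge0//; lra.
have SB f : S f -> S (B f) by exact: (bounded_op_in bB).
have iB : intertwiner B.
  split=> // [f g Sf Sg|i f Sf].
    by rewrite /B !semi_innerE symA.
  have SU g : S g -> S (U i g) by exact: (bounded_op_in (bU i)).
  have SA : S (A f) by exact: (bounded_op_in bA).
  rewrite (bounded_opD (bU i)); try exact: (csubspaceZ cS).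
  by apply: ip_eqD; rewrite (bounded_opZ (bU i))//; apply: ip_eqZ; exact: commA.
have Bf00 : ip (B f0) f0 = 0 by rewrite !semi_innerE /s; field; rewrite gt_eqF.
have Bf0 : ip (B f0) = ip 0.
  (* The sign e = 1 or -1 treats both cases of semidefiniteness. Positivity of e <B h, h> at h = f0
     + t g has no constant term in t, so its linear coefficient <B f0, g> must vanish. *)
  have key : forall e : R, e * e = 1 -> (forall f, S f -> 0 <= e * ip (B f) f) ->
      ip (B f0) = ip 0.
    move=> e e1 Bge0; have ip0 z : ip 0 z = 0 by rewrite -(scale0r z) ipZl mul0r.
    apply: (ip_eq_in cS); [exact: SB|exact: csubspace0|move=> g Sg; rewrite ip0].
    have q t : 0 <= e * (2 * t * ip (B f0) g + t ^+ 2 * ip (B g) g).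
      have := Bge0 (f0 + t *: g) (csubspaceD cS Sf0 (csubspaceZ cS t Sg)).
      have St : S (t *: g) by exact: csubspaceZ.
      rewrite (bounded_opD bB)// ipDl !(semi_innerDr _ f0) Bf00.
      rewrite (bounded_opZ bB)// !ipZl !semi_innerZr.
      rewrite (intertwiner_sym iB Sg Sf0) (ipC g (B f0)); lra.
    set b := ip (B f0) g in q *; set d := ip (B g) g in q.
    have [d0|d0] := eqVneq d 0.
      have ebb : e * (b * b) = 0 by move: (q b) (q (- b)); rewrite d0; lra.
      have : b * b = 0 by rewrite -[LHS]mul1r -e1 -mulrA ebb mulr0.
      by move/eqP; rewrite mulf_eq0 orbb => /eqP.
    have d_gt0 : 0 < e * d.
      rewrite lt_neqAle Bge0// andbT eq_sym mulf_neq0//; apply/eqP => e0.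
      by move: e1; rewrite e0 mul0r => /eqP; rewrite eq_sym oner_eq0.
    have := q (- (b / d)).
    rewrite (_ : e * _ = - ((e * d) * (b / d) ^+ 2)); last by field.
    rewrite oppr_ge0 pmulr_rle0// le_eqVlt ltNge sqr_ge0 orbF sqrf_eq0.
    by rewrite mulf_eq0 invr_eq0 (negbTE d0) orbF => /eqP.
  have [B0|B0] := schur_semidefinite iB.
    by apply: (key 1) => [|f Sf]; rewrite mul1r// B0.
  by apply: (key (-1)) => [|f Sf]; rewrite ?mulrNN ?mul1r// mulN1r oppr_ge0 B0.
have bsid := bounded_op_ext (X := fun f => s *: f) (bounded_op_lin s 0 bounded_op_id bounded_op_id)
  (fun f => etrans (congr2 +%R erefl (scale0r _)) (addr0 _)).
have KP := equalizer_csubspace bA bsid.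
exists s; case: (irr KP) => [f []//|i f [Sf fP]|K0|SK f /SK[]//].
- have SU g : S g -> S (U i g) by exact: (bounded_op_in (bU i)).
  split; first exact: SU.
  rewrite -commA// -(bounded_opZ (bU i))//; apply: (bounded_op_eq (bU i)) => //.
    exact: (bounded_op_in bA).
  exact: (csubspaceZ cS).
- have : [set f | S f /\ ip (A f) = ip (s *: f)] f0.
    split=> //; have : ip (2 *: B f0) = ip (2 *: 0) by exact: ip_eqZ.
    rewrite scaler0 /B scalerDr !scalerA divff ?pnatr_eq0// scale1r.
    rewrite mulrN mulrA divff ?pnatr_eq0// mul1r scaleNr => /ip_eqP.
    by rewrite subr0 => /ip_eqP.
  by move/K0/eqP; rewrite (negbTE f00).
Qed.

End schur.
End operators.
End semi_inner_product.

(** * Real L2 spaces *)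

Section real_L2.
Context d (T : measurableType d) (R : realType) (mu : {measure set T -> \bar R}).

Let le12 : (1 <= 2%:E :> \bar R)%E. Proof. by rewrite lee_fin ler1n. Qed.

Definition rL2 := LfunType mu le12.
HB.instance Definition _ := GRing.Lmodule.on rL2.

Definition rL2_inner (u v : rL2) : R := \int[mu]_x (u x * v x).

Lemma rL2_measurable (u : rL2) : measurable_fun setT u.
Proof. exact: measurable_funP. Qed.

Lemma rL2_mul_integrable (u v : rL2) :
  mu.-integrable setT (fun x => (u x * v x)%:E).
Proof. by apply/Lfun1_integrable; apply: Lfun2_mul_Lfun1; exact: LfunP. Qed.

Lemma rL2_innerE (u v : rL2) : (rL2_inner u v)%:E = (\int[mu]_x (u x * v x)%:E)%E.
Proof. by rewrite fineK// integrable_fin_num// rL2_mul_integrable. Qed.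

Lemma rL2_semi_inner : semi_inner rL2_inner.
Proof.
split=> [u v|u v w|a u w|u].
- by apply: eq_Rintegral => x _; rewrite mulrC.
- rewrite /rL2_inner -RintegralD//; [|exact: rL2_mul_integrable..].
  by apply: eq_Rintegral => x _ /=; rewrite -mulrDl.
- rewrite /rL2_inner -RintegralZl//; last exact: rL2_mul_integrable.
  by apply: eq_Rintegral => x _ /=; rewrite mulrA.
- by apply: Rintegral_ge0 => x _; rewrite -expr2 sqr_ge0.
Qed.

Lemma Lfun2P (f : T -> R) : measurable_fun setT f ->
  (\int[mu]_x (f x ^+ 2)%:E < +oo)%E -> f \in Lfun mu 2%:E.
Proof.
move=> mf foo; rewrite inE; apply/andP; split; first by rewrite inE.
rewrite inE /= /finite_norm unlock; apply: poweR_lty.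
rewrite (_ : (\int[mu]_x _)%E = \int[mu]_x (f x ^+ 2)%:E)%E//.
apply: eq_integral => x _ /=.
by rewrite powR_mulrn// real_normK ?num_real.
Qed.

Definition mk_rL2 (f : T -> R) (Pf : f \in Lfun mu 2%:E) : rL2 := Lfun_Sub le12 Pf.

Local Notation nrm := (inorm rL2_inner).

Lemma rL2_sqr_norm (u : rL2) : (\int[mu]_x (u x ^+ 2)%:E)%E = (nrm u ^+ 2)%:E.
Proof. by rewrite (sqr_inorm rL2_semi_inner) rL2_innerE. Qed.

Lemma rL2_abs_in (u : rL2) : (fun x => `|u x|) \in Lfun mu 2%:E.
Proof.
apply: Lfun2P; first by apply: measurableT_comp => //; exact: rL2_measurable.
under eq_integral do rewrite real_normK ?num_real//.
by rewrite rL2_sqr_norm ltry.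
Qed.

Definition rL2_abs (u : rL2) : rL2 := mk_rL2 (rL2_abs_in u).

Lemma rL2_absE u x : rL2_abs u x = `|u x|. Proof. by []. Qed.

Lemma nrm_rL2_abs u : nrm (rL2_abs u) = nrm u.
Proof.
congr Num.sqrt; apply: eq_Rintegral => x _.
by rewrite rL2_absE -normrM -expr2 ger0_norm ?sqr_ge0.
Qed.

(* The partial sums of the increments are dominated in norm, so by monotone       *)
(* convergence they are bounded almost everywhere.                                *)
Lemma rL2_summable_ae (w : nat -> rL2) (C : R) :
  (forall N, \sum_(k < N) nrm (w k) <= C) ->
  {ae mu, forall x, cvgn (fun N => \sum_(0 <= k < N) w k x)}.
Proof.
move=> wC.
pose G N := \sum_(k < N) rL2_abs (w k).
have GE N x : G N x = \sum_(0 <= k < N) `|w k x|.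
  rewrite /G big_mkord; elim: N => [|N IHN]; first by rewrite !big_ord0.
  by rewrite !big_ord_recr /= -IHN.
have Gge0 N x : 0 <= G N x by rewrite GE sumr_ge0.
have GC N : nrm (G N) <= C.
  apply: le_trans (wC N); rewrite /G; elim: N => [|N IHN].
    by rewrite !big_ord0 inorm0//; exact: rL2_semi_inner.
  rewrite !big_ord_recr /= (le_trans (inormD rL2_semi_inner _ _))//.
  by rewrite lerD// nrm_rL2_abs.
have Gmono x : {homo (fun N => G N x) : m n / (m <= n)%N >-> m <= n}.
  apply: homo_leq => // [? ? ?|N]; first exact: le_trans.
  by rewrite !GE big_nat_recr//= lerDl.
have C0 : 0 <= C by apply: le_trans (GC 0%N); exact: inorm_ge0.
pose g N x : \bar R := (G N x ^+ 2)%:E.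
have mg N : measurable_fun setT (g N).
  apply/measurable_EFinP; apply: measurable_funX; exact: rL2_measurable.
have gge0 N x : setT x -> (0 <= g N x)%E by move=> _; rewrite lee_fin sqr_ge0.
have gmono x : setT x -> {homo g^~ x : m n / (m <= n)%N >-> (m <= n)%E}.
  by move=> _ m n mn; rewrite lee_fin ler_sqr ?nnegrE// Gmono.
have lim_int : mu.-integrable setT (fun x => limn (g ^~ x)).
  apply/integrableP; split.
    apply: (emeasurable_fun_cvg g) => // x _.
    exact/ereal_nondecreasing_is_cvgn/gmono.
  have lim_ge0 x : (0 <= limn (g ^~ x))%E.
    apply: lime_ge; first exact/ereal_nondecreasing_is_cvgn/gmono.
    by apply: nearW => N; exact: gge0.
  under eq_integral do rewrite gee0_abs//.
  rewrite (monotone_convergence mu measurableT mg gge0 gmono).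
  apply: (@le_lt_trans _ _ (C ^+ 2)%:E); last exact: ltry.
  apply: lime_le.
    apply: ereal_nondecreasing_is_cvgn => m n mn.
    by apply: ge0_le_integral => // x _; [exact: gge0|exact: gmono].
  apply: nearW => N; rewrite rL2_sqr_norm lee_fin ler_sqr ?nnegrE//.
  exact: inorm_ge0.
have [A [mA A0 AP]] := integrable_ae measurableT lim_int.
exists A; split=> // x /=; apply: contra_notP => nAx.
have {}nAx : limn (g ^~ x) \is a fin_num.
  by apply: contra_notP nAx => nfin; apply: AP => /= /(_ I).
apply: normed_cvg; rewrite /normed_series_of.
suff bG : has_ubound (range (fun N => G N x)).
  have := nondecreasing_is_cvgn (Gmono x) bG.
  by rewrite (_ : (fun N => G N x) = [series `|w n x|]_n)//; apply/funext => N; exact: GE.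
(* G^2 <= l implies G <= l + 1 for nonnegative G. *)
exists (fine (limn (g ^~ x)) + 1) => _ [N _ <-].
have le1 : (g N x <= limn (g ^~ x))%E.
  rewrite (cvg_lim _ (ereal_nondecreasing_cvgn (gmono x I)))//.
  by apply: ereal_sup_ubound; exists N.
have {le1} : G N x ^+ 2 <= fine (limn (g ^~ x)) by rewrite -lee_fin fineK.
move: (fine _) (Gge0 N x) => a; nra.
Qed.


Lemma rL2_measurable_EFin (u : rL2) : measurable_fun setT (fun x => (u x)%:E).
Proof. by apply/measurable_EFinP; exact: rL2_measurable. Qed.

(** Riesz-Fischer: a subsequence with geometrically small increments converges almost everywhere,
    and Fatou's lemma turns this into convergence in norm. *)
Lemma rL2_complete : icomplete rL2_inner.
Proof.
move=> u uC; have eps k : 0 < 2^-1 ^+ k :> R by rewrite exprn_gt0 ?invr_gt0.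
have [N NP] := choice (fun k => uC _ (eps k)).
(* Partial sums give a monotone sequence of indices above N. *)
pose M k := (\sum_(j < k.+1) N j)%N.
have NM k : (N k <= M k)%N by rewrite /M big_ord_recr leq_addl.
have MM : {homo M : j k / (j <= k)%N >-> (j <= k)%N}.
  apply: homo_leq => // [? ? ?|k]; first exact: leq_trans.
  by rewrite [M k.+1]/M big_ord_recr leq_addr.
pose v k := u (M k).
have vP k j : (k <= j)%N -> nrm (v j - v k) <= 2^-1 ^+ k.
  by move=> kj; apply/ltW/NP; rewrite ?NM// (leq_trans (NM k))// MM.
pose w k := v k.+1 - v k.
have sumw n : \sum_(k < n) nrm (w k) <= 2.
  apply: (@le_trans _ _ (2 - 2 * 2^-1 ^+ n)); last by rewrite gerBl mulr_ge0 ?ltW.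
  elim: n => [|n IHn]; first by rewrite big_ord0 expr0 mulr1 subrr.
  rewrite big_ord_recr/= exprS.
  have := vP n n.+1 (leqnSn n); rewrite -/(w n).
  move: (nrm _) (2^-1 ^+ n) IHn => a b; lra.
have sumE n x : \sum_(0 <= k < n) w k x = v n x - v 0%N x.
  by rewrite -(telescope_sumr (fun k => v k x) (leq0n n)).
(* The upper limit is measurable and defined everywhere; it is the limit wherever there is one. *)
pose l x : \bar R := limn_esup (fun k => (v k x)%:E).
have ml : measurable_fun setT l.
  apply: (@measurable_fun_limn_esup _ _ _ setT (fun k x => (v k x)%:E)) => k.
  exact: rL2_measurable_EFin.
pose f x := fine (l x).
have mf : measurable_fun setT f by exact: (measurableT_comp (fine_measurable measurableT)).
have vf : {ae mu, forall x, (v ^~ x) @ \oo --> f x}.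
  apply: filterS (rL2_summable_ae sumw) => x cw.
  have cv : cvgn (v ^~ x).
    rewrite (_ : v ^~ x = (fun n => \sum_(0 <= k < n) w k x) \+ (fun=> v 0%N x)).
      by apply: is_cvgD => //; exact: is_cvg_cst.
    by apply/funext => n /=; rewrite sumE subrK.
  suff -> : f x = limn (v ^~ x) by [].
  rewrite /f /l is_cvg_limn_esupE.
    by rewrite EFin_lim.
  by apply/cvg_ex; exists (limn (v ^~ x))%:E; apply: cvg_EFin => //; exact: nearW.
have fv k : (\int[mu]_x ((f x - v k x) ^+ 2)%:E <= ((2^-1 ^+ k) ^+ 2)%:E)%E.
  pose h j x : \bar R := ((v j x - v k x) ^+ 2)%:E.
  have mh j : measurable_fun setT (h j).
    apply/measurable_EFinP; apply: measurable_funX.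
    by apply: measurable_funB; exact: rL2_measurable.
  have h0 j x : setT x -> (0 <= h j x)%E by rewrite lee_fin sqr_ge0.
  apply: (@le_trans _ _ (\int[mu]_x limn_einf (h ^~ x))%E).
    apply: ae_ge0_le_integral => //.
    - by move=> x _; rewrite lee_fin sqr_ge0.
    - apply/measurable_EFinP; apply: measurable_funX.
      by apply: measurable_funB => //; exact: rL2_measurable.
    - move=> x _; rewrite limn_einf_lim; apply: lime_ge; first exact: is_cvg_einfs.
      by apply: nearW => n; apply: le_ereal_inf_tmp => _ [m _ <-]; exact: h0.
    - rewrite (_ : (fun x => _) = (fun x => - limn_esup (fun n => - h n x))%E).
        apply: measurableT_comp => //.
        apply: (@measurable_fun_limn_esup _ _ _ setT (fun n x => - h n x)%E) => n.
        exact: measurableT_comp.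
      apply/funext => x; rewrite -limn_einfN; congr limn_einf.
      by apply/funext => n; exact/esym/oppeK.
    - apply: filterS vf => x vx _.
      suff hx : h ^~ x @ \oo --> ((f x - v k x) ^+ 2)%:E.
        by have [-> _] := cvg_limn_einf_sup hx.
      apply: cvg_EFin; first exact: nearW.
      rewrite expr2 (_ : _ \o _ = fun j => (v j x - v k x) * (v j x - v k x)); last first.
        by apply/funext => j /=; rewrite expr2.
      by apply: cvgM; (apply: cvgB => //; exact: cvg_cst).
  apply: (le_trans (fatou mu measurableT mh h0)).
  rewrite limn_einf_lim; apply: lime_le; first exact: is_cvg_einfs.
  apply: nearW => n; apply: (@le_trans _ _ (\int[mu]_x h (maxn n k) x)%E).
    apply: ereal_inf_lbound; by exists (maxn n k) => //=; exact: leq_maxl.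
  rewrite (rL2_sqr_norm (v (maxn n k) - v k)) lee_fin ler_sqr ?nnegrE ?inorm_ge0//.
  by rewrite vP// leq_maxr.
(* Only differences with f have been estimated so far; f itself is recovered by adding v 0 back. *)
have fv0 : (fun x => f x - v 0%N x) \in Lfun mu 2%:E.
  apply: Lfun2P; last exact: le_lt_trans (fv 0%N) (ltry _).
  by apply: measurable_funB => //; exact: rL2_measurable.
pose L := mk_rL2 fv0 + v 0%N.
have LE x : L x = f x by rewrite /= subrK.
exists L => e e0; have e20 : 0 < e / 2 by rewrite divr_gt0.
have [k ke] : exists k, 2^-1 ^+ k < e / 2 :> R.
  have [k kP] := ltr_add_invr e20; exists k; rewrite add0r in kP.
  apply: le_lt_trans kP; rewrite exprVn lef_pV2 ?posrE ?exprn_gt0//.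
  by rewrite -natrX ler_nat ltn_expl.
exists (M k) => j Mj; rewrite (le_lt_trans (inormB_trans rL2_semi_inner (v k) _ _))//.
rewrite [e]splitr ltrD//.
  apply: lt_trans ke; apply: NP => //.
  exact: leq_trans Mj.
apply: le_lt_trans ke; rewrite -ler_sqr ?nnegrE ?inorm_ge0// -lee_fin.
rewrite (inormBC rL2_semi_inner) -rL2_sqr_norm; apply: le_trans (fv k).
rewrite le_eqVlt; apply/orP; left; apply/eqP/eq_integral => x _.
by congr ((_ ^+ 2)%:E); rewrite -(LE x).
Qed.

End real_L2.

(** * Change of variables for the Lebesgue measure of column vectors *)

Section measurable_matrix_operations.
Context d (T : measurableType d) (R : realType).

Lemma measurable_mx_entry m n (f : T -> 'M[R]_(m, n)) i j :
  measurable_fun setT f -> measurable_fun setT (fun t => f t i j).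
Proof. by move=> mf; exact: (measurableT_comp (measurable_mx_coord _ _)). Qed.

Lemma measurable_mulmx m n p (f : T -> 'M[R]_(m, n)) (g : T -> 'M[R]_(n, p)) :
  measurable_fun setT f -> measurable_fun setT g ->
  measurable_fun setT (fun t => f t *m g t).
Proof.
move=> mf mg; apply: measurable_fun_mxP => i j.
under eq_fun do rewrite mxE.
apply: (@measurable_sum _ _ _ setT _ _ (fun k t => f t i k * g t k j)) => k.
by apply: measurable_funM; exact: measurable_mx_entry.
Qed.

Lemma measurable_addmx m n (f g : T -> 'M[R]_(m, n)) :
  measurable_fun setT f -> measurable_fun setT g ->
  measurable_fun setT (fun t => f t + g t).
Proof.
move=> mf mg; apply: measurable_fun_mxP => i j.
under eq_fun do rewrite mxE.
by apply: measurable_funD; exact: measurable_mx_entry.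
Qed.

Lemma measurable_oppmx m n (f : T -> 'M[R]_(m, n)) :
  measurable_fun setT f -> measurable_fun setT (fun t => - f t).
Proof.
move=> mf; apply: measurable_fun_mxP => i j.
under eq_fun do rewrite mxE.
by apply: measurableT_comp => //; exact: measurable_mx_entry.
Qed.

Lemma measurable_scalemx m n (a : T -> R) (f : T -> 'M[R]_(m, n)) :
  measurable_fun setT a -> measurable_fun setT f ->
  measurable_fun setT (fun t => a t *: f t).
Proof.
move=> ma mf; apply: measurable_fun_mxP => i j.
under eq_fun do rewrite mxE.
by apply: measurable_funM => //; exact: measurable_mx_entry.
Qed.

Lemma measurable_trmx m n (f : T -> 'M[R]_(m, n)) :
  measurable_fun setT f -> measurable_fun setT (fun t => (f t)^T).
Proof.
move=> mf; apply: measurable_fun_mxP => i j.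
by under eq_fun do rewrite mxE; exact: measurable_mx_entry.
Qed.

Lemma measurable_det n (f : T -> 'M[R]_n) :
  measurable_fun setT f -> measurable_fun setT (fun t => \det (f t)).
Proof.
move=> mf; rewrite /determinant.
apply: (@measurable_sum _ _ _ setT _ _
  (fun s : 'S_n => fun t => (-1) ^+ s * \prod_i f t i (s i))) => s.
apply: measurable_funM => //.
apply: measurable_prod => i _; exact: measurable_mx_entry.
Qed.

Lemma measurable_invmx n (f : T -> 'M[R]_n) :
  measurable_fun setT f -> measurable_fun setT (fun t => invmx (f t)).
Proof.
move=> mf; have mdet := measurable_det mf.
rewrite (_ : (fun t => _) = fun t => if (\det (f t)) == 0 then f t
    else (\det (f t))^-1 *: \adj (f t)); last first.
  apply/funext => t; rewrite /invmx unitmxE unitfE.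
  by case: eqP.
apply: measurable_fun_ifT => //.
  exact: measurable_fun_eqr.
apply: measurable_scalemx.
  rewrite (_ : (fun t => _) = fun t => \det (f t) * (\det (f t) ^+ 2) `^ (-1)).
    apply: measurable_funM => //; apply: (measurableT_comp (measurable_powR _)).
    exact: measurable_funX.
  apply/funext => t; rewrite powR_inv1 ?sqr_ge0// expr2 invfM.
  have [->|det0] := eqVneq (\det (f t)) 0; first by rewrite invr0 mul0r.
  by rewrite mulrA divff// mul1r.
apply: measurable_fun_mxP => i j; under eq_fun do rewrite mxE.
apply: measurable_funM => //; apply: measurable_det.
apply: measurable_fun_mxP => k l; under eq_fun do rewrite !mxE.
exact: measurable_mx_entry.
Qed.

End measurable_matrix_operations.

Section affine_change_of_variables.
Context (R : realType).
Local Notation leb := (lebesgue_cV R).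

(** The map multiplies volumes by c. Stating this for integrals of nonnegative functions suits
    composition and Tonelli's theorem. *)
Definition rescales n (phi : 'cV[R]_n -> 'cV[R]_n) (c : R) : Prop :=
  [/\ measurable_fun setT phi, 0 < c &
   forall F : 'cV[R]_n -> \bar R, measurable_fun setT F -> (forall v, 0 <= F v)%E ->
     (c%:E * \int[leb n]_v F (phi v) = \int[leb n]_v F v)%E].

Lemma rescales_comp n (phi psi : 'cV[R]_n -> 'cV[R]_n) c d :
  rescales phi c -> rescales psi d -> rescales (phi \o psi) (c * d).
Proof.
move=> [mphi c0 phiP] [mpsi d0 psiP]; split; [exact: measurableT_comp|exact: mulr_gt0|].
move=> F mF F0; rewrite EFinM -muleA.
by rewrite (psiP (F \o phi) (measurableT_comp mF mphi) (fun=> F0 _)) phiP.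
Qed.

Lemma integral_lebesgue_cVS n (F : 'cV[R]_n.+1 -> \bar R) :
  measurable_fun setT F -> (forall v, 0 <= F v)%E ->
  (\int[leb n.+1]_v F v =
   \int[(lebesgue_measure \x leb n)%E]_p F (@cV_cons R n p))%E.
Proof.
move=> mF F0; rewrite /= /cons_measure ge0_integral_pushforward//.
exact: measurable_cV_cons.
Qed.

(** Lebesgue measure is determined by its values on half-open intervals, so it suffices to compute
    the preimages of those; for u < 0 they are half-open at the other end. *)
Lemma ge0_integral_affine (u b : R) (F : R -> \bar R) : u != 0 ->
  measurable_fun setT F -> (forall x, 0 <= F x)%E ->
  (`|u|%:E * \int[lebesgue_measure]_x F (u * x + b)%R =
   \int[lebesgue_measure]_x F x)%E.
Proof.
move=> u0 mF F0.
have maff (a c : R) : measurable_fun [set: measurableTypeR R]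
    ((fun x => a * x + c) : R -> measurableTypeR R).
  by apply: measurable_funD => //; exact: measurable_funM.
pose k : {nonneg R} := NngNum (normr_ge0 u).
rewrite -[in LHS](@ge0_integral_pushforward _ _ _ _ _ _ (maff u b) _ setT)//.
rewrite -[`|u|]/(k%:num) -ge0_integral_mscale//.
apply/esym/eq_measure_integral => A mA _.
apply: lebesgue_measure_unique => //= _ [[s t]] _ <-.
rewrite /mscale/= /pushforward.
have [u_lt0|u_gt0|u00] := ltgtP u 0; last by rewrite u00 eqxx in u0.
- rewrite (_ : _ @^-1` _ = `[(t - b) / u, (s - b) / u[%classic); last first.
    apply/seteqP; split=> x /=; rewrite !in_itv/=.
      by rewrite ltr_ndivlMr// ler_ndivrMr// ltrBlDr lerBrDr mulrC andbC.
    by rewrite ltr_ndivlMr// ler_ndivrMr// ltrBlDr lerBrDr mulrC andbC.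
  rewrite !lebesgue_measure_itv/= !lte_fin ltr_nM2r ?invr_lt0// ltrD2r.
  case: ifPn => _; last by rewrite mule0.
  by rewrite -!EFinD -EFinM ltr0_norm//; congr EFin; field.
- rewrite (_ : _ @^-1` _ = `](s - b) / u, (t - b) / u]%classic); last first.
    apply/seteqP; split=> x /=; rewrite !in_itv/=.
      by rewrite ltr_pdivrMr// ler_pdivlMr// ltrBlDr lerBrDr mulrC.
    by rewrite ltr_pdivrMr// ler_pdivlMr// ltrBlDr lerBrDr mulrC.
  rewrite !lebesgue_measure_itv/= !lte_fin ltr_pM2r ?invr_gt0// ltrD2r.
  case: ifPn => _; last by rewrite mule0.
  by rewrite -!EFinD -EFinM gtr0_norm//; congr EFin; field.
Qed.

Lemma rescales_ext n (phi psi : 'cV[R]_n -> 'cV[R]_n) c d :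
  phi =1 psi -> c = d -> rescales phi c -> rescales psi d.
Proof. by move=> /funext -> ->. Qed.

Lemma measurable_fun_cV_consl n (F : 'cV[R]_n.+1 -> \bar R) v :
  measurable_fun setT F -> measurable_fun setT (fun x => F (cV_cons (x, v))).
Proof.
move=> mF; apply: (measurableT_comp mF).
exact: (measurableT_comp (@measurable_cV_cons R n) (pair2_measurable v)).
Qed.

Lemma measurable_fun_cV_consr n (F : 'cV[R]_n.+1 -> \bar R) x :
  measurable_fun setT F -> measurable_fun setT (fun v => F (cV_cons (x, v))).
Proof.
move=> mF; apply: (measurableT_comp mF).
exact: (measurableT_comp (@measurable_cV_cons R n) (pair1_measurable x)).
Qed.

Lemma measurable_head n : measurable_fun setT (fun v : 'cV[R]_n.+1 => v ord0 ord0).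
Proof. exact: measurable_mx_coord. Qed.

Lemma measurable_tail n :
  measurable_fun setT (fun v : 'cV[R]_n.+1 => dsubmx (v : 'cV_(1 + n))).
Proof.
apply: measurable_fun_mxP => i j; under eq_fun do rewrite mxE.
exact: measurable_mx_coord.
Qed.

Lemma dsubmx_cV_cons n (p : R * 'cV[R]_n) : dsubmx (cV_cons p : 'cV_(1 + n)) = p.2.
Proof. exact: col_mxKd. Qed.

(** For a fixed tail the map is affine in the first coordinate, which Tonelli integrates first. *)
Lemma rescales_head n (u : R) (r : 'rV[R]_n) : u != 0 ->
  rescales (fun v : 'cV[R]_n.+1 => block_mx u%:M r 0 1%:M *m (v : 'cV_(1 + n))) `|u|.
Proof.
move=> u0; set phi := fun v => _.
have phiE x v : phi (cV_cons (x, v)) = cV_cons (u * x + (r *m v) ord0 ord0, v).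
  rewrite /phi /cV_cons mul_block_col mul0mx add0r mul1mx; congr col_mx.
  rewrite -scalar_mxM raddfD/=; congr (_ + _).
  exact: mx11_scalar.
have mphi : measurable_fun setT phi.
  by apply: measurable_mulmx => //; exact: measurable_cst.
split=> //; first by rewrite normr_gt0.
move=> F mF F0; rewrite !integral_lebesgue_cVS//; last exact: measurableT_comp.
rewrite !fubini_tonelli2//; do ?by apply: measurableT_comp => //; exact: measurable_cV_cons.
  rewrite -ge0_integralZl//=; last 2 first.
  - apply: (@measurable_fun_fubini_tonelli_G _ _ _ _ R lebesgue_measure
      (fun p => F (phi (cV_cons p)))) => //.
    by do 2!apply: measurableT_comp => //; exact: measurable_cV_cons.
  - by move=> v _; exact: integral_ge0.
  apply: eq_integral => v _; rewrite /fubini_G.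
  under eq_integral do rewrite phiE.
  rewrite (ge0_integral_affine _ (F := fun x => F (cV_cons (x, v))))//.
  exact: measurable_fun_cV_consl.
by do 2!apply: measurableT_comp => //; exact: measurable_cV_cons.
Qed.

(** The map of the tail may depend on the first coordinate, but its factor may not; Tonelli
    integrates the tail first. *)
Lemma rescales_tail n (psi : R -> 'cV[R]_n -> 'cV[R]_n) c :
  measurable_fun setT (fun p : R * 'cV[R]_n => psi p.1 p.2) ->
  (forall x, rescales (psi x) c) ->
  rescales (fun v : 'cV[R]_n.+1 =>
    cV_cons (v ord0 ord0, psi (v ord0 ord0) (dsubmx (v : 'cV_(1 + n))))) c.
Proof.
move=> mpsi psiP; set phi := fun v => _.
have phiE x v : phi (cV_cons (x, v)) = cV_cons (x, psi x v).
  by rewrite /phi cV_cons0 dsubmx_cV_cons.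
have mphi : measurable_fun setT phi.
  have mht : measurable_fun setT (fun v : 'cV[R]_n.+1 =>
      (v ord0 ord0, dsubmx (v : 'cV_(1 + n)))).
    by apply: measurable_fun_pair; [exact: measurable_head|exact: measurable_tail].
  have mpsi' := measurableT_comp mpsi mht.
  have mg := measurable_fun_pair (@measurable_head n) mpsi'.
  exact: (measurableT_comp (@measurable_cV_cons R n) mg).
have [_ c0 _] := psiP 0; split=> // F mF F0.
rewrite !integral_lebesgue_cVS//; last exact: measurableT_comp.
have mFc : measurable_fun setT (fun p => F (cV_cons p)).
  by apply: measurableT_comp => //; exact: measurable_cV_cons.
have mFpc : measurable_fun setT (fun p => F (phi (cV_cons p))).
  by do 2!apply: measurableT_comp => //; exact: measurable_cV_cons.
rewrite !fubini_tonelli1// -ge0_integralZl//=; last 3 first.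
- exact: (@measurable_fun_fubini_tonelli_F _ _ _ _ R (leb n) (fun p => F (phi (cV_cons p)))).
- by move=> v _; exact: integral_ge0.
- by rewrite lee_fin ltW.
apply: eq_integral => x _; rewrite /fubini_F.
under eq_integral do rewrite phiE.
have [_ _ /(_ (fun v => F (cV_cons (x, v)))) ->//] := psiP x.
exact: measurable_fun_cV_consr.
Qed.

Lemma rescales_id n : @rescales n id 1.
Proof. by split=> // F mF F0; rewrite mul1e. Qed.

Lemma cV_consE0 n (p : R * 'cV[R]_n) : cV_cons p ord0 0 = p.1.
Proof. exact: cV_cons0. Qed.

Lemma cV_consES n (p : R * 'cV[R]_n) i : cV_cons p (lift ord0 i) 0 = p.2 i 0.
Proof. exact: cV_consS. Qed.

Lemma rescales_translation n (b : 'cV[R]_n) : rescales (fun v => v + b) 1.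
Proof.
elim: n b => [|n IHn] b.
  by apply: rescales_ext (rescales_id 0) => // v; apply/matrixP => -[].
have mtl : measurable_fun setT (fun p : R * 'cV[R]_n => p.2 + dsubmx (b : 'cV_(1 + n))).
  by apply: measurable_addmx => //; exact: measurable_cst.
have tail := rescales_tail mtl (fun=> IHn _).
pose b0 := b ord0 ord0.
suff head : rescales (fun v : 'cV[R]_n.+1 => v + cV_cons (b0, 0)) 1.
  apply: rescales_ext (rescales_comp head tail); rewrite ?mulr1// => v /=.
  apply/matrixP => i j; rewrite (ord1 j) [LHS]mxE [RHS]mxE.
  have [k ->|->] := unliftP ord0 i; last by rewrite !cV_consE0.
  rewrite !cV_consES !mxE addr0; congr (v _ _ + b _ _); exact/val_inj.
have phiE x v : cV_cons (x, v) + cV_cons (b0, 0) = cV_cons (1 * x + b0, v).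
  apply/matrixP => i j; rewrite (ord1 j) [LHS]mxE.
  have [k ->|->] := unliftP ord0 i; last by rewrite !cV_consE0 mul1r.
  by rewrite !cV_consES mxE addr0.
have mphi : measurable_fun setT (fun v : 'cV[R]_n.+1 => v + cV_cons (b0, 0)).
  by apply: measurable_addmx => //; exact: measurable_cst.
split=> // F mF F0; rewrite mul1e !integral_lebesgue_cVS//; last exact: measurableT_comp.
have mFc := measurableT_comp mF (@measurable_cV_cons R n).
have mFp := measurableT_comp (measurableT_comp mF mphi) (@measurable_cV_cons R n).
rewrite !fubini_tonelli2//.
apply: eq_integral => v _; rewrite /fubini_G.
under eq_integral do rewrite phiE.
rewrite -(ge0_integral_affine b0 (oner_neq0 R) (F := fun x => F (cV_cons (x, v))))//.
  by rewrite normr1 mul1e.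
exact: measurable_fun_cV_consl.
Qed.

(* Gaussian elimination: a shear makes the pivot nonzero, and the rest is a       *)
(* product of a map of the head and a map of the tail.                            *)
Lemma rescales_mulmx n (h : 'M[R]_n) : h \in unitmx ->
  rescales (fun v => h *m v) `|\det h|.
Proof.
elim: n h => [|n IHn] h hU.
  apply: rescales_ext (rescales_id 0) => [v|]; first by apply/matrixP => -[].
  by rewrite det_mx00 normr1.
pose sh (r : 'rV[R]_n) : 'M[R]_(1 + n) := block_mx 1%:M r 0 1%:M.
have shV r : sh (- r) *m sh r = 1%:M.
  rewrite /sh mulmx_block !mul1mx !mulmx1 !mul0mx !mulmx0 !addr0 !add0r subrr.
  by rewrite -scalar_mx_block.
have detsh r : \det (sh r) = 1 by rewrite det_ublock !det1 mulr1.
have shear r (g : 'M[R]_(1 + n)) : rescales (fun v => (sh r *m g) *m v) `|\det (sh r *m g)| ->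
    rescales (fun v => g *m v) `|\det g|.
  move=> sP; apply: rescales_ext (rescales_comp (rescales_head (- r) (oner_neq0 R)) sP).
    by move=> v /=; rewrite !mulmxA shV mul1mx.
  by rewrite normr1 mul1r det_mulmx detsh mul1r.
suff pivot (g : 'M[R]_(1 + n)) : g \in unitmx -> g ord0 ord0 != 0 ->
    rescales (fun v => g *m v) `|\det g|.
  have [h00|h00] := eqVneq (h ord0 ord0) 0; last exact: pivot.
  (* The first column of an invertible matrix is nonzero; adding row k of the lower block to the
     first row makes the pivot nonzero. *)
  have [k hk] : exists k : 'I_n, h (lift ord0 k) ord0 != 0.
    apply/existsP; apply: contraLR hU; rewrite negb_exists => /forallP hk.
    rewrite unitmxE unitfE negbK (expand_det_col _ ord0) big1// => i _.
    have [k ->|->] := unliftP ord0 i; last by rewrite h00 mul0r.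
    by move: (hk k); rewrite negbK => /eqP ->; rewrite mul0r.
  have hE : sh (delta_mx ord0 k) *m h =
      col_mx (usubmx (h : 'M[R]_(1 + n)) + row k (dsubmx (h : 'M[R]_(1 + n))))
             (dsubmx (h : 'M[R]_(1 + n))).
    by rewrite -[h in LHS](vsubmxK (h : 'M[R]_(1 + n))) mul_block_col !mul1mx mul0mx add0r rowE.
  apply: (shear (delta_mx ord0 k)); apply: pivot.
    by rewrite unitmx_mul hU andbT unitmxE detsh unitr1.
  have -> : (sh (delta_mx ord0 k) *m h) ord0 ord0 = h ord0 ord0 + h (lift ord0 k) ord0.
    rewrite hE; transitivity (col_mx (usubmx (h : 'M[R]_(1 + n)) +
        row k (dsubmx (h : 'M[R]_(1 + n)))) (dsubmx (h : 'M[R]_(1 + n))) (lshift n ord0) ord0).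
      by congr (col_mx _ _ _ _); exact/val_inj.
    by rewrite col_mxEu !mxE; congr (h _ _ + h _ _); exact/val_inj.
  by rewrite h00 add0r.
move=> gU g00.
pose u := g ord0 ord0; pose r := ursubmx g; pose c := dlsubmx g.
(* The Schur complement of the pivot. *)
pose L := drsubmx g - u^-1 *: (c *m r).
have ulE : ulsubmx g = u%:M.
  rewrite [LHS]mx11_scalar; congr scalar_mx; rewrite !mxE /u.
  by congr (g _ _); exact/val_inj.
have gE : g = block_mx 1%:M 0 (u^-1 *: c) L *m block_mx u%:M r 0 1%:M.
  rewrite mulmx_block !mul1mx !mul0mx !mulmx0 !addr0 mulmx1 mul_mx_scalar scalerA.
  by rewrite divff// scale1r -scalemxAl addrC subrK -ulE /r /c submxK.
have detg : \det g = \det L * u.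
  by rewrite gE det_mulmx det_lblock det_ublock !det1 mul1r mulr1 det_scalar1.
have LU : L \in unitmx.
  by move: gU; rewrite !unitmxE detg unitrM => /andP[].
have mpsi : measurable_fun setT (fun p : R * 'cV[R]_n => L *m p.2 + p.1 *: (u^-1 *: c)).
  apply: measurable_addmx.
    by apply: measurable_mulmx => //; exact: measurable_cst.
  by apply: measurable_scalemx => //; exact: measurable_cst.
have psiP x : rescales (fun v => L *m v + x *: (u^-1 *: c)) `|\det L|.
  apply: rescales_ext (rescales_comp (rescales_translation (x *: (u^-1 *: c))) (IHn _ LU)) => //.
  by rewrite mul1r.
apply: rescales_ext (rescales_comp (rescales_tail mpsi psiP) (rescales_head r g00)); last first.
  by rewrite detg normrM.
move=> v /=; rewrite [in RHS]gE -mulmxA; move: (block_mx _ _ _ _ *m _) => w.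
rewrite -[w in RHS](vsubmxK (w : 'cV_(1 + n))) mul_block_col mul1mx mul0mx addr0.
apply: (congr2 (@col_mx R 1 n 1)); last first.
  rewrite addrC; congr (_ + _); rewrite [usubmx _]mx11_scalar mul_mx_scalar.
  by congr (_ *: _); rewrite mxE; congr (w _ _); exact/val_inj.
rewrite [RHS]mx11_scalar; congr scalar_mx; rewrite mxE; congr (w _ _); exact/val_inj.
Qed.

End affine_change_of_variables.

(** * Biinvariant measures *)

Lemma muleI_fin (R : realType) (x y z : \bar R) :
  (0 < z < +oo)%E -> (x * z = y * z)%E -> x = y.
Proof.
case: z => [r| |]//; rewrite ?ltxx ?andbF// lte_fin => /andP[r0 _].
move/(congr1 (fun t => t * (r^-1)%:E)%E).
by rewrite -!muleA -EFinM divff ?gt_eqF// !mule1.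
Qed.

Section biinvariant_measures.
Context d (X : measurableType d) (R : realType).
Context (mul : X -> X -> X) (inv : X -> X) (G : set X).

(** The operations are measurable on the whole ambient space, but they satisfy the group identities
    only on G, which carries the measures. The last two identities are the ones used in Weil's
    substitutions. *)
Record measurable_group : Prop := MeasurableGroup {
  mgroup_measurable : measurable G;
  mgroup_measurable_mul : measurable_fun setT (fun p : X * X => mul p.1 p.2);
  mgroup_measurable_inv : measurable_fun setT inv;
  mgroup_mul : forall x y, G x -> G y -> G (mul x y);
  mgroup_inv : forall x, G x -> G (inv x);
  mgroup_mulK : forall x y, G x -> G y -> mul (mul x y) (inv y) = x;
  mgroup_mul_inv : forall x y, G x -> G y -> mul x (inv (mul y x)) = inv y }.

Record biinvariant (nu : set X -> \bar R) : Prop := Biinvariant {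
  biinvariant_carrier : nu (~` G) = 0%E;
  biinvariantl : forall g, G g -> forall f : X -> \bar R, measurable_fun setT f ->
    (forall x, 0 <= f x)%E -> (\int[nu]_x f (mul g x) = \int[nu]_x f x)%E;
  biinvariantr : forall g, G g -> forall f : X -> \bar R, measurable_fun setT f ->
    (forall x, 0 <= f x)%E -> (\int[nu]_x f (mul x g) = \int[nu]_x f x)%E }.

Context (mgG : measurable_group).

Lemma eq_integral_carrier (nu : {measure set X -> \bar R}) (f h : X -> \bar R) :
  nu (~` G) = 0%E -> measurable_fun setT f -> measurable_fun setT h ->
  (forall x, 0 <= f x)%E -> (forall x, 0 <= h x)%E -> (forall x, G x -> f x = h x) ->
  (\int[nu]_x f x = \int[nu]_x h x)%E.
Proof.
move=> nuG mf mh f0 h0 fh; apply: ge0_ae_eq_integral => //.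
exists (~` G); split=> //; first by apply: measurableC; exact: mgroup_measurable.
by move=> x /=; apply: contra_not => Gx _; exact: fh.
Qed.

(* Weil's uniqueness argument, for biinvariant measures. *)
Lemma biinvariant_prod (mu nu : {sigma_finite_measure set X -> \bar R}) (f h : X -> \bar R) :
  biinvariant mu -> biinvariant nu -> measurable_fun setT f -> measurable_fun setT h ->
  (forall x, 0 <= f x)%E -> (forall x, 0 <= h x)%E ->
  ((\int[mu]_x f x) * (\int[nu]_x h x) = (\int[nu]_x f (inv x)) * (\int[mu]_x h x))%E.
Proof.
move=> [muG mul_ mur] [nuG nul nur] mf mh f0 h0.
have [mG mmul minv Gmul Ginv mulK mulinv] := mgG.
have mmul_l x : measurable_fun setT (mul x).
  exact: (measurableT_comp mmul (pair1_measurable x)).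
have mmul_r y : measurable_fun setT (mul^~ y).
  exact: (measurableT_comp mmul (pair2_measurable y)).
have mfi : measurable_fun setT (f \o inv) by exact: measurableT_comp.
have int0 (m : {measure set X -> \bar R}) (k : X -> \bar R) :
    (forall x, 0 <= k x)%E -> (0 <= \int[m]_x k x)%E by move=> k0; exact: integral_ge0.
(* The substitutions turn the double integral of f(x) h(x y) into that of f(x y^-1) h(x) (by x -> x
   y^-1), then into that of f(y^-1) h(x) (by y -> y x). *)
pose F (p : X * X) : \bar R := (f p.1 * h (mul p.1 p.2))%E.
have mF : measurable_fun setT F.
  by apply: emeasurable_funM; [exact: (measurableT_comp mf)|exact: (measurableT_comp mh)].
have F0 p : (0 <= F p)%E by rewrite mule_ge0.
pose K (p : X * X) : \bar R := (h p.1 * f (mul p.1 (inv p.2)))%E.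
have mmi : measurable_fun setT (fun p : X * X => mul p.1 (inv p.2)).
  apply: (measurableT_comp (f := fun p : X * X => mul p.1 p.2) (g := fun p => (p.1, inv p.2))) => //.
  by apply: measurable_fun_pair => //; exact: measurableT_comp.
have mK : measurable_fun setT K.
  by apply: emeasurable_funM; [exact: (measurableT_comp mh)|exact: (measurableT_comp mf)].
have K0 p : (0 <= K p)%E by rewrite mule_ge0.
transitivity (\int[mu]_x \int[nu]_y F (x, y))%E.
  rewrite -ge0_integralZr//; last exact: int0.
  apply: eq_integral_carrier => //.
  - by apply: emeasurable_funM => //; exact: measurable_cst.
  - exact: measurable_fun_fubini_tonelli_F.
  - by move=> x; rewrite mule_ge0// int0.
  - by move=> x; exact: int0.
  move=> x Gx; rewrite /F /= ge0_integralZl//; last exact: measurableT_comp.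
  by rewrite nul.
rewrite fubini_tonelli//.
transitivity (\int[nu]_y \int[mu]_x K (x, y))%E.
  apply: eq_integral_carrier => //.
  - exact: (@measurable_fun_fubini_tonelli_G _ _ _ _ _ mu F).
  - exact: (@measurable_fun_fubini_tonelli_G _ _ _ _ _ mu K).
  - by move=> x; exact: int0.
  - by move=> x; exact: int0.
  move=> y Gy; have mKy := measurableT_comp mK (pair2_measurable y).
  rewrite -(mur y Gy _ mKy (fun=> K0 _)).
  apply: eq_integral_carrier => //.
  - exact: (measurableT_comp mF (pair2_measurable y)).
  - exact: (measurableT_comp mKy (mmul_r y)).
  - by move=> x; rewrite mule_ge0.
  by move=> x Gx; rewrite /F /K /= mulK// muleC.
rewrite -fubini_tonelli// muleC -ge0_integralZr//; last exact: int0.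
apply: eq_integral_carrier => //.
- exact: measurable_fun_fubini_tonelli_F.
- by apply: emeasurable_funM => //; exact: measurable_cst.
- by move=> x; exact: int0.
- by move=> x; rewrite mule_ge0// int0.
move=> x Gx; have mfx : measurable_fun setT (fun y => f (mul x (inv y))).
  exact: (measurableT_comp (measurableT_comp mf (mmul_l x)) minv).
rewrite /K /= ge0_integralZl//; congr (_ * _)%E.
rewrite -(nur x Gx (fun y => f (mul x (inv y))))//.
apply: eq_integral_carrier => //; first exact: (measurableT_comp mfx (mmul_r x)).
by move=> y Gy; rewrite mulinv.
Qed.

(** [biinvariant_prod] with both measures equal, divided by the integral of h. *)
Lemma biinvariant_inv (mu : {sigma_finite_measure set X -> \bar R}) (f h : X -> \bar R) :
  biinvariant mu -> measurable_fun setT f -> measurable_fun setT h ->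
  (forall x, 0 <= f x)%E -> (forall x, 0 <= h x)%E ->
  (0 < \int[mu]_x h x < +oo)%E -> (\int[mu]_x f (inv x) = \int[mu]_x f x)%E.
Proof.
move=> bmu mf mh f0 h0 hfin; apply: (muleI_fin hfin).
exact/esym/biinvariant_prod.
Qed.

(** By [biinvariant_inv] for nu, the inversion in [biinvariant_prod] disappears; h then fixes the
    ratio m of the measures. *)
Lemma biinvariant_unique (mu nu : {sigma_finite_measure set X -> \bar R}) (m : R)
    (f h : X -> \bar R) :
  biinvariant mu -> biinvariant nu -> measurable_fun setT f -> measurable_fun setT h ->
  (forall x, 0 <= f x)%E -> (forall x, 0 <= h x)%E -> 0 < m ->
  (0 < \int[mu]_x h x < +oo)%E -> (\int[nu]_x h x = m%:E * \int[mu]_x h x)%E ->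
  (\int[nu]_x f x = m%:E * \int[mu]_x f x)%E.
Proof.
move=> bmu bnu mf mh f0 h0 m0 hfin hm; apply: (muleI_fin hfin).
rewrite -(biinvariant_inv bnu mf mh f0 h0).
  by rewrite -(biinvariant_prod bmu bnu mf mh f0 h0) hm muleCA muleA.
move: hfin => /andP[hgt0 hoo]; rewrite hm; apply/andP; split; first by rewrite mule_gt0.
by rewrite lte_mul_pinfty ?lee_fin// ltW.
Qed.

End biinvariant_measures.

Local Open Scope complex_scope.

(** * Complex L2 spaces *)

Lemma measurable_complexP (R : realType) d (T : measurableType d) (f : T -> R[i]) :
  measurable_fun setT f <-> measurable_fun setT (fun x => complex.Re (f x)) /\
    measurable_fun setT (fun x => complex.Im (f x)).
Proof.
have mpair : measurable_fun setT (@complex_pair R).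
  by move=> _ B mB; exists B.
split=> [mf|[mRe mIm]].
  have mp : measurable_fun setT (@complex_pair R \o f) by exact: measurableT_comp.
  by split; [exact: (measurableT_comp measurable_fst mp)|
             exact: (measurableT_comp measurable_snd mp)].
move=> _ _ [B mB <-]; rewrite !setTI -comp_preimage.
have mp : measurable_fun setT (@complex_pair R \o f) by exact: (measurable_fun_pair mRe mIm).
by rewrite -[X in measurable X]setTI; exact: mp.
Qed.

Lemma sqr_Re_normc (R : realType) (z : R[i]) :
  complex.Re `|z| ^+ 2 = complex.Re z ^+ 2 + complex.Im z ^+ 2.
Proof. by case: z => a b; rewrite normc_def/= sqr_sqrtr// addr_ge0 ?sqr_ge0. Qed.

Section complex_L2.
Context d (T : measurableType d) (R : realType) (mu : {measure set T -> \bar R}).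

(** Complex functions as pairs of real and imaginary parts, viewed as a real space; [cL2_inner] is
    the real part of the complex inner product. *)
Definition cL2 : Type := (rL2 mu * rL2 mu)%type.
HB.instance Definition _ := GRing.Lmodule.copy cL2 (rL2 mu * rL2 mu)%type.

Definition cL2_inner (e f : cL2) : R := rL2_inner e.1 f.1 + rL2_inner e.2 f.2.

Lemma cL2_semi_inner : semi_inner cL2_inner.
Proof.
have [iC iD iZ i0] := rL2_semi_inner mu; split=> [e f|e f g|a e f|e];
  rewrite /cL2_inner.
- by rewrite !(iC e.1) !(iC e.2).
- by rewrite !iD addrACA.
- by rewrite !iZ mulrDr.
- by rewrite addr_ge0.
Qed.

Local Notation nrm := (inorm cL2_inner).

Lemma cL2_complete : icomplete cL2_inner.
Proof.
have rP := rL2_semi_inner mu; have cP := cL2_semi_inner.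
have le1 e : inorm (@rL2_inner _ _ _ mu) e.1 <= nrm e.
  rewrite -ler_sqr ?nnegrE ?inorm_ge0// !sqr_inorm//.
  by rewrite lerDl (semi_inner_ge0 rP).
have le2 e : inorm (@rL2_inner _ _ _ mu) e.2 <= nrm e.
  rewrite -ler_sqr ?nnegrE ?inorm_ge0// !sqr_inorm//.
  by rewrite lerDr (semi_inner_ge0 rP).
have le12 e : nrm e <= inorm (@rL2_inner _ _ _ mu) e.1 + inorm (@rL2_inner _ _ _ mu) e.2.
  rewrite -ler_sqr ?nnegrE ?addr_ge0 ?inorm_ge0// sqrrD !sqr_inorm// /cL2_inner.
  by rewrite addrAC lerDl mulrn_wge0// mulr_ge0 ?inorm_ge0.
move=> u uC.
have [l1 ul1] : exists l, icvg (@rL2_inner _ _ _ mu) (fun k => (u k).1) l.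
  apply: rL2_complete => e /uC[N NP]; exists N => k m Nk Nm.
  exact: le_lt_trans (le1 (u k - u m)) (NP _ _ Nk Nm).
have [l2 ul2] : exists l, icvg (@rL2_inner _ _ _ mu) (fun k => (u k).2) l.
  apply: rL2_complete => e /uC[N NP]; exists N => k m Nk Nm.
  exact: le_lt_trans (le2 (u k - u m)) (NP _ _ Nk Nm).
exists (l1, l2) => e e0; have e20 : 0 < e / 2 by rewrite divr_gt0.
have [N NP] := ul1 _ e20; have [M MP] := ul2 _ e20.
exists (maxn N M) => k; rewrite geq_max => /andP[Nk Mk].
rewrite (le_lt_trans (le12 _))// [e]splitr ltrD//; [exact: NP|exact: MP].
Qed.

Definition cfun (e : cL2) : T -> R[i] := fun x => e.1 x +i* e.2 x.

Lemma L2normE (f : T -> R[i]) : L2norm mu f =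
  ((\int[mu]_x (complex.Re (f x) ^+ 2 + complex.Im (f x) ^+ 2)%:E) `^ 2^-1)%E.
Proof.
rewrite /L2norm unlock; congr (_ `^ _)%E; apply: eq_integral => x _ /=.
by rewrite powR_mulrn// real_normK ?num_real// sqr_Re_normc.
Qed.

Lemma L2norm_cfun e : L2norm mu (cfun e) = (nrm e)%:E.
Proof.
rewrite L2normE /=.
under eq_integral do rewrite EFinD.
rewrite ge0_integralD//=; last 4 first.
- by move=> x _; rewrite lee_fin sqr_ge0.
- by apply/measurable_EFinP; apply: measurable_funX; exact: rL2_measurable.
- by move=> x _; rewrite lee_fin sqr_ge0.
- by apply/measurable_EFinP; apply: measurable_funX; exact: rL2_measurable.
rewrite !rL2_sqr_norm !(sqr_inorm (rL2_semi_inner mu)) -EFinD poweR_EFin.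
by rewrite powR12_sqrt ?(semi_inner_ge0 cL2_semi_inner e).
Qed.

Lemma cfun_L2 e : L2 mu (cfun e).
Proof.
split; last by rewrite L2norm_cfun ltry.
by apply/measurable_complexP; split; exact: rL2_measurable.
Qed.

Lemma L2_Lfun2 f : L2 mu f -> (fun x => complex.Re (f x)) \in Lfun mu 2%:E /\
  (fun x => complex.Im (f x)) \in Lfun mu 2%:E.
Proof.
move=> [/measurable_complexP[mRe mIm]]; rewrite L2normE => foo.
have fin : (\int[mu]_x (complex.Re (f x) ^+ 2 + complex.Im (f x) ^+ 2)%:E < +oo)%E.
  by apply: (@lty_poweRy _ _ 2^-1).
split; apply: Lfun2P => //; apply: le_lt_trans fin; apply: ge0_le_integral => //.
- by move=> x _; rewrite lee_fin sqr_ge0.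
- by apply/measurable_EFinP; exact: measurable_funX.
- by apply/measurable_EFinP; apply: measurable_funD; exact: measurable_funX.
- by move=> x _; rewrite lee_fin lerDl sqr_ge0.
- by move=> x _; rewrite lee_fin sqr_ge0.
- by apply/measurable_EFinP; exact: measurable_funX.
- by apply/measurable_EFinP; apply: measurable_funD; exact: measurable_funX.
- by move=> x _; rewrite lee_fin lerDr sqr_ge0.
Qed.

Definition to_cL2 (f : T -> R[i]) : cL2 :=
  if pselect (L2 mu f) is left h then
    (mk_rL2 (L2_Lfun2 h).1, mk_rL2 (L2_Lfun2 h).2) else 0.

Lemma to_cL2K f : L2 mu f -> cfun (to_cL2 f) = f.
Proof.
rewrite /to_cL2 => fL; case: pselect => // h.
by apply/funext => x; rewrite /cfun /=; case: (f x).
Qed.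

Lemma cfunK e : to_cL2 (cfun e) = e.
Proof.
rewrite /to_cL2; case: pselect => [h|[]]; last exact: cfun_L2.
by case: e h => u v h; congr (_, _); apply/LfuneqP.
Qed.

(** Multiplication by i. *)
Definition cL2_rot (e : cL2) : cL2 := (- e.2, e.1).

Definition cL2_scale (a : R[i]) (e : cL2) : cL2 :=
  complex.Re a *: e + complex.Im a *: cL2_rot e.

Lemma cfun_scale a e : cfun (cL2_scale a e) = (fun x => a * cfun e x).
Proof.
apply/funext => x; case: a => a b.
transitivity ((a * e.1 x + b * - e.2 x) +i* (a * e.2 x + b * e.1 x)) => //.
by rewrite /cfun; apply/eqP; rewrite eq_complex /=; apply/andP; split; apply/eqP; ring.
Qed.

Lemma cfunD e f : cfun (e + f) = cfun e \+ cfun f.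
Proof. by []. Qed.

Lemma cfunB e f : cfun (e - f) = cfun e \- cfun f.
Proof. by []. Qed.

Lemma cfunZ (a : R) e : cfun (a *: e) = (fun x => a%:C * cfun e x).
Proof.
apply/funext => x; transitivity ((a * e.1 x) +i* (a * e.2 x)) => //.
by apply/eqP; rewrite eq_complex /= !mul0r subr0 addr0 !eqxx.
Qed.

(** Im <e, f> = Re <e, i f>, because the second argument is conjugated. *)
Definition cL2_cinner (e f : cL2) : R[i] := cL2_inner e f +i* cL2_inner e (cL2_rot f).

Lemma inner_cfun e f : inner mu (cfun e) (cfun f) = cL2_cinner e f.
Proof.
have mulI (u v : rL2 mu) : mu.-integrable setT (EFin \o (fun x => u x * v x)).
  exact: rL2_mul_integrable.
rewrite /inner /cintegral /cL2_cinner /cL2_inner; congr (_ +i* _).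
  rewrite /rL2_inner -RintegralD//; try exact: mulI.
  by apply: eq_Rintegral => x _ /=; ring.
rewrite /rL2_inner -RintegralD//; try exact: mulI.
all: by apply: eq_Rintegral => x _ /=; ring.
Qed.

Section weighted_composition.
Context (w : T -> R[i]) (phi : T -> T).
Context (mw : measurable_fun setT w) (mphi : measurable_fun setT phi).
Context (wphi : forall F : T -> \bar R, measurable_fun setT F -> (forall x, 0 <= F x)%E ->
  (\int[mu]_x ((complex.Re `|w x| ^+ 2)%:E * F (phi x)) = \int[mu]_x F x)%E).

(** The operators of the representation have this form. The hypothesis [wphi] says that |w|^2 is the
    Jacobian of phi, so that they are isometries. *)
Definition wcomp (f : T -> R[i]) : T -> R[i] := fun x => w x * f (phi x).

Lemma measurable_wcomp f : measurable_fun setT f -> measurable_fun setT (wcomp f).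
Proof.
move=> mf; have mfp : measurable_fun setT (f \o phi) by exact: measurableT_comp.
move/measurable_complexP : mfp => [mRe mIm].
move/measurable_complexP : mw => [wRe wIm].
have ReM (a b : R[i]) : complex.Re (a * b) =
    complex.Re a * complex.Re b - complex.Im a * complex.Im b by case: a b => ? ? [].
have ImM (a b : R[i]) : complex.Im (a * b) =
    complex.Re a * complex.Im b + complex.Im a * complex.Re b by case: a b => ? ? [].
apply/measurable_complexP; split.
  rewrite (_ : (fun x => _) = fun x => complex.Re (w x) * complex.Re (f (phi x)) -
    complex.Im (w x) * complex.Im (f (phi x))); last by apply/funext => x; exact: ReM.
  by apply: measurable_funB; exact: measurable_funM.
rewrite (_ : (fun x => _) = fun x => complex.Re (w x) * complex.Im (f (phi x)) +
    complex.Im (w x) * complex.Re (f (phi x))); last by apply/funext => x; exact: ImM.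
by apply: measurable_funD; exact: measurable_funM.
Qed.

Lemma L2norm_wcomp f : measurable_fun setT f -> L2norm mu (wcomp f) = L2norm mu f.
Proof.
move=> /measurable_complexP[mRe mIm]; rewrite !L2normE; congr (_ `^ _)%E.
rewrite -[RHS]wphi; first last.
- by move=> x; rewrite lee_fin addr_ge0 ?sqr_ge0.
- by apply/measurable_EFinP; apply: measurable_funD; exact: measurable_funX.
apply: eq_integral => x _; rewrite -EFinM /wcomp; congr EFin.
rewrite sqr_Re_normc; case: (w x) (f (phi x)) => a b [c e] /=; ring.
Qed.

Lemma L2_wcomp f : L2 mu f -> L2 mu (wcomp f).
Proof.
by move=> [mf foo]; split; [exact: measurable_wcomp|rewrite L2norm_wcomp].
Qed.

Definition cL2_wcomp (e : cL2) : cL2 := to_cL2 (wcomp (cfun e)).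

Lemma cfun_wcomp e : cfun (cL2_wcomp e) = wcomp (cfun e).
Proof. by rewrite to_cL2K//; apply: L2_wcomp; exact: cfun_L2. Qed.

Lemma cfun_inj : injective cfun.
Proof. by move=> e f ef; rewrite -(cfunK e) ef cfunK. Qed.

Lemma cL2_wcompD e f : cL2_wcomp (e + f) = cL2_wcomp e + cL2_wcomp f.
Proof.
apply: cfun_inj; rewrite cfunD !cfun_wcomp cfunD.
by apply/funext => x; rewrite /wcomp /= mulrDr.
Qed.

Lemma cL2_wcompZ a e : cL2_wcomp (a *: e) = a *: cL2_wcomp e.
Proof.
apply: cfun_inj; rewrite cfunZ !cfun_wcomp cfunZ.
by apply/funext => x; rewrite /wcomp /= mulrCA.
Qed.

Lemma cL2_wcomp_scale a e : cL2_wcomp (cL2_scale a e) = cL2_scale a (cL2_wcomp e).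
Proof.
apply: cfun_inj; rewrite cfun_scale !cfun_wcomp cfun_scale.
by apply/funext => x; rewrite /wcomp /= mulrCA.
Qed.

Lemma nrm_wcomp e : nrm (cL2_wcomp e) = nrm e.
Proof.
apply: EFin_inj; rewrite -!L2norm_cfun cfun_wcomp L2norm_wcomp//.
by have [] := cfun_L2 e.
Qed.

Lemma cL2_inner_wcomp e f : cL2_inner (cL2_wcomp e) (cL2_wcomp f) = cL2_inner e f.
Proof.
have cP := cL2_semi_inner.
have polar x y : 2 * cL2_inner x y = nrm (x + y) ^+ 2 - nrm x ^+ 2 - nrm y ^+ 2.
  rewrite !sqr_inorm// !(semi_innerE cP) (semi_innerC cP y x); ring.
have : 2 * cL2_inner (cL2_wcomp e) (cL2_wcomp f) = 2 * cL2_inner e f.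
  by rewrite !polar -cL2_wcompD !nrm_wcomp.
by move/(mulfI _); apply; rewrite pnatr_eq0.
Qed.

End weighted_composition.

Lemma cL2_rotE e : cL2_rot e = cL2_scale 'i e.
Proof. by rewrite /cL2_scale /= scale0r add0r scale1r. Qed.

End complex_L2.

(** * The quasi-regular representation *)

Section expi_dot.
Context (R : realType).

Lemma expiD (s t : R) : expi (s + t) = expi s * expi t.
Proof.
rewrite /expi mulrDr cosD sinD; apply/eqP; rewrite eq_complex /=.
by rewrite eqxx /= addrC mulrC (mulrC (sin _)).
Qed.

Lemma expi0 : expi (0 : R) = 1.
Proof. by rewrite /expi mulr0 cos0 sin0. Qed.

Lemma expiN (t : R) : expi (- t) * expi t = 1.
Proof. by rewrite -expiD addNr expi0. Qed.

Lemma Re_normc_expi (t : R) : `|expi t| = 1.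
Proof. by rewrite /expi normc_def /= cos2Dsin2 sqrtr1. Qed.

Lemma dotcVE n (x y : 'cV[R]_n) : dotcV x y = (x^T *m y) 0 0.
Proof. by rewrite mxE; apply: eq_bigr => i _; rewrite mxE. Qed.

Lemma dotcVC n (x y : 'cV[R]_n) : dotcV x y = dotcV y x.
Proof. by apply: eq_bigr => i _; rewrite mulrC. Qed.

Lemma dotcVDl n (x y z : 'cV[R]_n) : dotcV (x + y) z = dotcV x z + dotcV y z.
Proof. by rewrite !dotcVE linearD /= mulmxDl mxE. Qed.

Lemma dotcVDr n (x y z : 'cV[R]_n) : dotcV x (y + z) = dotcV x y + dotcV x z.
Proof. by rewrite !dotcVE mulmxDr mxE. Qed.

Lemma dotcVNl n (x y : 'cV[R]_n) : dotcV (- x) y = - dotcV x y.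
Proof. by rewrite !dotcVE linearN /= mulNmx mxE. Qed.

Lemma dotcVNr n (x y : 'cV[R]_n) : dotcV x (- y) = - dotcV x y.
Proof. by rewrite !dotcVE mulmxN mxE. Qed.

Lemma dotcV0r n (x : 'cV[R]_n) : dotcV x 0 = 0.
Proof. by rewrite dotcVE mulmx0 mxE. Qed.

Lemma dotcV0l n (x : 'cV[R]_n) : dotcV 0 x = 0.
Proof. by rewrite dotcVC dotcV0r. Qed.

Lemma dotcV_tr n (h : 'M[R]_n) (x y : 'cV[R]_n) : dotcV (h^T *m x) y = dotcV x (h *m y).
Proof. by rewrite !dotcVE trmx_mul trmxK mulmxA. Qed.

End expi_dot.

Section aWH_group_structure.
Context (R : realType) (n : nat).
Implicit Types (g : aWH R n) (f : 'cV[R]_n -> R[i]).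
Local Notation A := (@aWH_group R n).

Definition aWH_one : aWH R n := (1, 0, 0, 1%:M).

(** The exponential compensates the factor e^(-2 pi i <xi, x>) that arises in the product of g with
    its inverse. *)
Definition aWH_inv g : aWH R n :=
  let: (z, x, xi, h) := g in
  (z^* * expi (dotcV xi x), - (invmx h *m x), - (h^T *m xi), invmx h).

Lemma aWH_group_one : A aWH_one.
Proof. by split; [rewrite normr1|exact: unitmx1]. Qed.

Lemma aWH_group_mul g1 g2 : A g1 -> A g2 -> A (aWH_mul g1 g2).
Proof.
move: g1 g2 => [[[z1 x1] xi1] h1] [[[z2 x2] xi2] h2] [z11 h1U] [z21 h2U].
split; last by rewrite unitmx_mul h1U.
by rewrite !normrM z11 z21 !mul1r Re_normc_expi.
Qed.

Lemma conjc_mul1 (z : R[i]) : `|z| = 1 -> z^* * z = 1.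
Proof.
case: z => a b; rewrite normc_def => -[] /= ab1.
have {}ab1 : a * a + b * b = 1.
  by rewrite -!expr2 -[LHS]sqr_sqrtr ?addr_ge0 ?sqr_ge0// ab1 expr1n.
by apply/eqP; rewrite eq_complex /=; apply/andP; split; apply/eqP; lra.
Qed.

Lemma normc_conj1 (z : R[i]) : `|z| = 1 -> `|z^*| = 1.
Proof.
move=> z1; have := congr1 Num.norm (conjc_mul1 z1).
by rewrite normrM z1 mulr1 normr1.
Qed.

Lemma aWH_group_inv g : A g -> A (aWH_inv g).
Proof.
move: g => [[[z x] xi] h] [z1 hU]; split; last by rewrite unitmx_inv.
by rewrite normrM normc_conj1// mul1r Re_normc_expi.
Qed.

Lemma aWH_mul1g g : aWH_mul aWH_one g = g.
Proof.
move: g => [[[z x] xi] h]; rewrite /aWH_mul /aWH_one.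
by rewrite dotcV0l expi0 mulr1 !mul1mx invmx1 trmx1 mul1mx !mul1r !add0r.
Qed.

Lemma aWH_mulg1 g : aWH_mul g aWH_one = g.
Proof.
move: g => [[[z x] xi] h]; rewrite /aWH_mul /aWH_one.
by rewrite !mulmx0 dotcV0r expi0 !mulr1 !addr0 mulmx1.
Qed.

Lemma aWH_mulVg g : A g -> aWH_mul (aWH_inv g) g = aWH_one.
Proof.
move: g => [[[z x] xi] h] [/conjc_mul1 z0 hU]; rewrite /aWH_mul /aWH_one /aWH_inv.
rewrite invmxK !addNr mulVmx//; congr (_, _, _, _).
rewrite dotcVNl dotcV_tr mulmxA mulmxV// mul1mx [_ * z]mulrAC z0 mul1r.
by rewrite mulrC expiN.
Qed.

Lemma aWH_mulgV g : A g -> aWH_mul g (aWH_inv g) = aWH_one.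
Proof.
move: g => [[[z x] xi] h] [/conjc_mul1 z0 hU]; rewrite /aWH_mul /aWH_one /aWH_inv.
rewrite !mulmxN !mulmxA mulmxV// mul1mx subrr -trmx_mul mulmxV// trmx1 mul1mx subrr.
congr (_, _, _, _).
by rewrite dotcVNr mulrA [z * _]mulrC z0 mul1r mulrC expiN.
Qed.

Lemma invmx_mul (a b : 'M[R]_n) : a \in unitmx -> b \in unitmx ->
  invmx (a *m b) = invmx b *m invmx a.
Proof.
move=> aU bU; have abU : a *m b \in unitmx by rewrite unitmx_mul aU.
by rewrite -[RHS](mulKmx abU) -!mulmxA (mulmxA b) mulmxV// mul1mx mulmxV// mulmx1.
Qed.

Lemma aWH_mulA g1 g2 g3 : A g1 -> A g2 -> A g3 ->
  aWH_mul g1 (aWH_mul g2 g3) = aWH_mul (aWH_mul g1 g2) g3.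
Proof.
move: g1 g2 g3 => [[[z1 x1] xi1] h1] [[[z2 x2] xi2] h2] [[[z3 x3] xi3] h3].
move=> [_ h1U] [_ h2U] _; rewrite /aWH_mul invmx_mul// trmx_mul.
rewrite !mulmxDr !mulmxA !addrA; congr (_, _, _, _).
rewrite !dotcVDr !dotcVDl !expiD dotcV_tr !mulmxA mulVmx// mul1mx; ring.
Qed.

Lemma quasi_regular_mul g1 g2 f : A g1 -> A g2 ->
  quasi_regular (aWH_mul g1 g2) f = quasi_regular g1 (quasi_regular g2 f).
Proof.
move: g1 g2 => [[[z1 x1] xi1] h1] [[[z2 x2] xi2] h2] [_ h1U] [_ h2U].
apply/funext => y; rewrite /quasi_regular /aWH_mul /translation /modulation /dilation.
rewrite invmx_mul// det_mulmx normrM sqrtrM ?normr_ge0// invfM rmorphM/=.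
have -> : invmx h2 *m invmx h1 *m (y - (x1 + h1 *m x2)) =
    invmx h2 *m (invmx h1 *m (y - x1) - x2).
  by rewrite opprD addrA mulmxBr -!mulmxA mulKmx// -mulmxBr.
have -> : dotcV (y - (x1 + h1 *m x2)) (xi1 + (invmx h1)^T *m xi2) =
    dotcV (y - x1) xi1 - dotcV xi1 (h1 *m x2) + dotcV (invmx h1 *m (y - x1) - x2) xi2.
  rewrite opprD addrA dotcVDr (dotcVDl (y - x1) (- (h1 *m x2)) xi1) dotcVNl.
  rewrite [dotcV (h1 *m x2) xi1]dotcVC; congr (_ + _).
  by rewrite dotcVC dotcV_tr dotcVC mulmxBr mulKmx.
rewrite !expiD.
(* Moving the second translation past the first modulation produces the phase e', which cancels the
   phase e of the group law. *)
have e1 := expiN (dotcV xi1 (h1 *m x2)).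
set e := expi (dotcV xi1 (h1 *m x2)) in e1 *; set e' := expi (- _) in e1 *.
rewrite -[RHS]mul1r -e1; ring.
Qed.

Lemma quasi_regular_one f : quasi_regular aWH_one f = f.
Proof.
apply/funext => y; rewrite /quasi_regular /aWH_one /translation /modulation /dilation.
by rewrite dotcV0r expi0 det1 normr1 sqrtr1 invr1 invmx1 mul1mx !mul1r subr0.
Qed.

End aWH_group_structure.

Lemma measurable_funM_complex (R : realType) d (T : measurableType d) (f g : T -> R[i]) :
  measurable_fun setT f -> measurable_fun setT g -> measurable_fun setT (fun x => f x * g x).
Proof.
move=> /measurable_complexP[fRe fIm] /measurable_complexP[gRe gIm].
have ReM (a b : R[i]) : complex.Re (a * b) =
    complex.Re a * complex.Re b - complex.Im a * complex.Im b by case: a b => ? ? [].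
have ImM (a b : R[i]) : complex.Im (a * b) =
    complex.Re a * complex.Im b + complex.Im a * complex.Re b by case: a b => ? ? [].
apply/measurable_complexP; split.
  by under eq_fun do rewrite ReM; apply: measurable_funB; exact: measurable_funM.
by under eq_fun do rewrite ImM; apply: measurable_funD; exact: measurable_funM.
Qed.

Lemma measurable_expi (R : realType) d (T : measurableType d) (f : T -> R) :
  measurable_fun setT f -> measurable_fun setT (fun x => expi (f x)).
Proof.
move=> mf; have m2f : measurable_fun setT (fun x => 2 * pi * f x) by exact: measurable_funM.
by apply/measurable_complexP; split; rewrite /expi /=;
  [apply: (measurableT_comp _ m2f); apply: continuous_measurable_fun; exact: continuous_cos
  |apply: (measurableT_comp _ m2f); apply: continuous_measurable_fun; exact: continuous_sin].
Qed.

Lemma measurable_dotcV (R : realType) n d (T : measurableType d) (f g : T -> 'cV[R]_n) :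
  measurable_fun setT f -> measurable_fun setT g -> measurable_fun setT (fun x => dotcV (f x) (g x)).
Proof.
move=> mf mg.
apply: (@measurable_sum _ _ _ setT _ _ (fun i x => f x i ord0 * g x i ord0)) => i.
by apply: measurable_funM; exact: measurable_mx_entry.
Qed.

Section representation.
Context (R : realType) (n : nat).
Implicit Types (g : aWH R n) (f : 'cV[R]_n -> R[i]).
Local Notation A := (@aWH_group R n).
Local Notation leb := (lebesgue_cV R n).
Local Notation cL2 := (cL2 leb).
Local Notation ip := (@cL2_inner _ _ R leb).

Definition rep_weight g : 'cV[R]_n -> R[i] :=
  let: (z, x, xi, h) := g in
  fun y => z * (expi (dotcV (y - x) xi) * (Num.sqrt `|\det h|)^-1%:C).

Definition rep_map g : 'cV[R]_n -> 'cV[R]_n :=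
  let: (z, x, xi, h) := g in fun y => invmx h *m (y - x).

Lemma quasi_regularE g f : quasi_regular g f = wcomp (rep_weight g) (rep_map g) f.
Proof. by move: g => [[[z x] xi] h]; apply/funext => y; rewrite /wcomp /= -!mulrA. Qed.

Lemma measurable_rep_map g : measurable_fun setT (rep_map g).
Proof.
move: g => [[[z x] xi] h]; apply: measurable_mulmx; first exact: measurable_cst.
by apply: measurable_addmx => //; exact: measurable_cst.
Qed.

Lemma measurable_rep_weight g : measurable_fun setT (rep_weight g).
Proof.
move: g => [[[z x] xi] h]; apply: measurable_funM_complex; first exact: measurable_cst.
apply: measurable_funM_complex; last exact: measurable_cst.
apply: measurable_expi; apply: measurable_dotcV; last exact: measurable_cst.
by apply: measurable_addmx => //; exact: measurable_cst.
Qed.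

(** The squared weight |det h|^-1 is the volume factor of y -> h^-1 (y - x). *)
Lemma rep_wphi g : A g -> forall F : 'cV[R]_n -> \bar R, measurable_fun setT F ->
  (forall x, 0 <= F x)%E ->
  (\int[leb]_x ((complex.Re `|rep_weight g x| ^+ 2)%:E * F (rep_map g x)) = \int[leb]_x F x)%E.
Proof.
move: g => [[[z x] xi] h] [z1 hU] F mF F0.
have detV : `|\det (invmx h)| = `|\det h|^-1 by rewrite det_inv normfV.
have [_ c0 /(_ _ mF F0) <-] := rescales_comp
  (rescales_mulmx (etrans (unitmx_inv h) hU)) (rescales_translation (- x)).
rewrite mulr1 detV -ge0_integralZl//; last first.
  exact: (measurableT_comp mF (measurable_rep_map (z, x, xi, h))).
apply: eq_integral => y _; congr (_%:E * _)%E.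
rewrite /rep_weight !normrM z1 Re_normc_expi !mul1r normc_def /= expr0n addr0 sqrtr_sqr.
by rewrite real_normK ?num_real// exprVn sqr_sqrtr.
Qed.

Definition rep g : cL2 -> cL2 := cL2_wcomp (rep_weight g) (rep_map g).

Section rep_theory.
Context g (Ag : A g).
Let mw := measurable_rep_weight g.
Let mp := measurable_rep_map g.
Let wp := rep_wphi Ag.

Lemma cfun_rep e : cfun (rep g e) = quasi_regular g (cfun e).
Proof. by rewrite quasi_regularE; exact: cfun_wcomp. Qed.

Lemma repD e e' : rep g (e + e') = rep g e + rep g e'.
Proof. exact: cL2_wcompD. Qed.

Lemma repZ (a : R) e : rep g (a *: e) = a *: rep g e.
Proof. exact: cL2_wcompZ. Qed.

Lemma rep_scale a e : rep g (cL2_scale a e) = cL2_scale a (rep g e).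
Proof. exact: cL2_wcomp_scale. Qed.

Lemma rep_inner e e' : ip (rep g e) (rep g e') = ip e e'.
Proof. exact: cL2_inner_wcomp. Qed.

Lemma rep_norm e : inorm ip (rep g e) = inorm ip e.
Proof. exact: nrm_wcomp. Qed.

Lemma rep_rot e : rep g (cL2_rot e) = cL2_rot (rep g e).
Proof. by rewrite !cL2_rotE rep_scale. Qed.

End rep_theory.

Lemma rep_mul g1 g2 e : A g1 -> A g2 -> rep (aWH_mul g1 g2) e = rep g1 (rep g2 e).
Proof.
move=> Ag1 Ag2; apply: cfun_inj.
by rewrite !cfun_rep ?quasi_regular_mul//; exact: aWH_group_mul.
Qed.

Lemma rep_one e : rep (aWH_one R n) e = e.
Proof. by apply: cfun_inj; rewrite cfun_rep ?quasi_regular_one//; exact: aWH_group_one. Qed.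

Lemma rep_adj g e e' : A g -> ip (rep g e) e' = ip e (rep (aWH_inv g) e').
Proof.
move=> Ag; have AV := aWH_group_inv Ag.
by rewrite -(rep_inner AV) -(rep_mul e AV Ag) aWH_mulVg// rep_one.
Qed.

End representation.

(** * Topology of matrices *)

Section matrix_topology.
Context (R : realType).

Lemma continuous_mulf (T : topologicalType) (f g : T -> R) :
  continuous f -> continuous g -> continuous (fun x => f x * g x).
Proof. by move=> cf cg x; apply: cvgM; [exact: cf|exact: cg]. Qed.

Lemma continuous_matrix (T : topologicalType) m n (f : T -> 'M[R]_(m, n)) :
  (forall i j, continuous (fun x => f x i j)) -> continuous f.
Proof.
move=> cf x B [P Px PB].
have : \forall y \near x, forall ij : 'I_m * 'I_n, P ij.1 ij.2 (f y ij.1 ij.2).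
  by apply: filter_forall => -[i j]; exact: (cf i j x _ (Px i j)).
by apply: filterS => y Py; apply: PB => i j; exact: (Py (i, j)).
Qed.

(** Tychonoff's theorem for row vectors, transported by [vec_mx]. *)
Lemma compact_matrix_box m n (A : 'I_m -> 'I_n -> set R) :
  (forall i j, compact (A i j)) -> compact [set M : 'M[R]_(m, n) | forall i j, A i j (M i j)].
Proof.
move=> cA; have := @rV_compact R (m * n)
  (fun k => A (enum_val (cast_ord (esym (mxvec_cast m n)) k)).1
              (enum_val (cast_ord (esym (mxvec_cast m n)) k)).2) (fun k => cA _ _).
set B := [set v | _] => cB.
have cv : continuous (@vec_mx R m n).
  apply: continuous_matrix => i j.
  rewrite (_ : (fun x => _) = fun v : 'rV[R]_(m * n) => v ord0 (mxvec_index i j)).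
    exact: coord_continuous.
  by apply/funext => v; rewrite mxE.
have := continuous_compact (continuous_subspaceT (A := B) cv) cB.
congr compact; apply/seteqP; split=> [_ [v Bv <-] i j|M AM].
  rewrite mxE; have := Bv (mxvec_index i j).
  by rewrite /mxvec_index cast_ordK enum_rankK.
exists (mxvec M); last by rewrite mxvecK.
move=> k; case/mxvec_indexP: k => i j.
by rewrite /= mxvecE /mxvec_index cast_ordK enum_rankK; exact: AM.
Qed.

Definition rat_box m n (q : 'M[(rat * rat)%type]_(m, n)) : set 'M[R]_(m, n) :=
  [set M | forall i j, ratr (q i j).1 < M i j < ratr (q i j).2].

Lemma open_bigcup_rat_box m n (U : set 'M[R]_(m, n)) : open U ->
  U = \bigcup_(q in [set q | rat_box q `<=` U]) rat_box q.
Proof.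
move=> oU; apply/seteqP; split=> [M UM|M [q qU /qU//]].
have : nbhs M U by exact: open_nbhs_nbhs.
move=> [P PM PU].
have ex (ij : 'I_m * 'I_n) : exists q : rat * rat,
    ratr q.1 < M ij.1 ij.2 < ratr q.2 /\
    forall x : R, ratr q.1 < x < ratr q.2 -> P ij.1 ij.2 x.
  have /nbhs_ballP[e /= e0 eP] := PM ij.1 ij.2.
  set x := M ij.1 ij.2 in eP *.
  have [q1] : exists q, ratr q \in `]x - e, x[ by apply: rat_in_itvoo; rewrite ltrBlDr ltrDl.
  have [q2] : exists q, ratr q \in `]x, x + e[ by apply: rat_in_itvoo; rewrite ltrDl.
  rewrite !in_itv /= => /andP[xq2 q2e] /andP[q1e q1x].
  exists (q1, q2); split=> /=; first by rewrite q1x.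
  move=> y /andP[q1y yq2]; apply: eP; rewrite /ball /= ltr_norml.
  by apply/andP; split; lra.
have [q qP] := choice ex.
exists (\matrix_(i, j) q (i, j)) => [N Nbox|i j]; last first.
  by rewrite !mxE; have [] := qP (i, j).
apply: PU => i j; have [_] := qP (i, j); apply.
by have := Nbox i j; rewrite !mxE.
Qed.

Lemma measurable_rat_box m n (q : 'M[(rat * rat)%type]_(m, n)) : measurable (rat_box q).
Proof.
rewrite (_ : rat_box q = \bigcap_(ij in [set: 'I_m * 'I_n])
  [set M : 'M[R]_(m, n) | ratr (q ij.1 ij.2).1 < M ij.1 ij.2 < ratr (q ij.1 ij.2).2]); last first.
  by apply/seteqP; split=> M h; [move=> ij _; exact: h|move=> i j; exact: (h (i, j) I)].
apply: fin_bigcap_measurable => // -[i j] _ /=.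
rewrite -[X in measurable X]setTI.
exact: (measurable_mx_coord _ _ measurableT (measurable_itv `](ratr (q i j).1), (ratr (q i j).2)[)).
Qed.

(** There are countably many rational boxes, so every union of them is a countable one. S is
    arbitrary because the lemma serves both the given sigma-algebra and the one generated by the
    boxes. *)
Lemma bigcup_rat_box_in m n
    (S : set (set 'M[R]_(m, n))) (Q : set 'M[(rat * rat)%type]_(m, n)) :
  sigma_algebra setT S -> (forall q, S (rat_box q)) -> S (\bigcup_(q in Q) rat_box q).
Proof.
move=> [S0 SC SU] Sbox.
rewrite bigcup_mkcond.
rewrite (_ : \bigcup_i _ = \bigcup_(k : nat)
  if unpickle k is Some q then (if q \in Q then rat_box q else set0) else set0).
  apply: SU => k; case: (unpickle k) => // q; by case: ifP.
apply/seteqP; split=> [M [q _ Mq]|M [k _]].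
  by exists (pickle q) => //; rewrite pickleK.
by case: (unpickle k) => // q Mq; exists q.
Qed.

Lemma measurable_open_matrix m n (U : set 'M[R]_(m, n)) : open U -> measurable U.
Proof.
move=> /open_bigcup_rat_box ->; apply: bigcup_rat_box_in; last exact: measurable_rat_box.
exact: sigma_algebra_measurable.
Qed.

(** With [rat_box_setI], this provides a generating class stable under intersection, for Dynkin's
    theorem. *)
Lemma measurable_rat_boxE m n :
  @measurable _ 'M[R]_(m, n) = <<s [set B | exists q, B = rat_box q] >>.
Proof.
set G := [set B | _]; apply/seteqP; split; last first.
  apply: smallest_sub; first exact: sigma_algebra_measurable.
  by move=> _ [q ->]; exact: measurable_rat_box.
have sG : sigma_algebra setT <<s G >> by exact: smallest_sigma_algebra.
apply: smallest_sub => // _ [i [j [A [mA ->]]]].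
have mc : @measurable_fun _ _ (g_sigma_algebraType G) R setT (fun M : 'M[R]_(m, n) => M i j).
  apply: (measurability _ (RGenOInfty.measurableE R)).
  move=> _ [_ [x ->] <-]; rewrite setTI.
  have oU : open ((fun M : 'M[R]_(m, n) => M i j) @^-1` `]x, +oo[%classic).
    apply: open_comp => [M _|]; first exact: coord_continuous.
    exact: rray_open.
  rewrite [X in measurable X](open_bigcup_rat_box oU).
  by apply: bigcup_rat_box_in => // q; apply: sub_sigma_algebra; exists q.
by have := mc measurableT A mA; rewrite setTI.
Qed.

Lemma rat_box_setI m n (p q : 'M[(rat * rat)%type]_(m, n)) : rat_box p `&` rat_box q =
  rat_box (\matrix_(i, j) (Num.max (p i j).1 (q i j).1, Num.min (p i j).2 (q i j).2)).
Proof.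
have ratr_max (x y : rat) : ratr (Num.max x y) = Num.max (ratr x) (ratr y) :> R.
  by have [xy|yx] := leP x y; [rewrite max_r// ler_rat|rewrite max_l// ler_rat ltW].
have ratr_min (x y : rat) : ratr (Num.min x y) = Num.min (ratr x) (ratr y) :> R.
  by have [xy|yx] := leP x y; [rewrite min_l// ler_rat|rewrite min_r// ler_rat ltW].
apply/seteqP; split=> M.
  move=> [Mp Mq] i j; rewrite mxE /= ratr_max ratr_min gt_max lt_min.
  by move: (Mp i j) (Mq i j) => /andP[p1 p2] /andP[q1 q2]; rewrite p1 p2 q1 q2.
by move=> h; split=> i j; have := h i j; rewrite mxE /= ratr_max ratr_min gt_max lt_min;
  move=> /andP[/andP[a b] /andP[c e]]; rewrite ?a ?b ?c ?e.
Qed.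

Lemma measurable_closed_matrix m n (A : set 'M[R]_(m, n)) : closed A -> measurable A.
Proof.
move=> cA; rewrite -[A]setCK; apply: measurableC.
by apply: measurable_open_matrix; exact: closed_openC.
Qed.

Lemma continuous_mulmx m n p (M : 'M[R]_(m, n)) : continuous (mulmx M : 'M[R]_(n, p) -> _).
Proof.
apply: continuous_matrix => i j.
rewrite (_ : (fun x => _) = fun N : 'M[R]_(n, p) => \sum_k M i k * N k j); last first.
  by apply/funext => N; rewrite mxE.
apply: continuous_big; first exact: add_continuous.
move=> k _; apply: continuous_mulf; last exact: coord_continuous.
exact: cst_continuous.
Qed.

Lemma continuous_det n : continuous (@determinant R n : 'M[R]_n -> R).
Proof.
apply: continuous_big; first exact: add_continuous.
move=> s _; apply: continuous_mulf; first exact: cst_continuous.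
by apply: (continuous_big (@mul_continuous R)) => i _; exact: coord_continuous.
Qed.

Lemma continuous_complex_pair : continuous (fun p : R * R => p.1 +i* p.2 : R[i]).
Proof.
move=> [x y]; apply/(@cvgrPdist_lt R[i] R[i]^o) => e.
case: e => r s; rewrite ltcE /= => /andP[/eqP s0 r0]; rewrite {}s0.
have r20 : 0 < r / 2 by rewrite divr_gt0.
exists (ball x (r / 2), ball y (r / 2)).
  by split; exact: nbhsx_ballx.
move=> [x' y'] /= [dx dy]; rewrite /ball /= in dx dy.
rewrite normc_def ltcE /= eqxx /=.
rewrite -(@ltr_sqr _ (Num.sqrt _)) ?nnegrE ?sqrtr_ge0 ?(ltW r0)//.
rewrite sqr_sqrtr ?addr_ge0 ?sqr_ge0//.
rewrite -(real_normK (num_real (x - x'))) -(real_normK (num_real (y - y'))).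
have := normr_ge0 (x - x'); have := normr_ge0 (y - y').
move: dx dy; move: `|x - x'| `|y - y'| => a b; nra.
Qed.

Lemma compact_circle : compact [set z : R[i] | `|z| = 1].
Proof.
have cI : compact (`[(-1 : R), 1]%classic `*` `[(-1 : R), 1]%classic).
  by apply: compact_setX; exact: segment_compact.
pose q (p : R * R) : R := p.1 * p.1 + p.2 * p.2.
have cq : continuous q.
  have c1 : continuous (fun p : R * R => p.1) by move=> p; exact: cvg_fst.
  have c2 : continuous (fun p : R * R => p.2) by move=> p; exact: cvg_snd.
  move=> p; apply: cvgD; exact: continuous_mulf.
have cl : closed (q @^-1` [set 1]).
  by have /continuous_closedP := cq; apply; exact: closed_eq.
have := continuous_compact (continuous_subspaceT continuous_complex_pair)
  (compact_closedI cI cl).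
congr compact; apply/seteqP; split=> [_ [[x y] [_ /= q1] <-] /=|[x y] /= z1].
  rewrite normc_def /= (_ : _ + _ = 1) ?sqrtr1//.
have q1 : x * x + y * y = 1.
  move: z1; rewrite normc_def => -[] /= z1.
  by rewrite -!expr2 -[LHS]sqr_sqrtr ?addr_ge0 ?sqr_ge0// z1 expr1n.
exists (x, y) => //; split=> //; split; rewrite /= in_itv /=; apply/andP; split; nra.
Qed.

End matrix_topology.

(** * Translation complete groups *)

(** The columns of B are a basis of V and C consists of the coordinate forms of that basis, so B C
    is a projection onto V. Membership in V becomes a linear equation, hence a measurable
    condition. *)
Lemma vspace_matrix (R : realType) n (V : {vspace 'cV[R]_n}) : V <> fullv ->
  exists k (B : 'M[R]_(n, k)) (C : 'M[R]_(k, n)),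
    [/\ (k < n)%N, C *m B = 1%:M & forall v, v \in V <-> B *m (C *m v) = v].
Proof.
move=> Vfull; pose k := \dim V; pose b := vbasis V.
pose B : 'M[R]_(n, k) := \matrix_(i, j) b`_j i 0.
pose C : 'M[R]_(k, n) := \matrix_(j, i) coord b j (delta_mx i 0).
have CE v j : (C *m v) j 0 = coord b j v.
  rewrite mxE [in RHS](matrix_sum_delta v) linear_sum; apply: eq_bigr => i _.
  by rewrite big_ord1 linearZ /= mxE mulrC (ord1 ord0).
have BE (c : 'cV[R]_k) : B *m c = \sum_j c j 0 *: b`_j.
  apply/matrixP => i l; rewrite !mxE ord1 summxE; apply: eq_bigr => j _.
  by rewrite !mxE mulrC.
exists k, B, C; split.
- rewrite /k ltn_neqAle; apply/andP; split.
    apply/eqP => kn; apply: Vfull; apply/eqP; rewrite eqEdim subvf /= dimvf /=.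
    by rewrite kn /dim /= muln1.
  by have := dimvS (subvf V); rewrite dimvf /dim /= muln1.
- apply/matrixP => i j; rewrite !mxE.
  transitivity (coord b i b`_j); last first.
    by rewrite coord_free ?mxE ?(basis_free (vbasisP V))// eq_sym.
  rewrite -CE mxE; apply: eq_bigr => l _; by rewrite !mxE.
- move=> v; rewrite BE; split=> [vV|<-].
    by rewrite [RHS](coord_vbasis vV); apply: eq_bigr => j _; rewrite CE.
  apply: memv_suml => j _; apply: memvZ; apply: vbasis_mem; exact: memt_nth.
Qed.

Section tc_group_theory.
Context (R : realType) (n k : nat) (V : {vspace 'cV[R]_n}) (H : set 'M[R]_n).
Context (tcVH : translation_complete V H).
Context (B : 'M[R]_(n, k)) (C : 'M[R]_(k, n)).
Context (CB : C *m B = 1%:M) (VB : forall v, v \in V <-> B *m (C *m v) = v).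

Local Notation G := (tc_group V H).

Let HG : closed_GL_subgroup H. Proof. by have [] := tcVH. Qed.

Lemma tc_group_aWH g : G g -> aWH_group g.
Proof. by move: g => [[[z x] xi] h] []. Qed.

Lemma tc_group_mul g1 g2 : G g1 -> G g2 -> G (aWH_mul g1 g2).
Proof.
move: g1 g2 => [[[z1 x1] xi1] h1] [[[z2 x2] xi2] h2] [A1 V1 H1] [A2 V2 H2].
split; first exact: (aWH_group_mul A1 A2).
  by apply: memvD => //; have [_] := tcVH; apply => //; exact: (GL_subgroupV HG).
exact: (GL_subgroupM HG).
Qed.

Lemma tc_group_inv g : G g -> G (aWH_inv g).
Proof.
move: g => [[[z x] xi] h] [A1 V1 H1]; split; first exact: (aWH_group_inv A1).
  by rewrite memvN; have [_] := tcVH; apply.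
exact: (GL_subgroupV HG).
Qed.

Lemma measurable_GL_subgroup : measurable H.
Proof.
have -> : H = closure H `&` [set h | h \in unitmx].
  apply/seteqP; split=> h; last exact: (GL_subgroup_closed HG).
  by move=> Hh; split; [exact: subset_closure|exact: (GL_subgroup_unit HG)].
apply: measurableI.
  by apply: measurable_closed_matrix; exact: closed_closure.
rewrite (_ : [set h | _] = @determinant R n @^-1` [set~ 0]).
  rewrite -[X in measurable X]setTI.
  exact: (measurable_det (@measurable_id _ _ setT) measurableT (measurableC (measurable_set1 0))).
by apply/seteqP; split=> h /=; rewrite unitmxE unitfE => /eqP.
Qed.

Let mz : measurable_fun setT (fun g : aWH R n => g.1.1.1).
Proof. by do 2!apply: (measurableT_comp measurable_fst) => //. Qed.

Let mx : measurable_fun setT (fun g : aWH R n => g.1.1.2).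
Proof.
by apply: (measurableT_comp measurable_snd) => //; exact: (measurableT_comp measurable_fst).
Qed.

Let mxi : measurable_fun setT (fun g : aWH R n => g.1.2).
Proof. exact: (measurableT_comp measurable_snd). Qed.

Let mh : measurable_fun setT (fun g : aWH R n => g.2).
Proof. exact: measurable_snd. Qed.

Lemma measurable_mx0 m p : measurable [set (0 : 'M[R]_(m, p))].
Proof.
rewrite (_ : [set 0] = \bigcap_(ij in [set: 'I_m * 'I_p])
    [set M : 'M[R]_(m, p) | M ij.1 ij.2 = 0]); last first.
  apply/seteqP; split=> [_ -> ij _|M M0] /=; first by rewrite mxE.
  by apply/matrixP => i j; rewrite mxE (M0 (i, j)).
apply: fin_bigcap_measurable => // -[i j] _ /=; rewrite -[X in measurable X]setTI.
exact: (measurable_mx_coord _ _ measurableT (measurable_set1 0)).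
Qed.

Lemma measurable_tc_group : measurable G.
Proof.
rewrite (_ : G = [set g : aWH R n | complex.Re g.1.1.1 ^+ 2 + complex.Im g.1.1.1 ^+ 2 = 1] `&`
    ((fun g => B *m (C *m g.1.2) - g.1.2) @^-1` [set 0] `&` (fun g => g.2) @^-1` H)).
  have /measurable_complexP[mRe mIm] := mz.
  apply: measurableI; last apply: measurableI.
  - rewrite -[X in measurable X]setTI.
    apply: (measurable_funD (measurable_funX 2 mRe) (measurable_funX 2 mIm) _ (measurable_set1 1)).
    exact: measurableT.
  - rewrite -[X in measurable X]setTI; apply: (_ : measurable_fun setT _) => //.
      apply: measurable_addmx; last exact: measurable_oppmx.
      apply: measurable_mulmx; first exact: measurable_cst.
      by apply: measurable_mulmx => //; exact: measurable_cst.
    exact: measurable_mx0.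
  - by rewrite -[X in measurable X]setTI; apply: mh => //; exact: measurable_GL_subgroup.
apply/seteqP; split=> [[[[z x] xi] h] [[z1 hU] /VB xiV Hh]|[[[z x] xi] h] [/= z1 [/eqP]]] /=.
  by split; [rewrite -sqr_Re_normc z1 expr1n|split=> //; rewrite /preimage /= xiV subrr].
rewrite subr_eq0 => /eqP/VB xiV Hh; split=> //; split; last exact: (GL_subgroup_unit HG).
by case: z z1 => a b /= ab1; rewrite normc_def /= ab1 sqrtr1.
Qed.

Lemma measurable_aWH_mul :
  measurable_fun setT (fun p : aWH R n * aWH R n => aWH_mul p.1 p.2).
Proof.
have m1 : measurable_fun setT (fst : aWH R n * aWH R n -> _) by exact: measurable_fst.
have m2 : measurable_fun setT (snd : aWH R n * aWH R n -> _) by exact: measurable_snd.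
have z1 := measurableT_comp mz m1; have z2 := measurableT_comp mz m2.
have x1 := measurableT_comp mx m1; have x2 := measurableT_comp mx m2.
have xi1 := measurableT_comp mxi m1; have xi2 := measurableT_comp mxi m2.
have h1 := measurableT_comp mh m1; have h2 := measurableT_comp mh m2.
have hx := measurable_mulmx h1 x2.
have mz' := measurable_funM_complex (measurable_funM_complex z1 z2)
  (measurable_expi (measurable_dotcV xi1 hx)).
have mx' := measurable_addmx x1 hx.
have mxi' := measurable_addmx xi1 (measurable_mulmx (measurable_trmx (measurable_invmx h1)) xi2).
have mh' := measurable_mulmx h1 h2.
have := measurable_fun_pair (measurable_fun_pair (measurable_fun_pair mz' mx') mxi') mh'.
by congr measurable_fun; apply/funext => -[[[[? ?] ?] ?] [[[? ?] ?] ?]].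
Qed.

Lemma measurable_aWH_inv : measurable_fun setT (@aWH_inv R n).
Proof.
have mzc : measurable_fun setT (fun g : aWH R n => (g.1.1.1)^*).
  have /measurable_complexP[mRe mIm] := mz; apply/measurable_complexP.
  rewrite (_ : (fun x => complex.Re _) = fun g : aWH R n => complex.Re g.1.1.1); last first.
    by apply/funext => g; case: (g.1.1.1).
  rewrite (_ : (fun x => complex.Im _) = fun g : aWH R n => - complex.Im g.1.1.1); last first.
    by apply/funext => g; case: (g.1.1.1).
  by split=> //; exact: measurableT_comp.
have mhV := measurable_invmx mh.
have mz' := measurable_funM_complex mzc (measurable_expi (measurable_dotcV mxi mx)).
have mx' := measurable_oppmx (measurable_mulmx mhV mx).
have mxi' := measurable_oppmx (measurable_mulmx (measurable_trmx mh) mxi).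
have := measurable_fun_pair (measurable_fun_pair (measurable_fun_pair mz' mx') mxi') mhV.
by congr measurable_fun; apply/funext => -[[[? ?] ?] ?].
Qed.

Lemma tc_measurable_group : measurable_group (@aWH_mul R n) (@aWH_inv R n) G.
Proof.
split.
- exact: measurable_tc_group.
- exact: measurable_aWH_mul.
- exact: measurable_aWH_inv.
- exact: tc_group_mul.
- exact: tc_group_inv.
- move=> x y /tc_group_aWH Ax /tc_group_aWH Ay; have AVy := aWH_group_inv Ay.
  by rewrite -aWH_mulA// aWH_mulgV// aWH_mulg1.
- move=> x y /tc_group_aWH Ax /tc_group_aWH Ay.
  have AVy := aWH_group_inv Ay; have Ayx := aWH_group_mul Ay Ax.
  have AVyx := aWH_group_inv Ayx.
  rewrite -[LHS]aWH_mul1g -(aWH_mulVg Ay) -aWH_mulA//; last exact: aWH_group_mul.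
  by rewrite (aWH_mulA Ay)// aWH_mulgV// aWH_mulg1.
Qed.

Section Haar.
Context (mu : {measure set (aWH R n) -> \bar R}).
Context (muH : left_Haar G mu) (muR : right_invariant G mu).

Lemma Haar_setI A : measurable A -> mu A = mu (A `&` G).
Proof.
move=> mA; have mG := measurable_tc_group.
rewrite -{1}(setIT A) -(setUv G) setIUr measureU//; last 3 first.
- exact: measurableI.
- by apply: measurableI => //; exact: measurableC.
- by rewrite setIACA setICr setI0.
rewrite [X in (_ + X)%E](_ : _ = 0%E) ?adde0//.
apply/eqP; rewrite eq_le measure_ge0 andbT -(Haar_carrier muH).
by apply: le_measure; rewrite ?inE//; do ?[exact: measurableC|exact: measurableI (measurableC _)].
Qed.

(** The invariance hypotheses concern images of sets. Inside G, the preimage under a translation is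
    the image under the inverse translation, which leads to integrals. *)
Lemma Haar_biinvariant : biinvariant (@aWH_mul R n) G mu.
Proof.
have mmul := measurable_aWH_mul.
have inv_of (phi psi : aWH R n -> aWH R n) : measurable_fun setT phi ->
    (forall x, G x -> G (phi x)) -> (forall x, G x -> G (psi x)) ->
    (forall x, G x -> phi (psi x) = x) -> (forall x, G x -> psi (phi x) = x) ->
    (forall A, measurable A -> A `<=` G -> mu (psi @` A) = mu A) ->
    forall f : aWH R n -> \bar R, measurable_fun setT f -> (forall x, 0 <= f x)%E ->
    (\int[mu]_x f (phi x) = \int[mu]_x f x)%E.
  move=> mphi Gphi Gpsi phiK psiK muphi f mf f0.
  rewrite -[LHS](@ge0_integral_pushforward _ _ _ _ _ _ mphi mu setT)//.
  apply: eq_measure_integral => A mA _; transitivity (mu (phi @^-1` A)) => //.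
  have mA' : measurable (phi @^-1` A) by rewrite -[X in measurable X]setTI; exact: mphi.
  rewrite (Haar_setI mA') [RHS](Haar_setI mA) -[RHS]muphi; last 2 first.
  - by apply: measurableI => //; exact: measurable_tc_group.
  - by move=> x [].
  congr (mu _); apply/seteqP; split=> [x [Apx Gx]|_ [x [Ax Gx] <-]].
    by exists (phi x); [split=> //; exact: Gphi|exact: psiK].
  by split; [rewrite /preimage /= phiK|exact: Gpsi].
have GV g : G g -> G (aWH_inv g) by exact: tc_group_inv.
have KK (x y : aWH R n) : G x -> G y -> aWH_mul (aWH_inv x) (aWH_mul x y) = y.
  move=> /tc_group_aWH Ax /tc_group_aWH Ay.
  by rewrite aWH_mulA ?aWH_mulVg ?aWH_mul1g//; exact: aWH_group_inv.
have KV (x y : aWH R n) : G x -> G y -> aWH_mul x (aWH_mul (aWH_inv x) y) = y.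
  move=> /tc_group_aWH Ax /tc_group_aWH Ay.
  by rewrite aWH_mulA ?aWH_mulgV ?aWH_mul1g//; exact: aWH_group_inv.
have KR (x y : aWH R n) : G x -> G y -> aWH_mul (aWH_mul y x) (aWH_inv x) = y.
  move=> /tc_group_aWH Ax /tc_group_aWH Ay.
  by rewrite -aWH_mulA ?aWH_mulgV ?aWH_mulg1//; exact: aWH_group_inv.
have KRV (x y : aWH R n) : G x -> G y -> aWH_mul (aWH_mul y (aWH_inv x)) x = y.
  move=> /tc_group_aWH Ax /tc_group_aWH Ay.
  by rewrite -aWH_mulA ?aWH_mulVg ?aWH_mulg1//; exact: aWH_group_inv.
split; first exact: (Haar_carrier muH).
- move=> g Gg; apply: (inv_of _ (aWH_mul (aWH_inv g))).
  + exact: (measurableT_comp mmul (pair1_measurable g)).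
  + by move=> x Gx; exact: tc_group_mul.
  + by move=> x Gx; apply: tc_group_mul => //; exact: GV.
  + by move=> x Gx; exact: KV.
  + by move=> x Gx; exact: KK.
  + by move=> A mA AG; apply: (Haar_left_invariant muH) => //; exact: GV.
- move=> g Gg; apply: (inv_of _ (fun x => aWH_mul x (aWH_inv g))).
  + exact: (measurableT_comp mmul (pair2_measurable g)).
  + by move=> x Gx; exact: tc_group_mul.
  + by move=> x Gx; apply: tc_group_mul => //; exact: GV.
  + by move=> x Gx; exact: KRV.
  + by move=> x Gx; exact: KR.
  + by move=> A mA AG; apply: muR => //; exact: GV.
Qed.

End Haar.
End tc_group_theory.

(** * The Haar measure of coordinate boxes *)

(** Additivity gives f (m t) = m f(t) for natural m. With p the integer part of c q, monotonicity
    places both q f(c s) and c q f(s) between p f(s) and (p + 1) f(s), so f(c s) and c f(s) differ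
    by at most f(s) / q. *)
Lemma additive_monotone_linear (R : realType) (f : R -> R) :
  (forall s t, 0 <= s -> 0 <= t -> f (s + t) = f s + f t) ->
  (forall s, 0 <= s -> 0 <= f s) ->
  forall c s, 0 < c -> 0 <= s -> f (c * s) = c * f s.
Proof.
move=> fD f0 c s c0 s0.
have fM (m : nat) t : 0 <= t -> f (m%:R * t) = m%:R * f t.
  move=> t0; elim: m => [|m IHm].
    have := fD 0 0 (lexx 0) (lexx 0); rewrite addr0 !mul0r; lra.
  by rewrite -natr1 !mulrDl !mul1r fD ?mulr_ge0// IHm.
have fmono t u : 0 <= t -> t <= u -> f t <= f u.
  by move=> t0 tu; rewrite -[u](subrK t) addrC fD ?lerDl ?f0// subr_ge0.
have fs0 := f0 _ s0.
have key (q : nat) : (0 < q)%N -> `|f (c * s) - c * f s| * q%:R <= f s.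
  move=> q0; have q0' : 0 < q%:R :> R by rewrite ltr0n.
  have cq0 : 0 <= c * q%:R by rewrite mulr_ge0 ?ltW.
  pose p := Num.truncn (c * q%:R).
  have /andP[p1 p2] : p%:R <= c * q%:R < p.+1%:R by exact: truncn_itv.
  have cs0 : 0 <= c * s by rewrite mulr_ge0// ltW.
  have e1 : p%:R * f s <= q%:R * f (c * s).
    rewrite -(fM p s s0) -(fM q _ cs0); apply: fmono; first by rewrite mulr_ge0.
    by rewrite mulrA (mulrC q%:R) ler_wpM2r.
  have e2 : q%:R * f (c * s) <= p.+1%:R * f s.
    rewrite -(fM p.+1 s s0) -(fM q _ cs0); apply: fmono; first by rewrite mulr_ge0.
    by rewrite mulrA (mulrC q%:R) ler_wpM2r// ltW.
  rewrite (_ : `|_| * _ = `|(f (c * s) - c * f s) * q%:R|); last first.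
    by rewrite normrM (ger0_norm (ltW q0')).
  rewrite -natr1 in e2 p2; rewrite ler_norml.
  have := ler_wpM2r fs0 p1; have := ler_wpM2r fs0 (ltW p2).
  by move=> e3 e4; apply/andP; split; lra.
apply/eqP; rewrite -subr_eq0 -normr_le0 leNgt; apply/negP => d0.
have fs0' := key 1%N isT.
pose q := (Num.truncn (f s / `|f (c * s) - c * f s|)).+1.
have := key q (ltn0Sn _); rewrite leNgt => /negP; apply.
by rewrite mulrC -ltr_pdivrMr// /q truncnS_gt.
Qed.

Section sigma_finite_of.
Context d (T : measurableType d) (R : realType) (mu : {measure set T -> \bar R}).

Definition sigma_finite_of (_ : sigma_finite setT mu) : set T -> \bar R := mu.

Context (s : sigma_finite setT mu).
HB.instance Definition _ := Measure.copy (sigma_finite_of s) mu.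
HB.instance Definition _ := Measure_isSigmaFinite.Build _ _ _ (sigma_finite_of s) s.

End sigma_finite_of.

Section tc_group_boxes.
Context (R : realType) (n k : nat) (V : {vspace 'cV[R]_n}) (H : set 'M[R]_n).
Context (tcVH : translation_complete V H).
Context (B : 'M[R]_(n, k)) (C : 'M[R]_(k, n)).
Context (CB : C *m B = 1%:M) (VB : forall v, v \in V <-> B *m (C *m v) = v).
Local Notation G := (tc_group V H).
Local Notation I := ('I_n + 'I_k)%type.

Definition tc_coord (i : I) (g : aWH R n) : R :=
  match i with inl i => g.1.1.2 i 0 | inr j => (C *m g.1.2) j 0 end.

(** Left multiplication by this element moves coordinate i by t and fixes the other coordinates and
    the matrix ([tc_coord_shift], [tc_shift_GL]). *)
Definition tc_shift (i : I) (t : R) : aWH R n :=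
  match i with
  | inl i => (1, t *: delta_mx i 0, 0, 1%:M)
  | inr j => (1, 0, t *: col j B, 1%:M) end.

(** The lower bound on the determinant keeps the set away from the singular matrices; hence it is
    compact, and these sets exhaust H. *)
Definition GL_box (N : nat) : set 'M[R]_n :=
  [set h | [/\ H h, forall i j, `|h i j| <= N%:R & N.+1%:R^-1 <= `|\det h|]].

Definition tc_box (J : I -> set R) N : set (aWH R n) :=
  [set g | [/\ G g, forall i, J i (tc_coord i g) & GL_box N g.2]].

Lemma measurable_tc_coord i : measurable_fun setT (tc_coord i).
Proof.
case: i => i /=.
  apply: measurable_mx_entry; apply: (measurableT_comp measurable_snd).
  exact: (measurableT_comp measurable_fst).
apply: measurable_mx_entry; apply: measurable_mulmx; first exact: measurable_cst.
exact: (measurableT_comp measurable_snd).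
Qed.

Lemma tc_shift_in i t : G (tc_shift i t).
Proof.
have [HG _] := tcVH.
case: i => i /=; split; try exact: (GL_subgroup1 HG); try exact: mem0v.
- by split; [rewrite normr1|exact: unitmx1].
- by split; [rewrite normr1|exact: unitmx1].
- by apply/VB; rewrite -!scalemxAr colE !mulmxA -(mulmxA B) CB mulmx1.
Qed.

Lemma tc_coord_shift i j t g :
  tc_coord j (aWH_mul (tc_shift i t) g) = tc_coord j g + (if i == j then t else 0).
Proof.
move: g => [[[z x] xi] h]; case: i => i; case: j => j /=;
  rewrite ?mul1mx ?invmx1 ?trmx1 ?mul1mx ?add0r ?addr0//.
- rewrite mxE addrC !mxE eqxx andbT.
  have -> : (inl i == inl j :> I) = (i == j) by [].
  by rewrite eq_sym; case: eqP => _; rewrite ?mulr1 ?mulr0.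
- rewrite mulmxDr mxE addrC; congr (_ + _).
  have -> : (inr i == inr j :> I) = (i == j) by [].
  rewrite -scalemxAr colE mulmxA CB mul1mx !mxE eqxx andbT eq_sym.
  by case: eqP => _; rewrite ?mulr1 ?mulr0.
Qed.

Lemma tc_shift_GL i t g : (aWH_mul (tc_shift i t) g).2 = g.2.
Proof. by move: g => [[[z x] xi] h]; case: i => i /=; rewrite mul1mx. Qed.

Lemma compact_GL_box N : compact (GL_box N).
Proof.
have [HG _] := tcVH.
have := @compact_matrix_box R n n (fun _ _ => `[- N%:R, N%:R]%classic)
  (fun _ _ => @segment_compact R _ _).
set K := [set M | _] => cK.
have cd : closed [set h : 'M[R]_n | N.+1%:R^-1 <= `|\det h|].
  have cnd : continuous (fun h : 'M[R]_n => `|\det h|).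
    move=> h; exact: (continuous_comp (@continuous_det R n h) (@norm_continuous R R^o _)).
  have /continuous_closedP/(_ [set x | N.+1%:R^-1 <= x]) := cnd.
  by apply; exact: closed_ge.
have := compact_closedI (compact_closedI cK cd) (@closed_closure _ H).
congr compact; apply/seteqP; split=> [h [[Kh dh] ch]|h [Hh Nh dh]].
  split=> //; last first.
    by move=> i j; have := Kh i j; rewrite /= in_itv /= ler_norml.
  apply: (GL_subgroup_closed HG); split=> //=; rewrite unitmxE unitfE -normr_gt0.
  by apply: lt_le_trans dh; rewrite invr_gt0.
split; last exact: subset_closure.
split=> // i j; have := Nh i j; by rewrite /= in_itv /= ler_norml.
Qed.

Lemma measurable_GL_box N : measurable (GL_box N).
Proof.
apply: measurable_closed_matrix; apply: compact_closed; last exact: compact_GL_box.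
exact: norm_hausdorff.
Qed.

Lemma measurable_tc_box J N : (forall i, measurable (J i)) -> measurable (tc_box J N).
Proof.
move=> mJ; rewrite (_ : tc_box J N = G `&` ((\bigcap_(i in [set: I])
    (tc_coord i @^-1` J i)) `&` (fun g => g.2) @^-1` GL_box N)).
  apply: measurableI; first exact: (measurable_tc_group tcVH VB).
  apply: measurableI.
    apply: fin_bigcap_measurable => // i _; rewrite -[X in measurable X]setTI.
    exact: measurable_tc_coord.
  rewrite -[X in measurable X]setTI; apply: (measurable_snd) => //.
  exact: measurable_GL_box.
apply/seteqP; split=> g; first by move=> [Gg gs gN]; split=> //; split=> // i _; exact: gs.
by move=> [Gg [gs gN]]; split=> // i; exact: (gs i Logic.I).
Qed.

(** The box is a product of the circle, a box of positions, the image under B of a box of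
    V-coordinates, and [GL_box]. *)
Lemma compact_tc_box J N : (forall i, compact (J i)) -> compact (tc_box J N).
Proof.
move=> cJ; have cX := @compact_matrix_box R n 1 (fun i _ => J (inl i)) (fun _ _ => cJ _).
have cY := @compact_matrix_box R k 1 (fun j _ => J (inr j)) (fun _ _ => cJ _).
have cBY := continuous_compact (continuous_subspaceT (@continuous_mulmx R n k 1 B)) cY.
have := compact_setX (compact_setX (compact_setX (@compact_circle R) cX) cBY) (@compact_GL_box N).
congr compact; apply/seteqP; split.
  move=> [[[z x] xi] h] [[[/= z1 xs] [c cs <-]] hN].
  have [Hh _ _] := hN; have [HG _] := tcVH; split=> //=.
    split=> //; first by split=> //; exact: (GL_subgroup_unit HG).
    by apply/VB; rewrite [C *m _]mulmxA CB mul1mx.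
  by case=> i /=; [exact: xs|rewrite mulmxA CB mul1mx; exact: cs].
move=> [[[z x] xi] h] [[[z1 hU] xiV Hh] gs hN]; split=> //; split.
  by split=> //= i j; rewrite ord1; exact: (gs (inl i)).
exists (C *m xi); last exact/VB.
by move=> i j; rewrite ord1 /=; exact: (gs (inr i)).
Qed.

Lemma tc_box_sub J K N : (forall i, J i `<=` K i) -> tc_box J N `<=` tc_box K N.
Proof. by move=> JK g [Gg gs gN]; split=> // i; exact/JK. Qed.

Section Haar_boxes.
Context (mu : {measure set (aWH R n) -> \bar R}).
Context (muH : left_Haar G mu) (muR : right_invariant G mu).

Let mG := measurable_tc_group tcVH VB.
Let bmu : biinvariant (@aWH_mul R n) G mu := Haar_biinvariant tcVH VB muH muR.

Lemma Haar_preimage g A : G g -> measurable A -> mu (aWH_mul g @^-1` A) = mu A.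
Proof.
move=> Gg mA; have mg : measurable_fun setT (aWH_mul g).
  exact: (measurableT_comp (@measurable_aWH_mul R n) (pair1_measurable g)).
have mA' : measurable (aWH_mul g @^-1` A) by rewrite -[X in measurable X]setTI; exact: mg.
rewrite -[A in RHS]setIT -[aWH_mul g @^-1` A]setIT -!integral_indic//.
apply: (biinvariantl bmu Gg (f := fun x => (\1_A x)%:E)) => //.
by apply/measurable_EFinP; exact: measurable_indic.
Qed.

Lemma tc_box_lty (J : I -> set R) N (M : R) : (forall i, measurable (J i)) ->
  (forall i, J i `<=` `[- M, M]%classic) -> (mu (tc_box J N) < +oo)%E.
Proof.
move=> mJ JM; pose K (i : I) := `[- M, M]%classic : set R.
apply: (@le_lt_trans _ _ (mu (tc_box K N))).
  apply: le_measure; rewrite ?inE; [exact: measurable_tc_box| |exact: tc_box_sub].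
  by apply: measurable_tc_box => i; exact: measurable_itv.
apply: (Haar_compact muH); first by apply: compact_tc_box => i; exact: segment_compact.
by move=> g [].
Qed.

Definition upd (J : I -> set R) i X : I -> set R := fun j => if j == i then X else J j.

(** Half-open, so that an interval splits into two disjoint intervals of the same kind. *)
Let co (a b : R) : set R := `[a, b[%classic.

(* As a function of the length of one side, the measure of a box is monotone,     *)
(* and additive by invariance under translations along that side, hence linear.   *)
Lemma Haar_box_scale1 (J : I -> set R) N (M : R) i (c s : R) : (forall j, measurable (J j)) ->
  (forall j, J j `<=` `[- M, M]%classic) -> 0 < c -> 0 < s ->
  (mu (tc_box (upd J i (co (- (c * s)) (c * s))) N) =
   c%:E * mu (tc_box (upd J i (co (- s) s)) N))%E.
Proof.
move=> mJ JM c0 s0; pose E a b := tc_box (upd J i (co a b)) N.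
have mE a b : measurable (E a b).
  by apply: measurable_tc_box => j; rewrite /upd; case: ifP => // _; exact: measurable_itv.
have Eoo a b : (mu (E a b) < +oo)%E.
  apply: (@tc_box_lty _ _ (Num.max `|M| (Num.max `|a| `|b|))) => j.
    by rewrite /upd; case: ifP => // _; exact: measurable_itv.
  rewrite /upd; case: ifP => _ x.
    rewrite /co /= !in_itv /= => /andP[ax xb]; apply/andP; split.
      rewrite lerNl !le_max; apply/orP; right; apply/orP; left.
      have := ler_norm (- a); rewrite normrN; lra.
    rewrite !le_max; apply/orP; right; apply/orP; right.
    have := ler_norm b; lra.
  move=> /JM; rewrite /= !in_itv /= => /andP[Mx xM]; apply/andP; split.
    by rewrite lerNl !le_max; apply/orP; left; have := ler_norm M; lra.
  by rewrite !le_max; apply/orP; left; have := ler_norm M; lra.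
pose D a b := fine (mu (E a b)).
have DE a b : mu (E a b) = (D a b)%:E by rewrite fineK// ge0_fin_numE.
have D0 a b : 0 <= D a b by apply: fine_ge0.
have Dadd a b d : a <= b -> b <= d -> D a d = D a b + D b d.
  move=> ab bd; apply: EFin_inj; rewrite EFinD -!DE -measureU//.
    congr (mu _); apply/seteqP; split=> g.
      move=> [Gg gJ gN]; have := gJ i; rewrite /upd eqxx /co /= in_itv /= => /andP[ga gd].
      have [gb|gb] := ltP (tc_coord i g) b; [left|right]; split=> // j;
        have := gJ j; rewrite /upd; case: eqP => // -> _; rewrite /co /= in_itv /= ?ga ?gb ?gd//.
    move=> [|] [Gg gJ gN]; have := gJ i; rewrite /upd eqxx /co /= in_itv /= => /andP[g1 g2];
      split=> // j; have := gJ j; rewrite /upd; case: eqP => // -> _; rewrite /co /= in_itv /=.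
      by rewrite g1 (lt_le_trans g2).
    by rewrite g2 (le_trans ab).
  apply/seteqP; split=> // g [[_ g1 _] [_ g2 _]].
  have := g1 i; have := g2 i; rewrite /upd eqxx /co /= !in_itv /= => /andP[bg _] /andP[_].
  by rewrite ltNge bg.
have Dshift a b t : D (a + t) (b + t) = D a b.
  apply: EFin_inj; rewrite -!DE -(Haar_preimage (tc_shift_in i t) (mE (a + t) (b + t))).
  rewrite (Haar_setI tcVH VB muH); last first.
    have mg : measurable_fun setT (aWH_mul (tc_shift i t)).
      exact: (measurableT_comp (@measurable_aWH_mul R n) (pair1_measurable _)).
    by rewrite -[X in measurable X]setTI; exact: mg.
  congr (mu _); apply/seteqP; split=> g.
    move=> [[_ gJ gN] Gg]; split=> //; last by rewrite tc_shift_GL in gN.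
    move=> j; have := gJ j; rewrite /upd tc_coord_shift (eq_sym i j).
    by case: eqP => [->|_]; rewrite ?addr0// /co /= !in_itv /= lerD2r ltrD2r.
  move=> [Gg gJ gN]; split=> //; split.
  - exact: (tc_group_mul tcVH (tc_shift_in i t)).
  - move=> j; have := gJ j; rewrite /upd tc_coord_shift (eq_sym i j).
    by case: eqP => [->|_]; rewrite ?addr0// /co /= !in_itv /= lerD2r ltrD2r.
  - by rewrite tc_shift_GL.
pose f t := D 0 t.
have fD t u : 0 <= t -> 0 <= u -> f (t + u) = f t + f u.
  move=> t0 u0; rewrite /f (Dadd 0 t (t + u))// ?lerDl//; congr (_ + _).
  by rewrite -(Dshift 0 u t) add0r addrC.
(* The symmetric side has length 2 t and is shifted to start at 0. *)
have Df t : D (- t) t = f (2 * t).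
  by rewrite -(Dshift _ _ t) addNr mulr_natl mulr2n.
have := additive_monotone_linear fD (fun t _ => D0 0 t) c0 (s := 2 * s).
rewrite mulr_ge0 ?ltW// => /(_ isT) fc.
by rewrite !DE !Df -EFinM mulrCA fc.
Qed.

(** The sides are rescaled one at a time; [J r] is the box in which exactly the sides listed in r
    have been rescaled. *)
Lemma Haar_box_scale (c s : I -> R) N : (forall i, 0 < c i) -> (forall i, 0 < s i) ->
  (mu (tc_box (fun i => co (- (c i * s i)) (c i * s i)) N) =
   (\prod_i c i)%:E * mu (tc_box (fun i => co (- s i) (s i)) N))%E.
Proof.
move=> c0 s0.
pose J (r : seq I) i := if i \in r then co (- (c i * s i)) (c i * s i) else co (- s i) (s i).
have mJ r i : measurable (J r i) by rewrite /J; case: ifP => _; exact: measurable_itv.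
pose M := \sum_i (c i * s i + s i).
have JM r i : J r i `<=` `[- M, M]%classic.
  have Mi : c i * s i + s i <= M.
    rewrite /M (bigD1 i)//= lerDl; apply: sumr_ge0 => j _.
    by rewrite addr_ge0// ?mulr_ge0// ltW.
  have := c0 i; have := s0 i => si ci; have cs : 0 < c i * s i by rewrite mulr_gt0.
  rewrite /J => x; case: ifP => _; rewrite /co /= !in_itv /= => /andP[x1 x2];
    by apply/andP; split; lra.
have key r : uniq r -> (mu (tc_box (J r) N) =
    (\prod_(i <- r) c i)%:E * mu (tc_box (J [::]) N))%E.
  elim: r => [|i r IHr] /=; first by rewrite big_nil mul1e.
  move=> /andP[ir ur]; rewrite big_cons EFinM -muleA -IHr//.
  rewrite (_ : J (i :: r) = upd (J r) i (co (- (c i * s i)) (c i * s i))); last first.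
    by apply/funext => j; rewrite /J /upd inE; case: eqP => // ->.
  rewrite (Haar_box_scale1 _ _ (mJ r) (JM r))//; congr (_ * mu (tc_box _ _))%E.
  by apply/funext => j; rewrite /J /upd; case: eqP => // ->; rewrite (negbTE ir).
have := key (index_enum I) (index_enum_uniq _).
rewrite (_ : J (index_enum I) = fun i => co (- (c i * s i)) (c i * s i))//.
by apply/funext => i; rewrite /J mem_index_enum.
Qed.

Let Jn (N : nat) (i : I) : set R := co (- N.+1%:R) N.+1%:R.

Lemma tc_box_cover : \bigcup_N tc_box (Jn N) N = G.
Proof.
have [HG _] := tcVH.
apply/seteqP; split=> [g [N _ []]//|g Gg].
have ex (x : R) : exists N : nat, x < N%:R.
  by exists (Num.truncn x).+1; exact: truncnS_gt.
have [hU Hh] : g.2 \in unitmx /\ H g.2 by move: g Gg => [[[z x] xi] h] [[]].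
have d0 : 0 < `|\det g.2| by rewrite normr_gt0 -unitfE -unitmxE.
(* N exceeds every coordinate, every matrix entry and the inverse of the determinant, since it
   exceeds their sum. *)
have [N NP] := ex (\sum_i `|tc_coord i g| + \sum_i \sum_j `|g.2 i j| + `|\det g.2|^-1).
have s1 : 0 <= \sum_i `|tc_coord i g| by apply: sumr_ge0 => i _; exact: normr_ge0.
have s2 : 0 <= \sum_i \sum_j `|g.2 i j|.
  by apply: sumr_ge0 => i _; apply: sumr_ge0 => j _; exact: normr_ge0.
have s3 : 0 < `|\det g.2|^-1 by rewrite invr_gt0.
exists N => //; split=> //.
  move=> i; have : `|tc_coord i g| <= \sum_i `|tc_coord i g|.
    rewrite [leRHS](bigD1 i)//= lerDl; apply: sumr_ge0 => j _; exact: normr_ge0.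
  rewrite /Jn /co /= in_itv /= -natr1; move: NP s2 s3.
  move: (\sum_i `|tc_coord i g|) (\sum_i \sum_j _) (_^-1) => a b c NP b0 c0 ta.
  have := ler_norm (tc_coord i g); have := ler_norm (- tc_coord i g); rewrite normrN.
  by move=> t1 t2; apply/andP; split; lra.
split=> //.
  move=> i j; have : `|g.2 i j| <= \sum_i \sum_j `|g.2 i j|.
    rewrite [leRHS](bigD1 i)//= [X in X + _](bigD1 j)//= -addrA lerDl addr_ge0//.
      by apply: sumr_ge0 => l _; exact: normr_ge0.
    by apply: sumr_ge0 => l _; apply: sumr_ge0 => m _; exact: normr_ge0.
  move: NP s1 s3; move: (\sum_i `|tc_coord i g|) (\sum_i \sum_j _) (_^-1) => a b c; lra.
rewrite -[leRHS]invrK lef_pV2 ?posrE//.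
move: NP s1 s2; move: (\sum_i `|tc_coord i g|) (\sum_i \sum_j _) (_^-1) => a b c.
rewrite -natr1; lra.
Qed.

Let mJn N i : measurable (Jn N i). Proof. exact: measurable_itv. Qed.

Let JnM N i : Jn N i `<=` `[- N.+1%:R, N.+1%:R]%classic.
Proof. by move=> x; rewrite /Jn /co /= !in_itv /= => /andP[-> /ltW]. Qed.

(** The boxes cover only G; its null complement is added to each of them. *)
Lemma Haar_sigma_finite : sigma_finite setT mu.
Proof.
exists (fun N => tc_box (Jn N) N `|` ~` G).
  apply/esym; rewrite -subTset => g _; have [|nGg] := pselect (G g).
    by rewrite -{1}tc_box_cover => -[N _ gN]; exists N => //; left.
  by exists 0%N => //; right.
move=> N; have mb := measurable_tc_box N (mJn N); have mGC := measurableC mG.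
split; first exact: measurableU.
rewrite measureU//; last by apply/seteqP; split=> // g [[Gg _ _]].
apply: lte_add_pinfty; first exact: tc_box_lty (mJn N) (@JnM N).
by rewrite [X in (X < _)%E](_ : _ = 0%E) ?ltry//; exact: (Haar_carrier muH).
Qed.

Lemma Haar_box_gt0 : exists N, (0 < mu (tc_box (Jn N) N))%E.
Proof.
apply: contrapT => /forallNP h0.
have : mu G = 0%E; last exact: (Haar_neq0 muH).
apply/eqP; rewrite eq_le measure_ge0 andbT -tc_box_cover.
apply: le_trans (measure_sigma_subadditive mu _ _ (@subset_refl _ _)) _.
- by move=> N; exact: measurable_tc_box.
- by rewrite tc_box_cover.
rewrite eseries0// => N _ _; apply/eqP; rewrite eq_le measure_ge0 andbT leNgt.
exact/negP.
Qed.

End Haar_boxes.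
End tc_group_boxes.

(** * Haar measure and conjugation by a dilation *)

Section conjugation_by_dilation.
Context (R : realType) (n : nat).
Implicit Types (g : aWH R n).

Definition aWH_dil (a : R) : aWH R n := (1, 0, 0, a%:M).

(** D_a^-1 g D_a, by [aWH_conjE]. *)
Definition aWH_conj (a : R) g : aWH R n :=
  let: (z, x, xi, h) := g in (z, a^-1 *: x, a *: xi, h).

Lemma aWH_group_dil a : a != 0 -> aWH_group (aWH_dil a).
Proof.
move=> a0; split; first by rewrite normr1.
by rewrite unitmxE det_scalar unitfE expf_neq0.
Qed.

Lemma aWH_inv_dil a : a != 0 -> aWH_inv (aWH_dil a) = aWH_dil a^-1.
Proof.
move=> a0; rewrite /aWH_inv /aWH_dil invmx_scalar !mulmx0 dotcV0r expi0 !oppr0 mulr1.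
by congr (_, _, _, _); rewrite rmorph1.
Qed.

Lemma aWH_conjE a g : a != 0 -> aWH_mul g (aWH_dil a) = aWH_mul (aWH_dil a) (aWH_conj a g).
Proof.
move: g => [[[z x] xi] h] a0; rewrite /aWH_mul /aWH_dil /aWH_conj.
rewrite !mulmx0 !dotcV0r dotcV0l expi0 !mulr1 mul1r !addr0 !add0r invmx_scalar tr_scalar_mx.
rewrite !mul_scalar_mx !scalerA mulfV// mulVf// !scale1r.
by congr (_, _, _, _); rewrite mul_mx_scalar.
Qed.

Lemma aWH_conjM a g1 g2 : a != 0 ->
  aWH_conj a (aWH_mul g1 g2) = aWH_mul (aWH_conj a g1) (aWH_conj a g2).
Proof.
move: g1 g2 => [[[z1 x1] xi1] h1] [[[z2 x2] xi2] h2] a0; rewrite /aWH_mul /aWH_conj.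
rewrite !scalerDr -!scalemxAr; congr (_ * expi _, _, _, _).
by apply: eq_bigr => i _; rewrite !mxE mulrACA mulfV// mul1r.
Qed.

Lemma aWH_conjK a g : a != 0 -> aWH_conj a (aWH_conj a^-1 g) = g.
Proof.
move: g => [[[z x] xi] h] a0; rewrite /aWH_conj !scalerA invrK.
by rewrite mulVf// mulfV// !scale1r.
Qed.

Lemma measurable_aWH_conj a : measurable_fun setT (aWH_conj a).
Proof.
have mz : measurable_fun setT (fun g : aWH R n => g.1.1.1).
  by do 2!apply: (measurableT_comp measurable_fst) => //.
have mx : measurable_fun setT (fun g : aWH R n => g.1.1.2).
  by apply: (measurableT_comp measurable_snd) => //; exact: (measurableT_comp measurable_fst).
have mxi : measurable_fun setT (fun g : aWH R n => g.1.2).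
  exact: (measurableT_comp measurable_snd).
have mh : measurable_fun setT (fun g : aWH R n => g.2) by exact: measurable_snd.
have := measurable_fun_pair (measurable_fun_pair (measurable_fun_pair mz
  (measurable_scalemx (measurable_cst a^-1) mx)) (measurable_scalemx (measurable_cst a) mxi)) mh.
by congr measurable_fun; apply/funext => -[[[? ?] ?] ?].
Qed.

Lemma tc_group_conj V H a g : a != 0 -> tc_group V H (aWH_conj a g) <-> tc_group V H g.
Proof.
move: g => [[[z x] xi] h] a0; split=> -[A1 xiV Hh]; split=> //; last exact: memvZ.
by rewrite -[xi](scalerK a0) memvZ.
Qed.

End conjugation_by_dilation.

Section Haar_dilation.
Context (R : realType) (n k : nat) (V : {vspace 'cV[R]_n}) (H : set 'M[R]_n).
Context (tcVH : translation_complete V H).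
Context (B : 'M[R]_(n, k)) (C : 'M[R]_(k, n)).
Context (CB : C *m B = 1%:M) (VB : forall v, v \in V <-> B *m (C *m v) = v).
Local Notation G := (tc_group V H).
Context (mu : {measure set (aWH R n) -> \bar R}).
Context (muH : left_Haar G mu) (muR : right_invariant G mu).

Let sf := Haar_sigma_finite tcVH CB VB muH.
Let mu' : {sigma_finite_measure set (aWH R n) -> \bar R} := sigma_finite_of sf.
Let bmu : biinvariant (@aWH_mul R n) G mu := Haar_biinvariant tcVH VB muH muR.
Let mgG := tc_measurable_group tcVH VB.

Let box N := tc_box V H C (fun i : 'I_n + 'I_k => `[- N.+1%:R, N.+1%:R[%classic) N.

Let measurable_box N : measurable (box N).
Proof. by apply: (measurable_tc_box tcVH VB) => i; exact: measurable_itv. Qed.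

Let box_fin : exists N, (0 < mu (box N) < +oo)%E.
Proof.
have [N N0] := Haar_box_gt0 tcVH VB muH; exists N; rewrite N0 /=.
pose M : R := N.+1%:R.
apply: (@tc_box_lty R n k V H tcVH B C CB VB mu muH _ N M) => i; first exact: measurable_itv.
by move=> x; rewrite /= !in_itv /= => /andP[-> /ltW].
Qed.

Lemma Haar_inv (f : aWH R n -> \bar R) : measurable_fun setT f -> (forall x, 0 <= f x)%E ->
  (\int[mu]_x f (aWH_inv x) = \int[mu]_x f x)%E.
Proof.
move=> mf f0; have [N Noo] := box_fin; have mA := measurable_box N.
apply: (@biinvariant_inv _ _ R _ _ _ mgG mu' f (fun x => (\1_(box N) x)%:E)) => //.
  by apply/measurable_EFinP; exact: measurable_indic.
by rewrite integral_indic// setIT.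
Qed.

(* The image of mu under the conjugation is biinvariant, hence proportional to    *)
(* mu; coordinate boxes give the factor.                                          *)
Lemma Haar_conj a (f : aWH R n -> \bar R) : 0 < a -> measurable_fun setT f ->
  (forall x, 0 <= f x)%E ->
  (\int[mu]_x f (aWH_conj a x) = (a ^+ n / a ^+ k)%:E * \int[mu]_x f x)%E.
Proof.
move=> a0 mf f0; have an0 : a != 0 by rewrite gt_eqF.
have mc := @measurable_aWH_conj R n a.
have mcV := @measurable_aWH_conj R n a^-1.
have aV0 : a^-1 != 0 by rewrite invr_eq0.
have cK g : aWH_conj a^-1 (aWH_conj a g) = g :> aWH R n.
  by have := aWH_conjK g aV0; rewrite invrK.
have cKV g : aWH_conj a (aWH_conj a^-1 g) = g :> aWH R n by exact: aWH_conjK.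
pose nu : {measure set (aWH R n) -> \bar R} :=
  measure_function_pushforward__canonical__measure_function_Measure mu mc.
have nuE A : nu A = mu (aWH_conj a @^-1` A) by [].
have int_nu (h : aWH R n -> \bar R) : measurable_fun setT h -> (forall x, 0 <= h x)%E ->
    (\int[nu]_x h x = \int[mu]_x h (aWH_conj a x))%E.
  by move=> mh h0; rewrite [LHS](@ge0_integral_pushforward _ _ _ _ _ _ mc mu setT).
have sfnu : sigma_finite setT nu.
  have [F UF Fo] := sf; exists (fun j => aWH_conj a^-1 @^-1` F j).
    apply/esym; rewrite -subTset => g _.
    have : setT (aWH_conj a^-1 g) by []. rewrite UF => -[j _ Fj]; by exists j.
  move=> j; have [mF Foo] := Fo j; split.
    by rewrite -[X in measurable X]setTI; exact: mcV.
  by rewrite nuE (_ : _ @^-1` _ = F j)//; apply/seteqP; split=> g; rewrite /preimage /= cK.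
pose nu' : {sigma_finite_measure set (aWH R n) -> \bar R} := sigma_finite_of sfnu.
have Gc g : G g -> G (aWH_conj a^-1 g) by move/(tc_group_conj V H g aV0).
have mmul := @measurable_aWH_mul R n.
have bnu : biinvariant (@aWH_mul R n) G nu.
  split.
  - rewrite nuE -[RHS](Haar_carrier muH); congr (mu _); apply/seteqP; split=> g /=.
      by apply: contra_not => Gg; apply/(tc_group_conj V H g an0).
    by apply: contra_not => Gg; apply/(tc_group_conj V H g an0).
  - move=> g Gg h mh h0; have mg := measurableT_comp mmul (pair1_measurable g).
    rewrite !int_nu//; last exact: (measurableT_comp mh mg).
    rewrite -[RHS](biinvariantl bmu (Gc _ Gg) (measurableT_comp mh mc) (fun=> h0 _)).
    by apply: eq_integral => x _ /=; rewrite aWH_conjM// cKV.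
  - move=> g Gg h mh h0; have mg := measurableT_comp mmul (pair2_measurable g).
    rewrite !int_nu//; last exact: (measurableT_comp mh mg).
    rewrite -[RHS](biinvariantr bmu (Gc _ Gg) (measurableT_comp mh mc) (fun=> h0 _)).
    by apply: eq_integral => x _ /=; rewrite aWH_conjM// cKV.
have [N Noo] := box_fin; have mA := measurable_box N.
rewrite -int_nu//.
apply: (@biinvariant_unique _ _ R _ _ _ mgG mu' nu' _ f (fun x => (\1_(box N) x)%:E)) => //.
- by apply/measurable_EFinP; exact: measurable_indic.
- by rewrite divr_gt0// exprn_gt0.
- by rewrite integral_indic// setIT.
rewrite !integral_indic// !setIT [LHS]nuE.
(* The preimage of the box under the conjugation has its n position sides multiplied by a and its k
   frequency sides by 1/a, whence a^n / a^k. *)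
pose c (i : 'I_n + 'I_k) := if i is inl _ then a else a^-1.
have c0 i : 0 < c i by case: i => ? /=; rewrite ?invr_gt0.
have -> : a ^+ n / a ^+ k = \prod_i c i.
  rewrite big_sumType /= !big_const_ord /=.
  rewrite !iter_mulr_1 exprVn.
  by [].
have coordE g i : (- N.+1%:R <= tc_coord C i (aWH_conj a g) < N.+1%:R) =
    (- (c i * N.+1%:R) <= tc_coord C i g < c i * N.+1%:R).
  have scaleE (t y s : R) : 0 < t -> (- s <= t^-1 * y < s) = (- (t * s) <= y < t * s).
    by move=> t0; rewrite ltr_pdivrMl// ler_pdivlMl// mulrN.
  move: g => [[[z x] xi] h]; case: i => i /=; first by rewrite mxE scaleE.
  by rewrite -scalemxAr mxE -(scaleE a^-1) ?invr_gt0// invrK.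
rewrite -(Haar_box_scale tcVH CB VB muH muR N c0 (fun=> ltr0Sn _ _)).
congr (mu _); apply/seteqP; split=> g [Gg gJ gN].
  split; first exact/(tc_group_conj V H g an0).
    by move=> i; have := gJ i; rewrite /= !in_itv /= coordE.
  by move: g gN {Gg gJ} => [[[? ?] ?] ?].
split; first exact/(tc_group_conj V H g an0).
  by move=> i; have := gJ i; rewrite /= !in_itv /= coordE.
by move: g gN {Gg gJ} => [[[? ?] ?] ?].
Qed.

End Haar_dilation.

(** * Total families and correlations of dilates *)

(** By induction on r: removing from u its component along v i lowers c <u, u> by <u, v i>^2 and
    leaves the other coefficients unchanged. *)
Lemma bessel (R : realType) (E : lmodType R) (ip : E -> E -> R) (I : eqType) (v : I -> E)
    (c : R) (r : seq I) (u : E) : semi_inner ip -> 0 < c -> uniq r ->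
  (forall i, ip (v i) (v i) = c) -> (forall i j, i != j -> ip (v i) (v j) = 0) ->
  \sum_(i <- r) ip u (v i) ^+ 2 <= c * ip u u.
Proof.
move=> ipP c0 + vc vo; elim: r u => [|i r IHr] u /=.
  by rewrite big_nil mulr_ge0 ?(semi_inner_ge0 ipP)// ltW.
move=> /andP[ir ur]; rewrite big_cons.
pose t := ip u (v i) / c; pose u' := u - t *: v i.
have -> : \sum_(j <- r) ip u (v j) ^+ 2 = \sum_(j <- r) ip u' (v j) ^+ 2.
  apply: eq_big_seq => j jr; rewrite /u' !(semi_innerE ipP) vo ?mulr0 ?subr0//.
  by apply: contraNneq ir => ->.
have := IHr u' ur.
have -> : c * ip u' u' = c * ip u u - ip u (v i) ^+ 2.
  rewrite /u' !(semi_innerE ipP) vc (semi_innerC ipP (v i) u) /t; field.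
  by rewrite gt_eqF.
by rewrite lerBrDl.
Qed.

Section rat_boxes_total.
Context (R : realType) (n : nat).
Local Notation leb := (lebesgue_cV R n).
Local Notation rL2 := (rL2 leb).
Local Notation nrm := (inorm (@rL2_inner _ _ R leb)).

Local Notation rbox q := (rat_box q : set 'cV[R]_n).
Implicit Types (q : 'M[(rat * rat)%type]_(n, 1)) (f : rL2).

Lemma rat_box_lty q : (leb (rbox q) < +oo)%E.
Proof.
pose A i : set R := `](ratr (q i 0).1), (ratr (q i 0).2)[%classic.
have -> : rbox q = [set v | forall i, A i (v i ord0)].
  apply/seteqP; split=> v vq i; first by have := vq i 0; rewrite /A /= in_itv.
  by move=> j; rewrite ord1; have := vq i; rewrite /A /= in_itv.
rewrite lebesgue_cV_box; last by move=> i; exact: measurable_itv.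
suff : (0 <= \prod_(i < n) lebesgue_measure (A i) < +oo)%E by case/andP.
apply: (big_ind (fun x : \bar R => 0 <= x < +oo)%E).
- by rewrite lee_fin ler01 ltry.
- move=> x y /andP[x0 xoo] /andP[y0 yoo]; rewrite mule_ge0//=.
  by rewrite lte_mul_pinfty// ge0_fin_numE.
- move=> i _; rewrite measure_ge0 /= lebesgue_measure_itv /=.
  by case: ifP => _; [rewrite -EFinB ltry|exact: ltry].
Qed.

Lemma rat_box_Lfun2 q : (\1_(rbox q) : 'cV[R]_n -> R) \in Lfun leb 2%:E.
Proof.
apply: Lfun2P; first by apply: measurable_indic; exact: measurable_rat_box.
rewrite (_ : (\int[leb]_x _)%E = leb (rbox q)); first exact: rat_box_lty.
rewrite -[rbox q in RHS]setIT -integral_indic//; last exact: measurable_rat_box.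
by apply: eq_integral => v _; rewrite indicE; case: (_ \in _); rewrite ?expr1n ?expr0n.
Qed.

Definition ind_rL2 q : rL2 := mk_rL2 (rat_box_Lfun2 q).

Lemma rL2_box_integrable f q : leb.-integrable (rbox q) (fun v => (f v)%:E).
Proof.
apply/(integrable_mkcond _ (measurable_rat_box q)).
have := rL2_mul_integrable f (ind_rL2 q); congr (integrable _ _ _).
apply/funext => v; rewrite /patch /= indicE; case: ifPn => _; first by rewrite mulr1.
by rewrite mulr0.
Qed.

Lemma rL2_inner_ind f q :
  (rL2_inner f (ind_rL2 q))%:E = (\int[leb]_(v in rbox q) (f v)%:E)%E.
Proof.
rewrite rL2_innerE [RHS]integral_mkcond; apply: eq_integral => v _.
rewrite /patch /= indicE; case: ifPn => _; first by rewrite mulr1.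
by rewrite mulr0.
Qed.

(** By Dynkin's theorem f has integral 0 on every measurable subset of a rational box, hence
    vanishes almost everywhere on it. *)
Lemma ind_rL2_total f : (forall q, rL2_inner f (ind_rL2 q) = 0) -> nrm f = 0.
Proof.
move=> f0; have fbox q : (\int[leb]_(v in rbox q) (f v)%:E = 0)%E.
  by rewrite -rL2_inner_ind f0.
have mf : measurable_fun setT (fun v => (f v)%:E) by exact: rL2_measurable_EFin.
(* Everything is intersected with one box p, where f is integrable. *)
have on_box p : forall A, measurable A -> (\int[leb]_(v in rbox p `&` A) (f v)%:E = 0)%E.
  have mp := @measurable_rat_box R _ _ p.
  have fint A : measurable A -> leb.-integrable (rbox p `&` A) (fun v => (f v)%:E).
    by move=> mA; apply: integrableS (rL2_box_integrable f p) => //; exact: measurableI.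
  pose P (A : set 'cV[R]_n) := (\int[leb]_(v in rbox p `&` A) (f v)%:E = 0)%E.
  suff : forall A, <<s [set B : set 'cV[R]_n | exists q, B = rbox q] >> A -> P A.
    by move=> PA A; rewrite measurable_rat_boxE; exact: PA.
  apply: (@dynkin_induction _ _ [set B : set 'cV[R]_n | exists q, B = rbox q] P); rewrite /P.
  - exact: measurable_rat_boxE.
  - by move=> _ _ [q ->] [q' ->]; rewrite rat_box_setI; eexists.
  - by rewrite setIT.
  - by move=> _ [q ->]; rewrite rat_box_setI.
  - move=> A mA A0.
    have := fbox p; rewrite -{1}(setIT (rbox p)) -(setUv A) setIUr integral_setU//.
    + by rewrite A0 add0e.
    + exact: measurableI.
    + by apply: measurableI => //; exact: measurableC.
    + exact: measurable_funTS.
    + by apply/disj_set2P; rewrite setIACA setICr setI0.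
  - move=> F mF tF F0; rewrite setI_bigcupr integral_bigcup//.
    + by rewrite eseries0.
    + by apply/trivIsetP => i j _ _ ij; rewrite setIACA (trivIsetP.1 tF)// setI0.
    + by move=> k; exact: measurableI.
    + by rewrite -setI_bigcupr; apply: fint; exact: bigcup_measurable.
have ae_box p : {ae leb, forall v, rbox p v -> (f v)%:E = 0%E}.
  have mp := @measurable_rat_box R _ _ p.
  apply/(ae_eq_integral_abs leb mp (measurable_funTS mf)).
  (* The integral of |f| is split according to the sign of f. *)
  pose A := [set v | 0 <= f v].
  have mA : measurable A.
    rewrite (_ : A = f @^-1` `[0, +oo[%classic).
      rewrite -[X in measurable X]setTI.
      exact: (rL2_measurable f measurableT (measurable_itv _)).
    by apply/seteqP; split=> v; rewrite /A /preimage /= in_itv /= andbT.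
  rewrite -(setIT (rbox p)) -(setUv A) setIUr integral_setU//; last 4 first.
  - exact: measurableI.
  - by apply: measurableI => //; exact: measurableC.
  - by apply: measurableT_comp => //; exact: measurable_funTS.
  - by apply/disj_set2P; rewrite setIACA setICr setI0.
  rewrite [X in (X + _)%E](_ : _ = 0%E) ?add0e; last first.
    rewrite -[RHS](on_box p A mA); apply: eq_integral => v; rewrite in_setE => -[_ Av].
    by rewrite /= ger0_norm.
  have mAC := measurableC mA.
  rewrite -[RHS](mule0 (-1)%:E) -(on_box p _ mAC) -integralZl//; last 2 first.
  - exact: measurableI.
  - apply: integrableS (rL2_box_integrable f p) => //; exact: measurableI.
  apply: eq_integral => v; rewrite in_setE => -[_ /negP]; rewrite -ltNge => fv.
  by rewrite /= ltr0_norm// -EFinM mulN1r.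
(* The boxes ]-N, N[^n exhaust the space. *)
have ae0 : {ae leb, forall v, (f v)%:E = 0%E}.
  pose p (N : nat) : 'M[(rat * rat)%type]_(n, 1) := \matrix_(i, j) (- N%:R, N%:R).
  apply: filterS (ae_foralln (fun N => ae_box (p N))) => v fv.
  pose S := \sum_(i < n) `|v i 0|; apply: (fv (Num.truncn S).+1) => i j.
  have : `|v i j| <= S.
    by rewrite ord1 /S (bigD1 i)//= lerDl; apply: sumr_ge0 => l _; exact: normr_ge0.
  move/le_lt_trans => /(_ _ (truncnS_gt S)); rewrite ltr_norml mxE /=.
  by rewrite rmorphN /= ratr_nat.
rewrite /inorm /rL2_inner /Rintegral (_ : (\int[leb]_x _)%E = 0%E) ?sqrtr0//.
rewrite -(integral0 leb setT); apply: ge0_ae_eq_integral => //.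
- by apply/measurable_EFinP; apply: measurable_funM; exact: rL2_measurable.
- by move=> v _; rewrite lee_fin -expr2 sqr_ge0.
- by apply: filterS ae0 => v fv _; rewrite EFinM fv mul0e.
Qed.

End rat_boxes_total.

Section dilation_correlation.
Context (R : realType) (n : nat).
Local Notation leb := (lebesgue_cV R n).
Local Notation cL2 := (cL2 leb).
Local Notation ip := (@cL2_inner _ _ R leb).
Local Notation nrm := (inorm ip).

Lemma aWH_dilM (a b : R) : aWH_mul (aWH_dil n a) (aWH_dil n b) = aWH_dil n (a * b).
Proof.
rewrite /aWH_mul /aWH_dil mulmx0 dotcV0l expi0 !mulr1 mulmx0 !addr0.
by congr (_, _, _, _); rewrite -scalar_mxM.
Qed.

Definition test_cL2 (b : bool) (q : 'M[(rat * rat)%type]_(n, 1)) : cL2 :=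
  if b then (ind_rL2 R q, 0) else (0, ind_rL2 R q).

Lemma test_cL2_total e : (forall b q, ip (test_cL2 b q) e = 0) -> nrm e = 0.
Proof.
move=> e0; have rP := rL2_semi_inner leb; have cP := cL2_semi_inner leb.
have ip0 (f : rL2 leb) : rL2_inner 0 f = 0.
  by rewrite -(scale0r f) (semi_innerZl rP) mul0r.
have e1 : inorm (@rL2_inner _ _ _ leb) e.1 = 0.
  apply: ind_rL2_total => q; have := e0 true q.
  by rewrite /cL2_inner /= ip0 addr0 (semi_innerC rP).
have e2 : inorm (@rL2_inner _ _ _ leb) e.2 = 0.
  apply: ind_rL2_total => q; have := e0 false q.
  by rewrite /cL2_inner /= ip0 add0r (semi_innerC rP).
by rewrite /inorm /cL2_inner -!(sqr_inorm rP) e1 e2 expr0n addr0 sqrtr0.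
Qed.

(** Otherwise the dilates of e by exp t, for t real, are pairwise orthogonal of equal nonzero norm.
    Each of them meets one of countably many test vectors nontrivially, and this would make R
    countable. *)
Lemma dilation_correlation e : nrm e != 0 ->
  exists a, [/\ 0 < a, a != 1 & ip (rep (aWH_dil n a) e) e != 0].
Proof.
move=> e0; apply: contrapT => none; have cP := cL2_semi_inner leb.
have orth a : 0 < a -> a != 1 -> ip (rep (aWH_dil n a) e) e = 0.
  by move=> a0 a1; apply/eqP/negPn/negP => ne; apply: none; exists a.
have c0 : 0 < ip e e.
  by rewrite -(sqr_inorm cP) exprn_gt0// lt_neqAle eq_sym e0 inorm_ge0.
pose v (t : R) := rep (aWH_dil n (expR t)) e.
have Adil (t : R) : aWH_group (aWH_dil n (expR t)).
  by apply: aWH_group_dil; rewrite gt_eqF ?expR_gt0.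
have vv t : ip (v t) (v t) = ip e e by exact: rep_inner.
have vo s t : s != t -> ip (v s) (v t) = 0.
  move=> st; have AV : aWH_group (aWH_dil n (expR t)^-1).
    by apply: aWH_group_dil; rewrite invr_eq0 gt_eqF ?expR_gt0.
  rewrite -(orth (expR (s - t))) ?expR_gt0//; last first.
    by apply/eqP => /(congr1 (@ln R)); rewrite expRK ln1 => /eqP; rewrite subr_eq0 (negbTE st).
  rewrite [LHS](semi_innerC cP) /v (rep_adj _ _ (Adil t)) aWH_inv_dil ?gt_eqF ?expR_gt0//.
  rewrite -(rep_mul _ AV (Adil s)) [LHS](semi_innerC cP).
  by rewrite aWH_dilM -expRN -expRD addrC.
(* An index consists of a test vector and a threshold 1 / (N + 1); there are countably many, and by
   totality these sets cover R. *)
pose A (i : bool * 'M[(rat * rat)%type]_(n, 1) * nat) : set R :=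
  [set t | i.2.+1%:R^-1 < ip (test_cL2 i.1.1 i.1.2) (v t) ^+ 2].
(* By Bessel's inequality only finitely many of the orthogonal vectors v t have   *)
(* an inner product of a given size with a given test vector.                     *)
have finA i : finite_set (A i).
  apply: contrapT => infA; set u := test_cL2 i.1.1 i.1.2.
  (* Enough elements for their squared coefficients, each above the threshold, to exceed Bessel's
     bound. *)
  have [B BA Bm] := infinite_set_fset (Num.truncn (ip e e * ip u u * i.2.+1%:R)).+1 infA.
  have bB := bessel u cP c0 (finmap.fset_uniq B) vv vo.
  suff : \sum_(t <- finmap.enum_fset B) ip u (v t) ^+ 2 > ip e e * ip u u by rewrite ltNge bB.
  apply: (@lt_le_trans _ _ (\sum_(t <- finmap.enum_fset B) i.2.+1%:R^-1)); last first.
    by rewrite big_seq [leRHS]big_seq; apply: ler_sum => t tB; apply/ltW/BA.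
  rewrite big_const_seq count_predT iter_addr_0 -(mulr_natr _ (size (finmap.enum_fset B))).
  rewrite ltr_pdivlMl//.
  rewrite mulrC; apply: lt_le_trans (truncnS_gt _) _.
  by rewrite ler_nat.
have : countable [set: R].
  rewrite (_ : setT = \bigcup_i A i).
    by apply: bigcup_countable => // i _; exact: finite_set_countable.
  apply/esym; rewrite -subTset => t _.
  have /existsNP[b /existsNP[q /eqP bq]] : ~ forall b q, ip (test_cL2 b q) (v t) = 0.
    by move/test_cL2_total/eqP; rewrite rep_norm// (negbTE e0).
  have bq0 : 0 < ip (test_cL2 b q) (v t) ^+ 2 by rewrite exprn_even_gt0.
  have [N] := ltr_add_invr bq0; rewrite add0r => NP.
  by exists (b, q, N).
move=> cR; have : countable (`]0%R, 1%R[%classic : set R).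
  exact: sub_countable (subset_card_le (@subsetT _ _)) cR.
move/countable_lebesgue_measure0; rewrite lebesgue_measure_itv /= lte_fin ltr01 => /eqP.
by rewrite -EFinB subr0 eqe oner_eq0.
Qed.

End dilation_correlation.

(** * Compressed dilations and voice transforms *)

Section compressed_dilation.
Context (R : realType) (n : nat) (V : {vspace 'cV[R]_n}) (H : set 'M[R]_n).
Context (tcVH : translation_complete V H).
Local Notation leb := (lebesgue_cV R n).
Local Notation cL2 := (cL2 leb).
Local Notation ip := (@cL2_inner _ _ R leb).
Local Notation nrm := (inorm ip).
Local Notation G := (tc_group V H).
Context (S : set cL2) (cS : csubspace ip S).
Context (SG : forall g e, G g -> S e -> S (rep g e)).

Let cP := cL2_semi_inner leb.

Lemma cdil_exists a e : exists p : cL2,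
  S p /\ forall s, S s -> ip p s = ip (rep (aWH_dil n a) e) s.
Proof.
have [p Sp pe] := projection_exists cP (@cL2_complete _ _ R leb) cS (rep (aWH_dil n a) e).
exists p; split=> // s Ss; apply/eqP; rewrite eq_sym -subr_eq0.
by rewrite -(semi_innerNl cP) -(semi_innerDl cP) pe.
Qed.

(* P D_a, with adjoint [cdil a^-1] on S. *)
Definition cdil a e : cL2 := projT1 (cid (cdil_exists a e)).

Lemma cdil_in a e : S (cdil a e).
Proof. by rewrite /cdil; case: cid => p []. Qed.

Lemma cdilE a e s : S s -> ip (cdil a e) s = ip (rep (aWH_dil n a) e) s.
Proof. by rewrite /cdil; case: cid => p [Sp pe] /= /pe. Qed.

Section nonzero_scale.
Context (a : R) (a0 : a != 0).

Let Aa : aWH_group (aWH_dil n a) := aWH_group_dil n a0.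

Lemma cdil_adj e s : S e -> S s -> ip (cdil a e) s = ip e (cdil a^-1 s).
Proof.
move=> Se Ss; rewrite cdilE// (semi_innerC cP e) cdilE// (semi_innerC cP _ e).
by rewrite (rep_adj _ _ Aa) aWH_inv_dil.
Qed.

Lemma cdil_bounded : bounded_op ip S (cdil a) 1.
Proof.
split=> [e _|e f Se Sf|b e Se|e Se]; first exact: cdil_in.
- apply: (ip_eq_in cP cS); first exact: cdil_in.
    by apply: (csubspaceD cS); exact: cdil_in.
  move=> s Ss; rewrite [LHS](cdilE _ _ Ss) (repD Aa) !(semi_innerDl cP).
  by congr (_ + _); exact: esym (cdilE _ _ Ss).
- apply: (ip_eq_in cP cS); first exact: cdil_in.
    by apply: (csubspaceZ cS); exact: cdil_in.
  move=> s Ss; rewrite [LHS](cdilE _ _ Ss) (repZ Aa) !(semi_innerZl cP).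
  by congr (_ * _); exact: esym (cdilE _ _ Ss).
have := le_trans (ler_norm _) (cauchy_schwarz cP (rep (aWH_dil n a) e) (cdil a e)).
rewrite -cdilE; last exact: cdil_in.
rewrite -(sqr_inorm cP) rep_norm// mul1r expr2.
have := inorm_ge0 ip (cdil a e); rewrite le_eqVlt => /predU1P[<- _|d0].
  exact: inorm_ge0.
by rewrite ler_pM2r.
Qed.

(** Tested against S, the projection drops out, and pi(g) D_a = D_a pi(g^a) remains; invariance of S
    under g^-1 keeps the test vector in S. *)
Lemma cdil_comm g e : G g -> S e -> ip (cdil a (rep (aWH_conj a g) e)) = ip (rep g (cdil a e)).
Proof.
move=> Gg Se; have Ag := tc_group_aWH Gg.
have Gcg : G (aWH_conj a g) by apply/(tc_group_conj V H g a0).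
apply: (ip_eq_in cP cS); first exact: cdil_in.
  by apply: SG => //; exact: cdil_in.
move=> s Ss; rewrite (cdilE _ _ Ss) (rep_adj _ _ Ag) cdilE.
  2: by apply: SG => //; exact: tc_group_inv.
rewrite -(rep_adj _ _ Ag) -(rep_mul _ Aa (tc_group_aWH Gcg)) -(rep_mul _ Ag Aa).
by rewrite aWH_conjE.
Qed.

End nonzero_scale.

Section irreducible.
Context (irr : forall K, csubspace ip K -> K `<=` S -> (forall g e, G g -> K e -> K (rep g e)) ->
  (forall e, K e -> nrm e = 0) \/ S `<=` K).

(** The operator is B_a times its adjoint, so it is self-adjoint; it commutes with pi because
    conjugation by 1/a followed by conjugation by a is trivial. *)
Lemma cdil_schur (a : R) : a != 0 ->
  exists s, forall e, S e -> ip (cdil a (cdil a^-1 e)) = ip (s *: e).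
Proof.
move=> a0; have aV0 : a^-1 != 0 by rewrite invr_eq0.
pose U (i : {g | G g}) := @rep R n (sval i).
have bU i : bounded_op ip S (U i) 1.
  case: i => g Gg; have Ag := tc_group_aWH Gg; split=> [e Se|e f _ _|b e _|e _] /=.
  - exact: SG.
  - by rewrite /U /= (repD Ag).
  - by rewrite /U /= (repZ Ag).
  - by rewrite /U /= rep_norm// mul1r.
apply: (schur cP cS (@cL2_complete _ _ R leb) bU) => [K cK KS KU|].
  by apply: irr => // g e Gg; exact: (KU (exist _ g Gg)).
split.
- have := bounded_op_comp cP cS ler01 (cdil_bounded a0) (cdil_bounded aV0); rewrite mulr1 => bA.
  exact: bA.
- move=> e f Se Sf; rewrite (cdil_adj a0 (cdil_in _ _) Sf) (cdil_adj aV0 Se (cdil_in _ _)).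
  by rewrite invrK.
case=> g Gg e Se; rewrite /U /= -(cdil_comm a0 Gg (cdil_in _ _)).
apply: (bounded_op_eq cP cS (cdil_bounded a0)).
- by apply: SG; [apply/(tc_group_conj V H g a0)|exact: cdil_in].
- exact: cdil_in.
rewrite -[in RHS](aWH_conjK g aV0) invrK.
by rewrite (cdil_comm aV0 _ Se)//; apply/(tc_group_conj V H g a0).
Qed.

(** Schur's lemma gives B_a B_(1/a) = s and B_(1/a) B_a = t. Here t > 0 because <B_a e0, e0> = <D_a
    e0, e0> is nonzero for the chosen a. *)
Lemma cdil_norm e0 : S e0 -> nrm e0 != 0 ->
  exists a s, [/\ 0 < a, a != 1, 0 < s &
    forall e, S e -> ip (cdil a e) (cdil a e) = s * ip e e /\
      ip (cdil a^-1 e) (cdil a^-1 e) = s * ip e e].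
Proof.
move=> Se0 e00; have [a [ap a1 corr]] := dilation_correlation e00.
have a0 : a != 0 by rewrite gt_eqF.
have aV0 : a^-1 != 0 by rewrite invr_eq0.
have [s sE] := cdil_schur a0; have [t] := cdil_schur aV0; rewrite invrK => tE.
have sN e : S e -> ip (cdil a^-1 e) (cdil a^-1 e) = s * ip e e.
  move=> Se; rewrite (cdil_adj aV0 Se (cdil_in _ _)) invrK [LHS](semi_innerC cP).
  by rewrite (sE _ Se) (semi_innerZl cP).
have tN e : S e -> ip (cdil a e) (cdil a e) = t * ip e e.
  move=> Se; rewrite (cdil_adj a0 Se (cdil_in _ _)) [LHS](semi_innerC cP).
  by rewrite (tE _ Se) (semi_innerZl cP).
have p0 : 0 < ip e0 e0.
  by rewrite -(sqr_inorm cP) exprn_gt0// lt_neqAle eq_sym e00 inorm_ge0.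
have t0 : 0 < t.
  suff : 0 < t * ip e0 e0 by rewrite pmulr_lgt0.
  rewrite -(tN _ Se0) -(sqr_inorm cP) exprn_gt0// lt_neqAle eq_sym inorm_ge0 andbT.
  apply: contraNneq corr => d0; rewrite -(cdilE _ _ Se0) -normr_le0.
  by rewrite (le_trans (cauchy_schwarz cP _ _))// d0 mul0r.
(* The squared norm of y = B_(1/a) B_a e0 is s t |e0|^2 by [sN] and t^2 |e0|^2 by [tE]. *)
have st : s = t.
  have sy := sN _ (cdil_in a e0); have := tE _ Se0.
  set y := cdil a^-1 (cdil a e0) in sy * => yE.
  have yy : ip y y = t * (t * ip e0 e0).
    by rewrite {1}yE (semi_innerZl cP) (semi_innerC cP) yE (semi_innerZl cP).
  have := etrans (esym (congr1 ( *%R s) (tN _ Se0))) (etrans (esym sy) yy).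
  rewrite !mulrA.
  by move/(mulIf (lt0r_neq0 p0))/(mulIf (lt0r_neq0 t0)).
exists a, t; split; [exact: ap|exact: a1|exact: t0|move=> e Se].
split; first exact: tN.
by rewrite (sN _ Se) st.
Qed.

End irreducible.

End compressed_dilation.

Section voice_transforms.
Context (R : realType) (n : nat) (V : {vspace 'cV[R]_n}) (H : set 'M[R]_n).
Context (tcVH : translation_complete V H).
Local Notation leb := (lebesgue_cV R n).
Local Notation cL2 := (cL2 leb).
Local Notation ip := (@cL2_inner _ _ R leb).
Local Notation nrm := (inorm ip).
Local Notation G := (tc_group V H).
Implicit Types (e f psi : cL2).

Let cP := cL2_semi_inner leb.
Let rP := rL2_semi_inner leb.

Lemma cL2_inner_rot e f : ip e (cL2_rot f) = - ip (cL2_rot e) f.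
Proof.
rewrite /cL2_inner /= (semi_innerNl rP) (semi_innerC rP e.1) (semi_innerNl rP).
by rewrite opprD opprK addrC (semi_innerC rP f.2) addrC.
Qed.

(** The torus contains i, so every G-invariant real subspace is stable under multiplication by i. *)
Lemma tc_group_i : G ('i, 0, 0, 1%:M).
Proof.
split; last exact: (GL_subgroup1 (proj1 tcVH)); last exact: mem0v.
split; last exact: unitmx1.
by rewrite normc_def /= expr0n expr1n add0r sqrtr1.
Qed.

Lemma rep_i e : rep ('i, 0, 0, 1%:M) e = cL2_rot e.
Proof.
apply: cfun_inj; rewrite (cfun_rep (tc_group_aWH tc_group_i)) cL2_rotE cfun_scale.
by rewrite -[in RHS](quasi_regular_one (cfun e)); apply/funext => y; rewrite /= mul1r.
Qed.

Definition normc2 (z : R[i]) : R := complex.Re z ^+ 2 + complex.Im z ^+ 2.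

Lemma normc2_ge0 z : 0 <= normc2 z.
Proof. by rewrite addr_ge0 ?sqr_ge0. Qed.

Lemma normc2M z w : normc2 (z * w) = normc2 z * normc2 w.
Proof. by case: z w => [a b] [c d]; rewrite /normc2 /=; ring. Qed.

Lemma normc2_gt0 z : z != 0 -> 0 < normc2 z.
Proof.
case: z => a b; rewrite eq_complex /= negb_and => ab.
by rewrite lt_neqAle normc2_ge0 andbT eq_sym /normc2 /= paddr_eq0 ?sqr_ge0// !sqrf_eq0
  negb_and.
Qed.

Lemma measurable_normc2 d (T : measurableType d) (f : T -> R[i]) :
  measurable_fun setT f -> measurable_fun setT (fun x => normc2 (f x)).
Proof.
move=> /measurable_complexP[mRe mIm].
by apply: measurable_funD; exact: measurable_funX.
Qed.

Lemma voice_transformE psi f g : G g ->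
  voice_transform G (cfun psi) (cfun f) g = cL2_cinner f (rep g psi).
Proof.
move=> Gg; rewrite /voice_transform mem_set// -(cfun_rep (tc_group_aWH Gg)).
exact: inner_cfun.
Qed.

Lemma sqr_voice_transform psi f g : G g ->
  normc2 (voice_transform G (cfun psi) (cfun f) g) =
  ip f (rep g psi) ^+ 2 + ip f (cL2_rot (rep g psi)) ^+ 2.
Proof. by move=> Gg; rewrite voice_transformE. Qed.

Section invariant_subspace.
Context (S : set cL2) (cS : csubspace ip S).
Context (SG : forall g e, G g -> S e -> S (rep g e)).

Lemma rot_in e : S e -> S (cL2_rot e).
Proof. by move=> Se; rewrite -rep_i; apply: SG => //; exact: tc_group_i. Qed.

Local Notation cdil := (cdil cS).

(** The projection disappears against a vector of S; moving D_(1/a) to the other side gives D_a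
    pi(g^a) f = pi(g) D_a f, and then pi(g) is moved back. *)
Lemma cdilV_conj a psi f g : a != 0 -> G g -> S f ->
  ip (cdil a^-1 psi) (rep (aWH_conj a g) f) = ip (rep (aWH_inv g) psi) (rep (aWH_dil n a) f).
Proof.
move=> a0 Gg Sf; have aV0 : a^-1 != 0 by rewrite invr_eq0.
have Gcg : G (aWH_conj a g) by apply/(tc_group_conj V H g a0).
rewrite (cdilE _ _ _ (SG Gcg Sf)) (rep_adj _ _ (aWH_group_dil n aV0)) (aWH_inv_dil n aV0) invrK.
rewrite -(rep_mul _ (aWH_group_dil n a0) (tc_group_aWH Gcg)) -(aWH_conjE g a0).
rewrite (rep_mul _ (tc_group_aWH Gg) (aWH_group_dil n a0)) [LHS](semi_innerC cP).
by rewrite (rep_adj _ _ (tc_group_aWH Gg)) [LHS](semi_innerC cP).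
Qed.

(** The two transforms are complex conjugates of each other: the real parts agree, and the imaginary
    parts are opposite because multiplication by i is skew-adjoint. *)
Lemma voice_dilation a psi g : a != 0 -> G g -> S psi ->
  normc2 (voice_transform G (cfun psi) (cfun (cdil a^-1 psi)) (aWH_conj a g)) =
  normc2 (voice_transform G (cfun psi) (cfun (cdil a psi)) (aWH_inv g)).
Proof.
move=> a0 Gg Spsi.
have Gcg : G (aWH_conj a g) by apply/(tc_group_conj V H g a0).
have GV := tc_group_inv tcVH Gg.
have re : ip (cdil a^-1 psi) (rep (aWH_conj a g) psi) = ip (cdil a psi) (rep (aWH_inv g) psi).
  apply: etrans (cdilV_conj _ a0 Gg Spsi) _; apply: etrans (semi_innerC cP _ _) _.
  exact: esym (cdilE _ _ _ (SG GV Spsi)).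
have im : ip (cdil a^-1 psi) (cL2_rot (rep (aWH_conj a g) psi)) =
    - ip (cdil a psi) (cL2_rot (rep (aWH_inv g) psi)).
  rewrite -(rep_rot (tc_group_aWH Gcg)); apply: etrans (cdilV_conj _ a0 Gg (rot_in Spsi)) _.
  rewrite (rep_rot (aWH_group_dil n a0)) cL2_inner_rot; congr (- _).
  apply: etrans (semi_innerC cP _ _) _; exact: esym (cdilE _ _ _ (rot_in (SG GV Spsi))).
apply: etrans (sqr_voice_transform _ _ Gcg) (etrans _ (esym (sqr_voice_transform _ _ GV))).
have sqD (x y x' y' : R) : x = x' -> y = - y' -> x ^+ 2 + y ^+ 2 = x' ^+ 2 + y' ^+ 2.
  by move=> -> ->; rewrite sqrrN.
exact: sqD re im.
Qed.

End invariant_subspace.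
End voice_transforms.

(** * Transfer between functions and [cL2], and the final computation *)

Lemma expr_div_eq1 (R : realFieldType) (a : R) (k n : nat) :
  0 < a -> (k < n)%N -> a ^+ n / a ^+ k = 1 -> a = 1.
Proof.
by move=> a0 kn; rewrite -expfB// => /eqP; rewrite pexpr_eq1 ?subn_gt0 ?ltW// => /eqP.
Qed.

Section square_integrals.
Context d (T : measurableType d) (R : realType) (mu : {measure set T -> \bar R}).

Lemma integral_normc2 (f : T -> R[i]) (x : R) : 0 <= x -> L2norm mu f = x%:E ->
  (\int[mu]_t (normc2 (f t))%:E = (x ^+ 2)%:E)%E.
Proof.
move=> x0; rewrite L2normE => fx.
have I0 : (0 <= \int[mu]_t (normc2 (f t))%:E)%E.
  by apply: integral_ge0 => t _; rewrite lee_fin normc2_ge0.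
rewrite -powR_mulrn// -poweR_EFin -fx -poweRrM mulVf ?pnatr_eq0// poweRe1//.
Qed.

Lemma inner0l (f : T -> R[i]) : inner mu (fun=> 0) f = 0.
Proof.
rewrite /inner (_ : (fun x => _) = fun=> 0); last by apply/funext => x; rewrite mul0r.
by rewrite /cintegral /Rintegral integral0.
Qed.

End square_integrals.

Section subspace_transfer.
Context (R : realType) (n : nat) (V : {vspace 'cV[R]_n}) (H : set 'M[R]_n).
Context (tcVH : translation_complete V H).
Local Notation leb := (lebesgue_cV R n).
Local Notation cL2 := (cL2 leb).
Local Notation ip := (@cL2_inner _ _ R leb).
Local Notation nrm := (inorm ip).
Local Notation G := (tc_group V H).

Lemma closed_subspace_csubspace (S : set ('cV[R]_n -> R[i])) : closed_subspace leb S ->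
  csubspace ip [set e : cL2 | S (cfun e)].
Proof.
move=> [SL S0 SD SZ Scl]; split=> [|e f Se Sf|a e Se|e small] /=.
- exact: S0.
- by rewrite cfunD; exact: SD.
- by rewrite cfunZ; exact: SZ.
apply: Scl; first exact: cfun_L2.
move=> r r0; have [f Sf ef] := small r r0.
by exists (cfun f) => //; rewrite -cfunB L2norm_cfun lte_fin.
Qed.

Lemma csubspace_closed_subspace (K : set cL2) : csubspace ip K ->
  (forall e, K e -> K (cL2_rot e)) -> closed_subspace leb (@cfun _ _ R leb @` K).
Proof.
move=> cK Krot; split.
- by move=> _ [e _ <-]; exact: cfun_L2.
- by exists 0 => //; exact: (csubspace0 cK).
- by move=> _ _ [e Ke <-] [f Kf <-]; exists (e + f) => //; exact: (csubspaceD cK).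
- move=> a _ [e Ke <-]; exists (cL2_scale a e); last exact: cfun_scale.
  by apply: (csubspaceD cK); apply: (csubspaceZ cK) => //; exact: Krot.
move=> f fL small; exists (to_cL2 leb f); last exact: to_cL2K.
apply: (csubspace_closed cK) => r r0; have [_ [e Ke <-] fe] := small r r0.
exists e => //; rewrite -lte_fin -L2norm_cfun cfunB to_cL2K//.
Qed.

(** An invariant real subspace is complex by [rep_i], so irreducibility over C applies to it. *)
Lemma irreducible_csubspace (S : set ('cV[R]_n -> R[i])) : irreducible_on G S ->
  forall K, csubspace ip K -> K `<=` [set e | S (cfun e)] ->
    (forall g e, G g -> K e -> K (rep g e)) ->
  (forall e, K e -> nrm e = 0) \/ [set e | S (cfun e)] `<=` K.
Proof.
move=> [_ irr] K cK KS KG.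
have Krot e : K e -> K (cL2_rot e).
  by move=> Ke; rewrite -(rep_i tcVH); apply: KG => //; exact: tc_group_i.
have [] := irr _ (csubspace_closed_subspace cK Krot).
- move=> g _ Gg [e Ke <-]; exists (rep g e); first exact: KG.
  exact: cfun_rep (tc_group_aWH Gg) e.
- by move=> _ [e Ke <-]; exact: KS.
- move=> K0; left=> e Ke; apply: EFin_inj; rewrite -L2norm_cfun; apply: K0; by exists e.
by move=> <-; right=> _ [e Ke /cfun_inj <-].
Qed.

End subspace_transfer.

Theorem corollary4p12 (R : realType) (n : nat) (V : {vspace 'cV[R]_n})
    (H : set 'M[R]_n) (mu : {measure set (aWH R n) -> \bar R}) :
  translation_complete V H ->
  V <> fullv ->
  left_Haar (tc_group V H) mu ->
  unimodular (tc_group V H) ->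
  ~ exists S : set ('cV[R]_n -> R[i]), discrete_series (tc_group V H) mu S.
Proof.
move=> tcVH Vfull muH /(_ mu muH) muR [S [cS SG irr [psi0 [Spsi0 [c [W [c0 [WL Wiso] WE]]]]]]].
have [k [B [C [kn CB VB]]]] := vspace_matrix Vfull.
set leb := lebesgue_cV R n in cS irr Spsi0 WL Wiso.
set G := tc_group V H in SG irr WE.
pose ip := @cL2_inner _ _ R leb; have cP : semi_inner ip := cL2_semi_inner leb.
pose S' : set (cL2 leb) := [set e | S (cfun e)].
have cS' : csubspace ip S' := closed_subspace_csubspace cS.
have SG' g e : G g -> S' e -> S' (rep g e).
  by move=> Gg Se; rewrite /S' /= (cfun_rep (tc_group_aWH Gg)); exact: SG.
have irr' := irreducible_csubspace tcVH irr.
pose psi : cL2 leb := to_cL2 leb psi0.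
have psiE : cfun psi = psi0 by apply: to_cL2K; exact: (closed_subspace_L2 cS).
have Spsi : S' psi by rewrite /S' /= psiE.
pose v (e : cL2 leb) g := normc2 (voice_transform G (cfun psi) (cfun e) g).
(* W is only assumed to preserve distances; since it sends 0 to 0, it preserves norms. *)
have W0 g : W (fun=> 0) g = 0.
  have := congr1 (@^~ g) (WE _ (closed_subspace0 cS)); rewrite /voice_transform /=.
  suff -> : (if g \in G then inner leb (fun=> 0) (quasi_regular g psi0) else 0) = 0.
    by move/esym/eqP; rewrite mulf_eq0 (negbTE c0) => /eqP.
  by case: ifP => // _; rewrite inner0l.
have vW e g : S' e -> v e g = normc2 c * normc2 (W (cfun e) g).
  by move=> Se; rewrite /v psiE (WE _ Se) normc2M.
have mv e : S' e -> measurable_fun setT (fun g => (v e g)%:E).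
  move=> Se; apply/measurable_EFinP; rewrite /v psiE (WE _ Se).
  under eq_fun do rewrite normc2M.
  apply: measurable_funM; first exact: measurable_cst.
  by apply: measurable_normc2; have [] := WL _ Se.
have v0 e g : (0 <= (v e g)%:E)%E by rewrite lee_fin normc2_ge0.
have iv e : S' e -> (\int[mu]_g (v e g)%:E = (normc2 c * ip e e)%:E)%E.
  move=> Se; under eq_integral do rewrite (vW _ _ Se) EFinM.
  rewrite ge0_integralZl//; last 3 first.
  - by apply/measurable_EFinP; apply: measurable_normc2; have [] := WL _ Se.
  - by move=> g _; rewrite lee_fin normc2_ge0.
  - by rewrite lee_fin normc2_ge0.
  rewrite (integral_normc2 (inorm_ge0 ip e)) ?(sqr_inorm cP)//.
  rewrite -L2norm_cfun.
  have := Wiso _ _ Se (closed_subspace0 cS).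
  rewrite (_ : W _ \- _ = W (cfun e)); last by apply/funext => g; rewrite /= W0 subr0.
  by rewrite (_ : cfun e \- _ = cfun e)//; apply/funext => x; rewrite /= subr0.
have cc : 0 < normc2 c by exact: normc2_gt0.
(* If psi were null, all voice transforms would vanish, and by [iv] every vector of S would be
   null. *)
have psi_neq0 : inorm ip psi != 0.
  apply/eqP => psi00; case: irr => + _; apply=> f Sf.
  have fE : cfun (to_cL2 leb f) = f by apply: to_cL2K; exact: (closed_subspace_L2 cS).
  set e := to_cL2 leb f in fE; have Se : S' e by rewrite /S' /= fE.
  have ip0 (x : cL2 leb) : inorm ip x = 0 -> ip e x = 0.
    move=> x0; apply/eqP; rewrite -normr_le0.
    by rewrite (le_trans (cauchy_schwarz cP e x))// x0 mulr0.
  have ve g : v e g = 0.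
    rewrite /v; have [Gg|Gg] := pselect (G g); last first.
      by rewrite /voice_transform memNset// /normc2 /= expr0n addr0.
    have Ag := tc_group_aWH Gg.
    rewrite (sqr_voice_transform _ _ Gg) -!/(ip _ _) !ip0 ?expr0n ?addr0//.
      by rewrite -(rep_i tcVH) (rep_norm (tc_group_aWH (tc_group_i tcVH))) (rep_norm Ag).
    by rewrite (rep_norm Ag).
  have := iv _ Se; under eq_integral do rewrite ve.
  rewrite integral0 => -[/esym/eqP]; rewrite mulf_eq0 (gt_eqF cc) /= => /eqP ee0.
  by rewrite -fE L2norm_cfun /inorm -/ip ee0 sqrtr0.
have [a [s [a0 a1 s0 sE]]] := cdil_norm tcVH cS' SG' irr' Spsi psi_neq0.
have an0 : a != 0 by rewrite gt_eqF.
have [sa sV] := sE _ Spsi.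
have Sa b : S' (cdil cS' b psi) := cdil_in cS' b psi.
have Ea := etrans (iv _ (Sa a)) (f_equal (fun x => (normc2 c * x)%:E) sa).
have EV := etrans (iv _ (Sa a^-1)) (f_equal (fun x => (normc2 c * x)%:E) sV).
have minv := mgroup_measurable_inv (tc_measurable_group tcVH VB).
have vv : (\int[mu]_g (v (cdil cS' a^-1 psi) (aWH_conj a g))%:E =
        \int[mu]_g (v (cdil cS' a psi) (aWH_inv g))%:E)%E.
  apply: (eq_integral_carrier (tc_measurable_group tcVH VB) (Haar_carrier muH)).
  - exact: measurableT_comp (mv _ (Sa a^-1)) (@measurable_aWH_conj R n a).
  - exact: measurableT_comp (mv _ (Sa a)) minv.
  - by move=> g; exact: v0.
  - by move=> g; exact: v0.
  move=> g Gg.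
  have vd : v (cdil cS' a^-1 psi) (aWH_conj a g) = v (cdil cS' a psi) (aWH_inv g).
    rewrite /v. exact: (voice_dilation tcVH cS' SG' an0 Gg Spsi).
  exact (f_equal (fun r : R => r%:E) vd).
have HV := Haar_conj tcVH CB VB muH muR a0 (mv _ (Sa a^-1)) (v0 _).
have Hi := Haar_inv tcVH CB VB muH muR (mv _ (Sa a)) (v0 _).
(* This chain gives a^n / a^k times the integral for B_(1/a) psi equal to the integral for B_a psi;
   both integrals are |c|^2 s |psi|^2, which is nonzero and cancels. *)
have := etrans (esym HV) (etrans vv (etrans Hi Ea)).
move=> /(etrans (esym (congr1 ( *%E (a ^+ n / a ^+ k)%:E) EV))).
rewrite -EFinM => -[].
have p0 : 0 < ip psi psi.
  have : 0 < inorm ip psi by rewrite lt0r psi_neq0 inorm_ge0.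
  by move/(exprn_gt0 2); rewrite (sqr_inorm cP psi).
have x0 := lt0r_neq0 (mulr_gt0 cc (mulr_gt0 s0 p0)).
rewrite -[X in _ = X]mul1r => /(mulIf x0).
by move/(expr_div_eq1 a0 kn)/eqP; rewrite (negbTE a1).
Qed.
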